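(* Let $n\geq 1$. For any countable ordinal $\lambda\geq 1$, there exists a based $n$-dimensional Peano continuum $(X_{\lambda},x_{\lambda})$ such that $\mathbf{wrk}_n(X_{\lambda})=\lambda$ and $\mathbf{w}_n^{\lambda}(X_{\lambda})=\emptyset$. Moreover, when $\lambda\geq 2$ is a successor ordinal, we may arrange for $\mathbf{w}_n^{\lambda-1}(X_{\lambda})=\{x_{\lambda}\}$.
   Context: All topological spaces are Hausdorff and ''map'' means continuous function. A continuum is a compact metrizable space; a Peano continuum is a path-connected and locally path-connected continuum. Dimension is Lebesgue covering dimension. $S^n$ is the unit $n$-sphere with basepoint $s_0=(1,0,\dots,0)$. A map $f:S^n\to X$ is essential if it is not null-homotopic. A sequence of maps $f_k:S^n\to X$, $k\in\mathbb{N}$, converges to $x\in X$ if for every neighborhood $U$ of $x$ there is $K$ with $\mathrm{Im}(f_k)\subseteq U$ for all $k\geq K$. The $\pi_n$-wild set $\mathbf{w}_n(X)$ of a space $X$ is the subspace of all points $x\in X$ for which there is a sequence of essential based maps $f_k:(S^n,s_0)\to (X,x)$ converging to $x$. Iterated wild sets are defined by transfinite recursion: $\mathbf{w}_n^0(X)=X$, $\mathbf{w}_n^{\kappa+1}(X)=\mathbf{w}_n(\mathbf{w}_n^{\kappa}(X))$ (where $\mathbf{w}_n^{\kappa}(X)$ has the subspace topology), and $\mathbf{w}_n^{\kappa}(X)=\bigcap_{\mu<\kappa}\mathbf{w}_n^{\mu}(X)$ for limit ordinals $\kappa$. The $\pi_n$-wild rank $\mathbf{wrk}_n(X)$ is the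 smallest ordinal $\kappa_0$ such that $\mathbf{w}_n^{\kappa_0}(X)=\mathbf{w}_n^{\kappa}(X)$ for all $\kappa\geq\kappa_0$. For a successor ordinal $\lambda=\mu+1$, $\lambda-1$ denotes $\mu$. *)

(* Defs.v *)
From HB Require Import structures.
From mathcomp Require Import all_boot all_order all_algebra generic_quotient.
From mathcomp Require Import all_classical all_reals all_analysis.
From mathcomp Require Import homotopy.

Set Implicit Arguments.
Unset Strict Implicit.
Unset Printing Implicit Defensive.

Import Order.TTheory GRing.Theory Num.Theory.
Import numFieldNormedType.Exports.

Local Open Scope classical_set_scope.
Local Open Scope ring_scope.
Local Open Scope quotient_scope.

(* Ordinals: a well-founded tree [onode f] stands for the ordinal
   sup_i (f i + 1); trees with the same rank are identified in [Ord]. *)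

Inductive otree : Type := onode (I : Type) (f : I -> otree).

Fixpoint otree_le (s t : otree) : Prop :=
  let: onode A f := s in let: onode B g := t in
  forall a : A, exists b : B, otree_le (f a) (g b).

Lemma otree_le_refl t : otree_le t t.
Proof. by elim: t => A f IH /= i; exists i. Qed.

Lemma otree_le_trans s t u : otree_le s t -> otree_le t u -> otree_le s u.
Proof.
elim: s t u => A f IH [J g] [K h] st tu i.
by have [j ij] := st i; have [k jk] := tu j; exists k; exact: IH ij jk.
Qed.

Definition otree_lt (s t : otree) : Prop :=
  let: onode J g := t in exists j : J, otree_le s (g j).

Lemma otree_lt_wf : well_founded otree_lt.
Proof.
suff H t : forall s, otree_le s t -> Acc otree_lt s.
  by move=> t; exact: H (otree_le_refl t).
elim: t => J g IH [A f] st; constructor=> r [i ri].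
by have [j ij] := st i; exact: IH (otree_le_trans ri ij).
Qed.

Lemma otree_leP (A : Type) (f : A -> otree) t :
  otree_le (onode f) t <-> forall a, otree_lt (f a) t.
Proof. by case: t. Qed.

Lemma otree_nle_lt s t : ~ otree_le s t -> otree_lt t s.
Proof.
elim: s t => A f IH t /otree_leP/existsNP[a fat]; exists a.
by case: t fat => B g fat; apply/otree_leP => b; apply: IH => fagb; apply: fat; exists b.
Qed.

Lemma otree_lt_le s t : otree_lt s t -> otree_le s t.
Proof.
elim: t s => B g IH [A f] [b /otree_leP sb] a.
by exists b; exact: IH (sb a).
Qed.

Lemma otree_ltNge s t : otree_lt s t <-> ~ otree_le t s.
Proof.
split=> [st ts|]; last exact: otree_nle_lt.
have ss : otree_lt s s.
  by case: t st ts => B g [b sb] /otree_leP/(_ b); case: s sb => A f sb [a ga];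
    exists a; exact: otree_le_trans sb ga.
clear st ts; revert s ss; apply: (well_founded_ind otree_lt_wf) => r IH rr.
exact: (IH r rr rr).
Qed.

Lemma otree_le_total s t : otree_le s t \/ otree_le t s.
Proof.
have [|nst] := pselect (otree_le s t); [by left | right].
exact/otree_lt_le/otree_nle_lt.
Qed.

HB.instance Definition _ := gen_eqMixin otree.
HB.instance Definition _ := gen_choiceMixin otree.

Definition otree_equiv : rel otree :=
  fun s t => `[< otree_le s t /\ otree_le t s >].

Lemma otree_equiv_refl : reflexive otree_equiv.
Proof. by move=> t; apply/asboolP; split; exact: otree_le_refl. Qed.

Lemma otree_equiv_sym : symmetric otree_equiv.
Proof. by move=> s t; apply/asboolP/asboolP => -[]. Qed.

Lemma otree_equiv_trans : transitive otree_equiv.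
Proof.
move=> t s u /asboolP[st ts] /asboolP[tu ut]; apply/asboolP.
by split; [exact: otree_le_trans st tu | exact: otree_le_trans ut ts].
Qed.

Canonical otree_equiv_rel :=
  EquivRel otree_equiv otree_equiv_refl otree_equiv_sym otree_equiv_trans.

Definition Ord : Type := {eq_quot otree_equiv}.

HB.instance Definition _ := Choice.on Ord.
HB.instance Definition _ := EqQuotient.on Ord.

Definition ord_le (a b : Ord) : bool := `[< otree_le (repr a) (repr b) >].

Lemma ord_le_refl : reflexive ord_le.
Proof. by move=> a; apply/asboolP; exact: otree_le_refl. Qed.

Lemma ord_le_anti : antisymmetric ord_le.
Proof.
move=> a b /andP[/asboolP ab /asboolP ba].
by rewrite -[a]reprK -[b]reprK; apply/eqquotP/asboolP.
Qed.

Lemma ord_le_trans : transitive ord_le.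
Proof.
move=> b a c /asboolP ab /asboolP bc; apply/asboolP.
exact: otree_le_trans ab bc.
Qed.

Lemma ord_le_total : total ord_le.
Proof.
move=> a b; have [h|h] := otree_le_total (repr a) (repr b); apply/orP.
  by left; apply/asboolP.
by right; apply/asboolP.
Qed.

Fact ord_display : Order.disp_t. Proof. exact: (Order.Disp tt tt). Qed.

HB.instance Definition _ := Order.Le_isPOrder.Build ord_display Ord
  ord_le_refl ord_le_anti ord_le_trans.
HB.instance Definition _ := Order.POrder_isTotal.Build ord_display Ord
  ord_le_total.

Definition Ord0 : Ord := \pi_Ord (onode (fun i : False => match i with end)).

Definition OrdS (a : Ord) : Ord := \pi_Ord (onode (fun _ : unit => repr a)).

Definition ord_limit (a : Ord) := a <> Ord0 /\ ~ exists b, a = OrdS b.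

Lemma repr_pi_ord (t : otree) :
  otree_le (repr (\pi_Ord t)) t /\ otree_le t (repr (\pi_Ord t)).
Proof.
have /eqquotP /asboolP // : repr (\pi_Ord t) = t %[mod Ord] by rewrite reprK.
Qed.

Lemma ord_ltE (a b : Ord) : (a < b)%O <-> otree_lt (repr a) (repr b).
Proof.
rewrite ltNge; split; first by move=> /negP h; apply/otree_ltNge => /asboolP.
by move=> /otree_ltNge h; apply/negP => /asboolP.
Qed.

Lemma ord_lt_wf : well_founded (fun a b : Ord => (a < b)%O).
Proof.
suff H t : forall a : Ord, repr a = t -> Acc (fun a b : Ord => (a < b)%O) a.
  by move=> a; exact: H erefl.
move: t; apply: (well_founded_ind otree_lt_wf) => t IH a at_.
by constructor=> b /ord_ltE; rewrite at_ => bt; exact: (IH _ bt b erefl).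
Qed.

Lemma ord_le0x (a : Ord) : (Ord0 <= a)%O.
Proof.
apply/asboolP; apply: otree_le_trans (proj1 (repr_pi_ord _)) _.
by case: (repr a) => A f [].
Qed.

Lemma ord_ltS (a b : Ord) : (a < OrdS b)%O = (a <= b)%O.
Proof.
apply/idP/asboolP => [/ord_ltE|ab].
  have := proj1 (repr_pi_ord (onode (fun _ : unit => repr b))).
  rewrite -/(OrdS b); case: (repr (OrdS b)) => J g gb [j aj].
  by have [_ jb] := gb j; exact: otree_le_trans aj jb.
apply/ord_ltE.
have := proj2 (repr_pi_ord (onode (fun _ : unit => repr b))).
rewrite -/(OrdS b); case: (repr (OrdS b)) => J g /(_ tt)[j bj].
by exists j; exact: otree_le_trans ab bj.
Qed.

Lemma ltOrdS (a : Ord) : (a < OrdS a)%O.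
Proof. by rewrite ord_ltS. Qed.

Lemma OrdS_neq0 (a : Ord) : OrdS a <> Ord0.
Proof. by move=> a0; have := ltOrdS a; rewrite a0 ltNge ord_le0x. Qed.

Lemma OrdS_inj : injective OrdS.
Proof.
move=> a b ab; apply/le_anti/andP.
by split; rewrite -ord_ltS; [rewrite -ab | rewrite ab]; exact: ltOrdS.
Qed.

Lemma ord_strict_sup (I : Type) (F : I -> Ord) : exists a : Ord,
  forall b : Ord, (a <= b)%O <-> forall i, (F i < b)%O.
Proof.
pose t := onode (fun i => repr (F i)).
have [at1 at2] := repr_pi_ord t.
exists (\pi_Ord t) => b; split.
  move=> /asboolP ab i; apply/ord_ltE; have := otree_le_trans at2 ab.
  by rewrite /t; case: (repr b) => J g; exact.
move=> h; apply/asboolP; apply: (otree_le_trans at1); rewrite /t.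
have {}h i : otree_lt (repr (F i)) (repr b) by apply/ord_ltE.
by move: h; case: (repr b) => J g.
Qed.

Section peano_continua.
Context {R : realType}.

Definition unit_interval : Type := (`[0%R, 1%R]%classic : set R).

HB.instance Definition _ := Topological.on unit_interval.

Lemma unit_interval0_subproof : (0 : R) \in `[0, 1]%classic.
Proof. by rewrite inE /= in_itv /= lexx ler01. Qed.

Lemma unit_interval1_subproof : (1 : R) \in `[0, 1]%classic.
Proof. by rewrite inE /= in_itv /= ler01 lexx. Qed.

Definition unit_interval0 : unit_interval := SigSub unit_interval0_subproof.
Definition unit_interval1 : unit_interval := SigSub unit_interval1_subproof.

Lemma unit_interval01 : unit_interval0 != unit_interval1.
Proof. by apply/eqP => /(congr1 val)/eqP; rewrite /= eq_sym oner_eq0. Qed.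

HB.instance Definition _ := isBiPointed.Build unit_interval unit_interval01.

Definition path_connected (X : topologicalType) (A : set X) :=
  forall x y, A x -> A y ->
  exists p : {path unit_interval from x to y in X}, range p `<=` A.

Definition locally_path_connected (X : topologicalType) :=
  forall (x : X) (U : set X), nbhs x U ->
  exists V : set X, [/\ open_nbhs x V, path_connected V & V `<=` U].

Definition metrizable (X : topologicalType) :=
  exists (M : metricType R) (f : X -> M) (g : M -> X),
    [/\ continuous f, continuous g, cancel f g & cancel g f].

Definition continuum (X : topologicalType) :=
  compact [set: X] /\ metrizable X.

Definition peano_continuum (X : topologicalType) :=
  [/\ continuum X, path_connected [set: X] & locally_path_connected X].

End peano_continua.
Arguments unit_interval : clear implicits.
Arguments path_connected R {X} A.
Arguments locally_path_connected : clear implicits.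
Arguments metrizable : clear implicits.
Arguments continuum : clear implicits.
Arguments peano_continuum : clear implicits.

Section covering_dimension.
Context {X : topologicalType}.

Definition open_cover (C : set (set X)) :=
  C `<=` open /\ \bigcup_(A in C) A = setT.

Definition covering_dim_le (n : nat) :=
  forall C : set (set X), finite_set C -> open_cover C ->
  exists D : set (set X),
    [/\ open_cover D,
        forall B, D B -> exists2 A, C A & B `<=` A &
        forall x, ([set B | D B /\ B x] #<= `I_n.+1)%card].

(* The value -1 of the empty space is not represented. *)
Definition covering_dim (n : nat) :=
  covering_dim_le n /\ forall m, covering_dim_le m -> (n <= m)%N.

End covering_dimension.
Arguments covering_dim_le : clear implicits.
Arguments covering_dim : clear implicits.

Section wild_sets.
Context (R : realType) (n : nat).

Definition sphere : set 'rV[R]_n.+1 :=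
  [set v | \sum_(i < n.+1) v ord0 i ^+ 2 = 1].

Lemma sphere_base_subproof : (delta_mx ord0 ord0 : 'rV[R]_n.+1) \in sphere.
Proof.
rewrite inE /sphere /= (bigD1 ord0) //= mxE !eqxx expr1n big1 ?addr0 // => i.
by rewrite mxE => /negbTE ->; rewrite andbF expr0n.
Qed.

Definition sphere_base : sphere := SigSub sphere_base_subproof.

Definition null_homotopic (X : topologicalType) (f : sphere -> X) :=
  exists (c : X) (H : sphere * unit_interval R -> X),
    [/\ continuous H, forall s, H (s, unit_interval0) = f s &
        forall s, H (s, unit_interval1) = c].

Definition essential (X : topologicalType) (f : sphere -> X) :=
  ~ null_homotopic f.

Definition maps_converge (X : topologicalType) (f : nat -> sphere -> X)
    (x : X) :=
  forall U : set X, nbhs x U ->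
  exists K : nat, forall k, (K <= k)%N -> range (f k) `<=` U.

Definition wild_set (X : topologicalType) : set X :=
  [set x | exists f : nat -> sphere -> X,
     [/\ forall k, continuous (f k), forall k, f k sphere_base = x,
         forall k, essential (f k) & maps_converge f x]].

(* The wild set of A with its subspace topology, seen as a subset of X. *)
Definition wild_subset (X : topologicalType) (A : set X) : set X :=
  set_val @` @wild_set (set_type A).

Definition wild_step (X : topologicalType) (k : Ord)
    (W : forall m : Ord, (m < k)%O -> set X) : set X :=
  [set x | [\/ k = Ord0,
               exists (m : Ord) (mk : (m < k)%O),
                 k = OrdS m /\ wild_subset (W m mk) x |
               ord_limit k /\ forall (m : Ord) (mk : (m < k)%O), W m mk x]].

Definition wild_iter (X : topologicalType) : Ord -> set X :=
  Fix ord_lt_wf (fun _ => set X) (@wild_step X).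
Arguments wild_iter : clear implicits.

Lemma wild_iterE (X : topologicalType) (k : Ord) :
  wild_iter X k = wild_step (fun m (_ : (m < k)%O) => wild_iter X m).
Proof.
rewrite /wild_iter Fix_eq // => x V W VW; congr wild_step.
by apply: functional_extensionality_dep => m; apply: functional_extensionality_dep.
Qed.

Lemma wild_iter0 (X : topologicalType) : wild_iter X Ord0 = setT.
Proof. by rewrite wild_iterE -subTset => x _; constructor. Qed.

Lemma wild_iterS (X : topologicalType) (k : Ord) :
  wild_iter X (OrdS k) = wild_subset (wild_iter X k).
Proof.
rewrite wild_iterE; apply/seteqP; split=> x.
  case=> [k0|[m [_ [/OrdS_inj <- //]]]|[[_ []]]]; last by exists k.
  by have := OrdS_neq0 k0.
by move=> xk; constructor 2; exists k, (ltOrdS k).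
Qed.

Lemma wild_iter_limit (X : topologicalType) (k : Ord) : ord_limit k ->
  wild_iter X k = \bigcap_(m in [set m : Ord | (m < k)%O]) wild_iter X m.
Proof.
move=> kl; rewrite wild_iterE; apply/seteqP; split=> x.
  case=> [k0|[m [_ [km _]]]|[_ xW] m /xW//]; first by case: kl.
  by case: kl => _ []; exists m.
by move=> xW; constructor 3; split=> // m; exact: xW.
Qed.

Definition wild_stable (X : topologicalType) (k0 : Ord) :=
  forall k : Ord, (k0 <= k)%O -> wild_iter X k0 = wild_iter X k.

Definition is_wild_rank (X : topologicalType) (k0 : Ord) :=
  wild_stable X k0 /\ forall k : Ord, wild_stable X k -> (k0 <= k)%O.

End wild_sets.
Arguments wild_set R n X : clear implicits.
Arguments wild_iter R n X k : clear implicits.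
Arguments is_wild_rank R n X k0 : clear implicits.

(* Main.v *)
Require Import Defs.
From HB Require Import structures.
From mathcomp Require Import finmap.
From mathcomp Require Import all_boot all_order all_algebra.
From mathcomp Require Import all_classical all_reals all_analysis.
From mathcomp Require Import homotopy.
From mathcomp Require Import ring lra zify.

Set Implicit Arguments.
Unset Strict Implicit.
Unset Printing Implicit Defensive.

Import Order.TTheory GRing.Theory Num.Def Num.Theory.
Import numFieldNormedType.Exports.

Local Open Scope classical_set_scope.
Local Open Scope ring_scope.

(** The space is a tree of spheres with ordinal labels. Its nodes are the finite
sequences of natural numbers, and the sphere of the node k :: s is glued by its pole to
the point att k of the sphere of s; the root is a degenerate sphere, a single point. A
point of the tree is recorded by its images under the retractions of the tree onto its
spheres, that is, by a family of vectors indexed by the nodes. In the product metric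
spheres with a large index are small, and the tree is closed in a product of spheres
([treeE], [tree_compact]); retracting one sphere after the other to its pole shows that
it is a Peano continuum ([tree_peano]). Spheres are unit spheres of the sup norm, so
that their faces are cubes.

Some of the nodes carry an ordinal label, the others do not occur in the space. As a rule
the labels of the children of a node are smaller than its own label a, and children of
each label c < a are attached near every point of its sphere. Branches
descend in the ordinals, hence are finite. The main claim ([wild_iter_level]) is that
the wild set of index c is the union [level c] of the spheres with a label at least c,
which is proved by transfinite induction.
- If x lies on a sphere of label a > c, children of label at least c are attached
  arbitrarily close to x. A map that runs from x along a short path to such a child and
  then wraps around it is essential, because its coordinate at the child has degree one
  ([level_wild]).
- If c is the largest label of a sphere through x, small maps from the sphere to
  [level c] are null-homotopic ([level_tame]). A coordinate at a node of label below c
  takes countably many values on the level, hence is constant along a connected sphere;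
  the other coordinates are constant because the map is small. The map thus stays in a
  small part of one sphere, where straight lines contract it.
- At limits one needs that the labels of the spheres through a point have a maximum
  ([top_label]).

For lambda = mu + 1 the root has label mu, and all other labels are smaller, so the wild
set of index mu is the root. If mu = 0, a single child of label 0 makes the space
n-dimensional. For a limit lambda no single label would do, and labels cofinal in lambda
are brought in through only children, for which labels may increase:
an only child never makes its gluing point wild. The root has label 1, its children
have label 0, and each of them has an only child, whose label is an arbitrary
successor below lambda; from there on labels decrease.

The topological input is the Poincare-Miranda theorem, which follows from a count of
cubes in a grid by mod 2 cochains ([cube_labelling]). It shows that the maps above are
essential ([squash_essential]), and it yields Lebesgue's covering theorem, hence the
lower bound for the dimension. The upper bound comes from n + 1 grids of cuts in general
position: a point of the tree has free coordinates on one sphere only, of the n + 1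
coordinates of a point of that sphere one is 1 or -1, and so one of the grids does not
cut through the point ([tree_dim_le]). *)

(** * Mod 2 cochains on a cubical grid *)

Section cubical_cochains.
Variables (m N : nat).
Local Notation grid := {ffun 'I_m -> 'I_N.+1}.
Implicit Types (x y : grid) (A : {set 'I_m}) (l : seq 'I_m).

(** As [inord] sends an index that is out of range to 0, a step from the last vertex in
direction j returns to the first. *)
Definition step x j : grid := [ffun i => if i == j then inord (x j).+1 else x i].
Definition unstep x j : grid := [ffun i => if i == j then inord (x j).-1 else x i].

Lemma stepC x i j : step (step x i) j = step (step x j) i.
Proof.
have [->//|ij] := eqVneq i j; apply/ffunP => k; rewrite !ffunE.
have [kj|kj] := eqVneq k j; have [ki|ki] := eqVneq k i; rewrite ?(negbTE kj) ?(negbTE ki) //.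
- by rewrite -kj ki eqxx in ij.
- by rewrite -kj (negbTE ki).
by rewrite -ki (negbTE kj).
Qed.

Lemma step_out x i j : i != j -> step x j i = x i.
Proof. by move=> ij; rewrite ffunE (negbTE ij). Qed.

Lemma step_in x j : (x j < N)%N -> step x j j = (x j).+1 :> nat.
Proof. by move=> xN; rewrite ffunE eqxx inordK. Qed.

Variable u : 'I_m -> grid -> 'F_2.

(** For l = [:: i1; ...; ir] this is the value of the cup product of the coboundaries of
u i1, ..., u ir on the unit cube with least vertex x and directions A: the sum, over the
monotone edge paths through that cube, of the products of the increments along the path. *)
Fixpoint cup l x A : 'F_2 :=
  if l is i :: l' then
    \sum_(j in A) (u i (step x j) + u i x) * cup l' (step x j) (A :\ j)
  else 1.

Lemma F2_addrr (a : 'F_2) : a + a = 0.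
Proof. by apply: addrr_pchar2; rewrite pchar_Fp. Qed.

Lemma setD1C A i j : (A :\ i) :\ j = (A :\ j) :\ i.
Proof. by apply/setP => k; rewrite !inE andbCA. Qed.

Lemma sum_pairsC A (f : 'I_m -> 'I_m -> 'F_2) :
  \sum_(i in A) \sum_(j in A :\ i) f i j = \sum_(i in A) \sum_(j in A :\ i) f j i.
Proof.
rewrite (exchange_big_dep (mem A)) => [|i j iA /=]; last by rewrite !inE => /andP[].
apply: eq_bigr => i iA; apply: eq_bigl => j.
by rewrite !inE (iA : i \in A) andbT andbC eq_sym.
Qed.

Lemma sum_pairs_sym A (f : 'I_m -> 'I_m -> 'F_2) :
  (forall i j, f i j = f j i) -> \sum_(i in A) \sum_(j in A :\ i) f i j = 0.
Proof.
move=> fC; have -> : \sum_(i in A) \sum_(j in A :\ i) f i j =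
  \sum_(i in A) \sum_(j in A | (i < j)%N) f i j +
  \sum_(i in A) \sum_(j in A | (j < i)%N) f i j.
  rewrite -big_split; apply: eq_bigr => i _; rewrite (bigID (fun j : 'I_m => (i < j)%N)) /=.
  by congr (_ + _); apply: eq_bigl => j; rewrite !inE -val_eqE /=; case: ltngtP; rewrite ?andbF ?andbT.
rewrite [X in _ + X](exchange_big_dep (mem A)) => [|i j iA /=]; last by case/andP.
rewrite -big_split big1 // => i iA; rewrite -[RHS](F2_addrr (\sum_(j in A | (i < j)%N) f i j)).
by congr (_ + _); apply: eq_big => [j|j _]; rewrite ?iA //.
Qed.

(** A product of coboundaries is a cocycle: its sum over the facets of a unit cube with
one more direction vanishes. In the induction the terms that involve two steps are
symmetric in them, and cancel in pairs. *)
Lemma cup_closed l x A : #|A| = (size l).+1 ->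
  \sum_(i in A) cup l (step x i) (A :\ i) = \sum_(i in A) cup l x (A :\ i).
Proof.
elim: l x A => [|k l IH] x A cA //=.
have cA1 i : i \in A -> #|A :\ i| = (size l).+1.
  by move=> iA; move: cA; rewrite (cardsD1 i) iA => -[].
pose g i j := cup l (step (step x i) j) (A :\ i :\ j).
have gC i j : g i j = g j i by rewrite /g stepC setD1C.
have IHx i : i \in A -> \sum_(j in A :\ i) g i j =
    \sum_(j in A :\ i) cup l (step x i) (A :\ i :\ j).
  by move=> iA; exact: IH (cA1 i iA).
apply/eqP; rewrite -subr_eq0 -sumrB; apply/eqP.
have E (a b : 'F_2) : a - b = a + b by apply/eqP; rewrite subr_eq -addrA F2_addrr addr0.
transitivity (\sum_(i in A) (\sum_(j in A :\ i) u k (step (step x i) j) * g i j +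
   \sum_(j in A :\ i) u k (step x i) * g i j +
   (\sum_(j in A :\ i) u k (step x j) * cup l (step x j) (A :\ i :\ j) +
   \sum_(j in A :\ i) u k x * cup l (step x j) (A :\ i :\ j)))).
  apply: eq_bigr => i iA; rewrite E -!big_split /=.
  by apply: eq_bigr => j _; rewrite /g !mulrDl.
rewrite !big_split /= sum_pairs_sym; last by move=> i j; rewrite gC stepC.
rewrite add0r; apply/eqP; rewrite addrA; apply/eqP.
have -> : \sum_(i in A) \sum_(j in A :\ i) u k (step x i) * g i j =
  \sum_(i in A) \sum_(j in A :\ i) u k (step x j) * cup l (step x j) (A :\ i :\ j).
  rewrite [RHS]sum_pairsC; apply: eq_bigr => i iA; rewrite -!mulr_sumr IHx //.
  by congr (_ * _); apply: eq_bigr => j _; rewrite setD1C.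
rewrite F2_addrr add0r sum_pairsC.
transitivity (u k x * \sum_(i in A) \sum_(j in A :\ i) g i j); last by rewrite sum_pairs_sym ?mulr0.
rewrite mulr_sumr; apply: eq_bigr => i iA.
by rewrite IHx // mulr_sumr; apply: eq_bigr => j _; rewrite setD1C.
Qed.

(** The increments of u i vanish along paths on which u i is constant, which happens when
u i depends on a coordinate that no step changes. *)
Lemma cup_frozen l x A i : i \in l -> i \notin A ->
  (forall y z : grid, y i = x i -> z i = x i -> u i y = u i z) -> cup l x A = 0.
Proof.
elim: l x A => [//|k l IH] x A; rewrite inE => /orP[/eqP <-|il] iA ui /=.
  apply: big1 => j jA; rewrite (ui _ x) ?F2_addrr ?mul0r // step_out //.
  by apply: contraNneq iA => ->.
apply: big1 => j jA; have ij : i != j by apply: contraNneq iA => ->.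
by rewrite IH ?mulr0 // ?inE ?(negbTE iA) ?andbF // step_out.
Qed.

Definition grid_cube x y := forall j, y j = x j :> nat \/ y j = (x j).+1 :> nat.

Lemma cup_neq0 l x A i : (forall j, j \in A -> (x j < N)%N) -> i \in l -> cup l x A != 0 ->
  exists y z : grid, [/\ grid_cube x y, grid_cube x z & u i y != u i z].
Proof.
suff H l' (w : grid) (B : {set 'I_m}) : (forall j, if j \in B then (w j = x j :> nat /\ (x j < N)%N) else
     (w j = x j :> nat \/ w j = (x j).+1 :> nat)) -> i \in l' -> cup l' w B != 0 ->
  exists y z : grid, [/\ grid_cube x y, grid_cube x z & u i y != u i z].
  by move=> xA il; apply: H il => j; case: ifP => [/xA|]; [split|left].
elim: l' w B => [//|k l' IH] w B wB; rewrite inE.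
have st j : j \in B -> forall i, if i \in B :\ j then (step w j i = x i :> nat /\ (x i < N)%N) else
     (step w j i = x i :> nat \/ step w j i = (x i).+1 :> nat).
  move=> jB h; rewrite !inE; have := wB h; have [->|hj] /= := eqVneq h j.
    by rewrite jB => -[wx xN]; right; rewrite step_in wx.
  by rewrite step_out.
have cl (w' : grid) (B' : {set 'I_m}) : (forall j, if j \in B' then (w' j = x j :> nat /\ (x j < N)%N) else
     (w' j = x j :> nat \/ w' j = (x j).+1 :> nat)) -> grid_cube x w'.
  by move=> h j; have := h j; case: ifP => // _ [? _]; left.
move=> /orP ik /=; case: (boolP [forall j in B, (u k (step w j) + u k w) * cup l' (step w j) (B :\ j) == 0]).
  by move=> /forall_inP h; rewrite big1 ?eqxx // => j jB; exact/eqP/h.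
rewrite negb_forall_in => /exists_inP[j jB]; rewrite mulf_eq0 negb_or => /andP[uj cj] _.
case: ik => [/eqP ->|il]; last exact: IH (st j jB) il cj.
exists (step w j), w; split; [exact: cl (st j jB)|exact: cl wB|].
by apply: contraNneq uj => ->; rewrite F2_addrr.
Qed.

(** The least vertices of the unit cubes with directions A that tile the face of the grid
on which all other coordinates are maximal. *)
Definition inner A y := [forall j, (y j == ord_max) == (j \notin A)].

Lemma stepK x j : (x j < N)%N -> unstep (step x j) j = x.
Proof.
move=> xN; apply/ffunP => i; rewrite !ffunE eqxx; case: eqVneq => [->|//].
by apply: val_inj; rewrite /= !inordK //= ltnW.
Qed.

Lemma unstepK x j : (0 < x j)%N -> step (unstep x j) j = x.
Proof.
move=> x0; apply/ffunP => i; rewrite !ffunE eqxx; case: eqVneq => [->|//].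
by apply: val_inj; have xN := ltn_ord (x j); rewrite /= !inordK ?prednK // ltnW.
Qed.

(** The increments in direction j telescope on each line of the face: they leave the
values at the two ends, where the coordinate j is maximal, respectively zero. *)
Lemma telescope_dir A j (g : grid -> 'F_2) : (0 < N)%N -> j \in A ->
  \sum_(y | inner A y) (g (step y j) + g y) =
  \sum_(y | inner (A :\ j) y) g y +
  \sum_(y : grid | [forall i, if i == j then y i == ord0 else (y i == ord_max) == (i \notin A)]) g y.
Proof.
move=> N0 jA; pose Q (y : grid) := [forall i, (i == j) || ((y i == ord_max) == (i \notin A))].
have innerE (y : grid) : inner A y = Q y && (y j != ord_max).
  apply/forallP/andP => [h|[/forallP h yj] i].
    by split; [apply/forallP => i; rewrite h orbT|have := h j; rewrite jA eqbF_neg].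
  by have := h i; have [->|//] := eqVneq i j; rewrite jA (negbTE yj).
have innerDE (y : grid) : inner (A :\ j) y = Q y && (y j == ord_max).
  apply/forallP/andP => [h|[/forallP h yj] i].
    split; last by have := h j; rewrite !inE eqxx /= eqb_id.
    by apply/forallP => i; have [//|ij] := eqVneq i j; have := h i; rewrite !inE ij.
  have [->|ij] := eqVneq i j; first by rewrite !inE eqxx yj.
  by have := h i; rewrite !inE ij (negbTE ij).
have zeroE (y : grid) : [forall i, if i == j then y i == ord0 else (y i == ord_max) == (i \notin A)]
   = Q y && (y j == ord0).
  apply/forallP/andP => [h|[/forallP h yj] i].
    split; last by have := h j; rewrite eqxx.
    by apply/forallP => i; have := h i; case: eqVneq.
  by have := h i; case: eqVneq => [->|//].
under eq_bigl do rewrite innerE; under [X in _ = X + _]eq_bigl do rewrite innerDE.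
under [X in _ = _ + X]eq_bigl do rewrite zeroE.
have E : \sum_(y | Q y && (y j != ord_max)) g (step y j) = \sum_(y | Q y && (y j != ord0)) g y.
  rewrite [RHS](reindex_onto (step^~ j) (unstep^~ j)) => [|y /andP[_ y0]]; last first.
    by rewrite unstepK // lt0n.
  apply: eq_bigl => y; apply: esym; have Qs : Q (step y j) = Q y.
    by apply: eq_forallb => i; case: eqVneq => [->//|ij]; rewrite step_out.
  rewrite Qs; have [yN|] := boolP (y j == ord_max).
    rewrite andbF ffunE eqxx (eqP yN) /inord /insubd insubF ?ltnn //=.
    by rewrite andbF.
  move=> yN; have yN' : (y j < N)%N.
    by rewrite ltn_neqAle -ltnS ltn_ord andbT.
  by rewrite stepK // eqxx andbT -val_eqE /= step_in.
rewrite big_split /= E.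
pose s (P : pred grid) := \sum_(y | Q y && P y) g y.
rewrite -/(s (fun y => y j != ord0)) -/(s (fun y => y j != ord_max)).
rewrite -/(s (fun y => y j == ord0)) -/(s (fun y => y j == ord_max)).
have split_s P : \sum_(y | Q y) g y = s P + s (predC P) by rewrite (bigID P).
have := split_s (fun y => y j == ord_max); rewrite (split_s (fun y => y j == ord0)).
rewrite /predC /=; set t0 := s _; set t0' := s _; set tM := s _; set tM' := s _ => h.
have -> : t0' = t0 + (t0 + t0') by rewrite addrA F2_addrr add0r.
by rewrite h -!addrA F2_addrr addr0 addrC.
Qed.

(** Stokes' formula and induction on l. By [cup_closed] the product for i :: l is the
coboundary of u i times the product for l, so its total is a sum over the boundary. There
the face on which coordinate i is maximal contributes the total for l, as u i = 1 on it,
and the other faces contribute 0. *)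
Lemma cup_total l : (0 < N)%N -> uniq l ->
  (forall i y, y i = ord0 -> u i y = 0) -> (forall i y, y i = ord_max -> u i y = 1) ->
  \sum_(y | inner [set j in l] y) cup l y [set j in l] = 1.
Proof.
move=> N0 ul u0 u1; elim: l ul => [_|i l IH /=].
  rewrite (big_pred1 [ffun=> ord_max]) // => y; apply/forallP/eqP => [h|-> j].
    by apply/ffunP => j; have := h j; rewrite ffunE !inE eqb_id => /eqP.
  by rewrite ffunE !inE eqxx.
move=> /andP[il ul]; have {}IH := IH ul.
have -> : [set j in i :: l] = i |: [set j in l] by apply/setP => j; rewrite !inE.
set A := i |: _; have AK : A :\ i = [set j in l].
  by apply/setP => j; rewrite !inE; case: eqVneq => [->|]; rewrite ?(negbTE il).
have cA : #|A| = (size l).+1.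
  by rewrite cardsU1 inE (negbTE il) cardsE; move/card_uniqP: ul => ->.
transitivity (\sum_(j in A) \sum_(y | inner A y)
    (u i (step y j) * cup l (step y j) (A :\ j) + u i y * cup l y (A :\ j))).
  rewrite [RHS]exchange_big; apply: eq_bigr => y _ /=.
  under eq_bigr do rewrite mulrDl.
  by rewrite !big_split /= -mulr_sumr cup_closed // mulr_sumr.
have iA : i \in A by rewrite !inE eqxx.
rewrite (bigD1 i) //= [X in _ + X]big1 ?addr0 => [|j /andP[jA ji]].
  rewrite (telescope_dir (fun y => u i y * cup l y (A :\ i))) // [X in _ + X]big1 ?addr0 => [|y].
    rewrite -[RHS]IH AK; apply: eq_bigr => y /forallP /(_ i).
    by rewrite inE (negbTE il) eqb_id => /eqP yi; rewrite u1 ?mul1r.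
  by move=> /forallP /(_ i); rewrite eqxx => /eqP yi; rewrite u0 ?mul0r.
have jl : j \in l by move: jA; rewrite !inE (negbTE ji).
have jDA : j \notin A :\ j by rewrite !inE eqxx.
rewrite (telescope_dir (fun y => u i y * cup l y (A :\ j))) // !big1 ?addr0 // => y /forallP /(_ j).
  rewrite eqxx => /eqP yj; rewrite (cup_frozen jl jDA) ?mulr0 // => v w; rewrite yj => vj wj.
  by rewrite !u0.
rewrite jDA eqb_id => /eqP yj; rewrite (cup_frozen jl jDA) ?mulr0 // => v w; rewrite yj => vj wj.
by rewrite !u1.
Qed.

(** Since the cup product of all coboundaries has total 1, it is nonzero on a unit cube,
and then every u i changes along some edge of that cube. *)
Theorem cube_labelling : (0 < N)%N ->
  (forall i y, y i = ord0 -> u i y = 0) -> (forall i y, y i = ord_max -> u i y = 1) ->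
  exists2 x : grid, forall j, (x j < N)%N &
    forall i, exists y z : grid, [/\ grid_cube x y, grid_cube x z & u i y != u i z].
Proof.
move=> N0 u0 u1; have := cup_total N0 (enum_uniq 'I_m) u0 u1.
set A := [set j in _]; have AT j : j \in A by rewrite inE mem_enum.
case: (boolP [exists x, inner A x && (cup (enum 'I_m) x A != 0)]) => [/existsP[x]|].
  move=> /andP[/forallP xi cx] _; have xN j : (x j < N)%N.
    have := xi j; rewrite AT eqbF_neg -val_eqE /= => xj.
    by rewrite ltn_neqAle xj -ltnS ltn_ord.
  by exists x => // i; apply: cup_neq0 cx; rewrite ?mem_enum.
rewrite negb_exists => /forallP h; rewrite big1 => [/eqP|y yi]; first by rewrite eq_sym oner_eq0.
by have := h y; rewrite yi negbK => /eqP.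
Qed.

End cubical_cochains.

(** * The Poincare-Miranda theorem *)

Lemma nbhs_preimage (S T : topologicalType) (f : S -> T) (x : S) (U : set T) :
  continuous f -> open U -> U (f x) -> nbhs x (f @^-1` U).
Proof. by move=> cf oU Ufx; apply: cf; exact: open_nbhs_nbhs. Qed.

Section row_vectors.
Variable R : realType.

Lemma rV_norm_ge m (v : 'rV[R]_m) j : `|v ord0 j| <= `|v|.
Proof.
rewrite [leRHS]/normr /= mx_normrE; apply: le_trans (le_bigmax _ _ (ord0, j)) => //=.
Qed.

Lemma rV_norm_le m (v : 'rV[R]_m) (e : R) : 0 <= e ->
  (forall j, `|v ord0 j| <= e) -> `|v| <= e.
Proof.
move=> e0 ve; rewrite [leLHS]/normr /= mx_normrE; apply/bigmax_leP; split=> // -[i j] _ /=.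
by rewrite (ord1 i).
Qed.

Lemma rV_norm_lt m (v : 'rV[R]_m) (e : R) : 0 < e ->
  (forall j, `|v ord0 j| < e) -> `|v| < e.
Proof.
move=> e0 ve; rewrite [ltLHS]/normr /= mx_normrE; apply/bigmax_ltP; split=> // -[i j] _ /=.
by rewrite (ord1 i).
Qed.

Lemma rV_norm_attained m (v : 'rV[R]_m.+1) : exists j, `|v ord0 j| = `|v|.
Proof.
have [->|v0] := eqVneq v 0; first by exists ord0; rewrite mxE normr0 normr0.
have /mx_norm_neq0[[i j] /= e] : mx_norm v != 0 by rewrite -normr_eq0 in v0.
by exists j; rewrite [RHS]e (ord1 i).
Qed.

Lemma row_continuous (Z : topologicalType) m (f : Z -> 'rV[R]_m) :
  (forall j, continuous (fun z => f z ord0 j)) -> continuous f.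
Proof.
move=> cf z; apply/cvgrPdist_lt => e e0.
have : \forall t \near z, forall j : 'I_m, `|f z ord0 j - f t ord0 j| < e.
  apply: filter_forall => j.
  by move: (cf j z) => /cvgrPdist_lt /(_ _ e0).
apply: filterS => t H; apply: rV_norm_lt => // j.
by rewrite !mxE; exact: H.
Qed.

Lemma coordinate_continuous (Z : topologicalType) m (f : Z -> 'rV[R]_m) : continuous f ->
  forall j, continuous (fun z => f z ord0 j).
Proof.
move=> cf j z.
exact: (@continuous_comp _ _ _ f (fun v : 'rV[R]_m => v ord0 j) z (cf z) (@coord_continuous _ _ _ _ _ _)).
Qed.

Definition cube m : set 'rV[R]_m := [set v | forall j, -1 <= v ord0 j <= 1].

Lemma cube_compact m : compact (@cube m).
Proof.
apply: bounded_closed_compact.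
  exists 1; split => // x x1 v vc /=; apply: le_trans (ltW x1).
  by apply: rV_norm_le => // j; rewrite ler_norml vc.
have -> : @cube m = \bigcap_(j in setT) [set v : 'rV[R]_m | v ord0 j \in `[-1, 1]].
  apply/seteqP; split => v vc j /=; first by move=> _; rewrite in_itv /= vc.
  by have := vc j I; rewrite /= in_itv.
apply: closed_bigI => j _.
have : closed ((fun v : 'rV[R]_m => v ord0 j) @^-1` `[-1, 1]).
  apply: closed_comp => [v _|]; first exact: coord_continuous.
  exact: interval_closed.
by [].
Qed.

(** Colour a grid vertex by the signs of the coordinates of F. The unit cubes found by
[cube_labelling] in ever finer grids accumulate at a point near which every coordinate
of F takes both signs. *)
Theorem poincare_miranda m (F : 'rV[R]_m -> 'rV[R]_m) : continuous F ->
  (forall v i, cube v -> v ord0 i = -1 -> F v ord0 i <= 0) ->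
  (forall v i, cube v -> v ord0 i = 1 -> 0 <= F v ord0 i) ->
  exists2 v, cube v & F v = 0.
Proof.
move=> cF Fm Fp.
have cFi := coordinate_continuous cF.
pose g k (y : {ffun 'I_m -> 'I_k.+2}) : 'rV[R]_m :=
  \row_j (-1 + 2 * ((y j : nat)%:R / k.+1%:R)).
have g_cube k y : cube (@g k y).
  move=> j; rewrite mxE.
  have [t0 t1] : (0 <= (y j : nat)%:R / k.+1%:R :> R) /\ ((y j : nat)%:R / k.+1%:R <= 1 :> R).
    split; first by rewrite divr_ge0.
    by rewrite ler_pdivrMr // mul1r ler_nat -ltnS.
  by move: t0 t1; set t : R := _ / _ => t0 t1; apply/andP; split; lra.
(* The colour is forced on the two faces, where the coordinate of F might vanish. *)
pose lab k i (y : {ffun 'I_m -> 'I_k.+2}) := (y i != ord0) && ((y i == ord_max) || (0 < F (@g k y) ord0 i)).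
have lab0 k i y : ~~ @lab k i y -> F (g k y) ord0 i <= 0.
  rewrite negb_and negbK negb_or -leNgt => /orP[/eqP yi|/andP[] //].
  by apply: Fm => //; rewrite mxE yi mul0r mulr0 addr0.
have lab1 k i y : @lab k i y -> 0 <= F (g k y) ord0 i.
  move=> /andP[_ /orP[/eqP yi|/ltW //]].
  by apply: Fp => //; rewrite mxE yi /= divff ?pnatr_eq0 //; lra.
have step k : exists v, cube v /\ forall i, exists y z,
    [/\ cube y, cube z, `|v - y| <= 2 / k.+1%:R, `|v - z| <= 2 / k.+1%:R &
        F y ord0 i <= 0 /\ 0 <= F z ord0 i].
  have [//| | |x xk h] := @cube_labelling m k.+1 (fun i y => if @lab k i y then 1 else 0).
  - by move=> i y yi; rewrite /lab yi eqxx.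
  - by move=> i y yi; rewrite /lab yi eqxx.
  exists (g k x); split=> // i; have [y [z [xy xz yz]]] := h i.
  have dist w : grid_cube x w -> `|g k x - g k w| <= 2 / k.+1%:R.
    move=> xw; apply: rV_norm_le => [|j]; first by rewrite divr_ge0.
    rewrite !mxE; have [->|->] := xw j; first by rewrite subrr normr0 divr_ge0.
    rewrite -natr1 (_ : _ - _ = - (2 / k.+1%:R)); last by ring.
    by rewrite normrN ger0_norm ?divr_ge0.
  case: ifP yz => ly; case: ifP => lz //; rewrite ?eqxx // => _.
  - by exists (g k z), (g k y); split; rewrite ?dist //; split; [apply: lab0; rewrite lz|exact: lab1].
  - by exists (g k y), (g k z); split; rewrite ?dist //; split; [apply: lab0; rewrite ly|exact: lab1].
have [p pP] := choice step.
have [|v [vc vcl]] := @cube_compact m (p @ \oo) _.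
  by exists 0%N => // k _ /=; have [] := pP k.
exists v => //; apply/rowP => i; rewrite [RHS]mxE.
have near_v (U : set 'rV[R]_m) : nbhs v U -> exists y z, [/\ U y, U z, F y ord0 i <= 0 & 0 <= F z ord0 i].
  move=> /nbhs_ballP[e /= e0 eU].
  have [K _ KP] : \forall k \near \oo, 2 / k.+1%:R < e / 2 :> R.
    near=> k; rewrite ltr_pdivrMr // mulrC -ltr_pdivrMr ?divr_gt0 //.
    by rewrite (lt_trans _ (_ : k%:R < _)) ?ltr_nat //; near: k; exact: nbhs_infty_gtr.
  have A : (p @ \oo) [set p k | k in [set k | (K <= k)%N]].
    by exists K => // k kK /=; exists k.
  have e20 : 0 < e / 2 by rewrite divr_gt0.
  have [_ [[k /= /KP kK <-] vp]] := vcl _ _ A (nbhsx_ballx v _ e20).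
  have [_ /(_ i)[y [z [yc zc dy dz [Fy Fz]]]]] := pP k.
  have close w : `|p k - w| <= 2 / k.+1%:R -> U w.
    move=> pw; apply: eU; move: vp; rewrite -!ball_normE /= => vp.
    rewrite (splitr e) (_ : v - w = (v - p k) + (p k - w)); last by rewrite addrA subrK.
    apply: le_lt_trans (ler_normD _ _) _.
    by rewrite ltrD // (le_lt_trans pw).
  by exists y, z; split => //; exact: close.
apply/eqP; rewrite eq_le; apply/andP; split; rewrite leNgt; apply/negP => Fv.
  have /near_v[y [z [/= Fy _ Fy' _]]] : nbhs v [set w | 0 < F w ord0 i].
    by exact: (nbhs_preimage (f := fun w => F w ord0 i) (cFi i) (@open_gt _ 0)).
  by move: Fy; rewrite ltNge Fy'.
have /near_v[y [z [/= _ Fz _ Fz']]] : nbhs v [set w | F w ord0 i < 0].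
  by exact: (nbhs_preimage (f := fun w => F w ord0 i) (cFi i) (@open_lt _ 0)).
by move: Fz; rewrite ltNge Fz'.
Unshelve. all: by end_near. Qed.

End row_vectors.

(** * Lebesgue's covering theorem *)

Lemma finset_card_le (I : finType) (A : {set I}) (T : Type) (f : I -> T) (B : set T) (k : nat) :
  {in A &, injective f} -> (forall i, i \in A -> B (f i)) -> (B #<= `I_k)%card -> (#|A| <= k)%N.
Proof.
move=> fI AB Bk; rewrite -card_le_II; apply: card_le_trans Bk.
pose g (i : 'I_#|A|) := f (enum_val i).
have gI : {in [set: 'I_#|A|] &, injective g}.
  by move=> i j _ _ e; apply: enum_val_inj; apply: fI e; exact: enum_valP.
rewrite (card_le_eql card_II) -(card_le_eql (inj_card_eq gI)).
by apply: subset_card_le => _ [i _ <-]; apply: AB; exact: enum_valP.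
Qed.

Section depth.
Variables (R : realType) (V : normedModType R).
Implicit Types (W : set V) (v w : V).

(** Truncated at 1, so that the depth of the whole space is finite. *)
Definition depth_set W v : set R :=
  [set r | 0 <= r <= 1 /\ forall w, `|v - w| < r -> W w].

Definition depth W v : R := sup (depth_set W v).

Lemma depth_set_sup W v : has_sup (depth_set W v).
Proof.
split; last by exists 1 => r [/andP[]].
by exists 0; split=> [|w]; rewrite ?lexx ?ler01 // normr_lt0.
Qed.

Lemma depth_ge0 W v : 0 <= depth W v.
Proof.
apply: sup_upper_bound; first exact: depth_set_sup.
by split=> [|w]; rewrite ?lexx ?ler01 // normr_lt0.
Qed.

Lemma depth_gt0 W v : open W -> (0 < depth W v) <-> W v.
Proof.
move=> oW; split=> [d0|Wv].
  have [r [_ rW] r0] := sup_adherent d0 (depth_set_sup W v).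
  by apply: rW; rewrite subrr normr0 -(subrr (depth W v)).
have /nbhs_ballP[e /= e0 eW] : nbhs v W by exact: open_nbhs_nbhs.
have me : 0 < minr e 1 by rewrite lt_min e0 ltr01.
apply: (lt_le_trans me); apply: sup_upper_bound; first exact: depth_set_sup.
split=> [|w vw]; first by rewrite (ltW me) ge_min lexx orbT.
by apply: eW; rewrite -ball_normE /=; apply: lt_le_trans vw _; rewrite ge_min lexx.
Qed.

Lemma depth_lip W v w : depth W v <= depth W w + `|v - w|.
Proof.
apply: ge_sup => [|r [/andP[r0 r1] rW]]; first by have [] := depth_set_sup W v.
have [rw|wr] := leP r `|v - w|.
  by apply: le_trans rw _; rewrite lerDr depth_ge0.
rewrite -lerBlDr; apply: sup_upper_bound; first exact: depth_set_sup.
split=> [|z wz]; last first.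
  apply: rW; rewrite (_ : v - z = (v - w) + (w - z)); last by rewrite addrA subrK.
  by apply: le_lt_trans (ler_normD _ _) _; rewrite -ltrBrDl.
by rewrite subr_ge0 (ltW wr) /= lerBlDr; apply: le_trans r1 _; rewrite lerDl.
Qed.

Lemma depth_continuous W : continuous (depth W).
Proof.
move=> v; apply/cvgrPdist_lt => e e0; near=> w.
have vw : `|v - w| < e by near: w; apply: cvgr_dist_lt.
apply: le_lt_trans vw; rewrite ler_norml.
have := depth_lip W v w; have := depth_lip W w v; rewrite distrC.
by move=> h1 h2; apply/andP; split; lra.
Unshelve. all: by end_near. Qed.

Lemma depthB_continuous W W' : continuous (fun v => depth W v - depth W' v).
Proof. by move=> v; apply: cvgB; exact: depth_continuous. Qed.

End depth.

Section cube_dimension.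
Variables (R : realType) (n : nat).
Notation cube := (@cube R n).

Section disjoint_families.
Variables (I : finType) (W : I -> set 'rV[R]_n).
Hypothesis W_open : forall i, open (W i).
Implicit Types J : {set I}.

(** Sets [deepest J] with J of equal cardinal are disjoint, as J consists of the
deepest sets at each of their points. They come from the open stars of the vertices in
the barycentric subdivision of the nerve. *)
Definition deepest (J : {set I}) : set 'rV[R]_n :=
  [set v | forall i, i \in J -> 0 < depth (W i) v /\
     forall j, j \notin J -> depth (W j) v < depth (W i) v].

Lemma deepest_open J : open (deepest J).
Proof.
rewrite openE => v Jv.
pose P i (w : 'rV[R]_n) := i \in J -> 0 < depth (W i) w /\
  forall j, j \notin J -> depth (W j) w < depth (W i) w.
suff : \forall w \near v, forall i, P i w by [].
apply: (@filter_forall 'rV[R]_n I P (nbhs v)) => i; case: (boolP (i \in J)) => [iJ|iJ]; last first.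
  by apply: nearW => w /(negP iJ).
have [vi vj] := Jv i iJ.
pose Q j (w : 'rV[R]_n) := j \notin J -> depth (W j) w < depth (W i) w.
have h1 : \forall w \near v, forall j, Q j w.
  apply: (@filter_forall 'rV[R]_n I Q (nbhs v)) => j; case: (boolP (j \in J)) => [jJ|/vj vji].
    by apply: nearW => w nj; case: (negP nj jJ).
  have c := @depthB_continuous R 'rV[R]_n (W i) (W j).
  have : 0 < depth (W i) v - depth (W j) v by rewrite subr_gt0.
  by move=> /(nbhs_preimage c (@open_gt _ 0)); apply: filterS => w /=; rewrite subr_gt0 => h _.
have h2 := nbhs_preimage (@depth_continuous _ _ (W i)) (@open_gt _ 0) vi.
by apply: filterS2 h1 h2 => w h1 h2 _.
Qed.

Lemma deepest_sub J i : i \in J -> deepest J `<=` W i.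
Proof. by move=> iJ v /(_ _ iJ)[]; rewrite depth_gt0. Qed.

Lemma deepest_disjoint J J' v : #|J| = #|J'| -> deepest J v -> deepest J' v -> J = J'.
Proof.
move=> cJ Jv J'v; apply/eqP; rewrite eqEcard cJ leqnn andbT; apply/negPn/negP.
move=> /subsetPn[i iJ iJ']; have : ~~ (J' \subset J).
  apply: contraNN iJ' => s; suff -> : J' = J by [].
  by apply/eqP; rewrite eqEcard s cJ leqnn.
move=> /subsetPn[j jJ' jJ].
have [_ /(_ _ jJ)] := Jv i iJ; have [_ /(_ _ iJ')] := J'v j jJ'.
by move=> h /(lt_trans h); rewrite ltxx.
Qed.

Lemma deepest_at v : deepest [set i | `[< W i v >]]%SET v.
Proof.
move=> i; rewrite inE => /asboolP iv; split; first by rewrite depth_gt0.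
move=> j; rewrite inE => /asboolPn jv.
have /le_lt_trans : depth (W j) v <= 0 by rewrite leNgt; apply/negP; rewrite depth_gt0.
by apply; rewrite depth_gt0.
Qed.

(** If no set of the cover met opposite faces, split the sets [deepest J] with #|J| = j + 1
into the union G j of those that meet the face -1 in direction j and the union H j of the
others. These are disjoint, G j avoids the face 1, and H j avoids the face -1, so the map
with coordinates depth (H j) - depth (G j) has a zero by Poincare-Miranda. But a zero
lies in none of the sets, and these cover the cube. *)
Lemma lebesgue_covering : cube `<=` \bigcup_i W i ->
  (forall v, cube v -> (#|[set i | `[< W i v >]]%SET| <= n)%N) ->
  exists i j v w, [/\ cube v, cube w, W i v, W i w & v ord0 j = -1 /\ w ord0 j = 1].
Proof.
move=> cov ord; apply: contrapT => nfaces.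
pose meets (J : {set I}) j := exists2 w, cube w /\ w ord0 j = -1 & deepest J w.
pose G (j : 'I_n) : set 'rV[R]_n := \bigcup_(J in [set J : {set I} | #|J| = j.+1 /\ meets J j]) deepest J.
pose H (j : 'I_n) : set 'rV[R]_n := \bigcup_(J in [set J : {set I} | #|J| = j.+1 /\ ~ meets J j]) deepest J.
have oG j : open (G j) by apply: bigcup_open => J _; exact: deepest_open.
have oH j : open (H j) by apply: bigcup_open => J _; exact: deepest_open.
pose F v : 'rV[R]_n := \row_j (depth (H j) v - depth (G j) v).
have cF : continuous F.
  apply: row_continuous => j.
  rewrite (_ : (fun _ => _) = (fun v => depth (H j) v - depth (G j) v)); last first.
    by apply/funext => v; rewrite mxE.
  exact: depthB_continuous.
have out W' (v : 'rV[R]_n) : open W' -> ~ W' v -> depth W' v = 0.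
  move=> oW nW; apply/eqP; rewrite eq_le depth_ge0 andbT leNgt; apply/negP.
  by rewrite depth_gt0.
have GH j v : G j v -> H j v -> False.
  move=> [J [cJ mJ] Jv] [J' [cJ' mJ']] J'v; apply: mJ'.
  by rewrite -(deepest_disjoint _ Jv J'v) // cJ cJ'.
have [v i vc vi|v i vc vi|v vc Fv] := poincare_miranda cF.
- rewrite mxE (out (H i)) ?sub0r ?oppr_le0 ?depth_ge0 //.
  by move=> [J [_ nJ] Jv]; apply: nJ; exists v.
- rewrite mxE (out (G i)) ?subr0 ?depth_ge0 //.
  move=> [J [cJ [w [wc wi] Jw]] Jv]; apply: nfaces.
  have /card_gt0P[k kJ] : (0 < #|J|)%N by rewrite cJ.
  by exists k, i, w, v; split => //; exact: deepest_sub kJ _ _.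
pose J := [set i | `[< W i v >]]%SET.
have [k _ kv] := cov v vc.
have J0 : (0 < #|J|)%N by apply/card_gt0P; exists k; rewrite inE; apply/asboolP.
have Jn : (#|J|.-1 < n)%N by rewrite prednK // ord.
pose j := Ordinal Jn; have /rowP /(_ j) := Fv; rewrite !mxE.
have : G j v \/ H j v.
  have [m|m] := pselect (meets J j); [left|right]; exists J; rewrite /= ?prednK //;
    by [split | exact: deepest_at].
move=> [Gv|Hv] => /eqP; rewrite subr_eq0 => /eqP e.
  have := (depth_gt0 v (oG j)).2 Gv; rewrite -e => /(depth_gt0 v (oH j)).1 Hv.
  exact: GH Gv Hv.
have := (depth_gt0 v (oH j)).2 Hv; rewrite e => /(depth_gt0 v (oG j)).1 Gv.
exact: GH Gv Hv.
Qed.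

End disjoint_families.

(** The sets U e cover X and none of them contains points with opposite extreme values of
a coordinate of y, so Lebesgue's theorem applies to every refinement of this cover. *)
Lemma covering_dim_ge (X : topologicalType) (q : 'rV[R]_n -> X) (y : X -> 'rV[R]_n) (m : nat) :
  continuous q -> continuous y -> (forall v, cube v -> y (q v) = v) ->
  covering_dim_le X m -> (n <= m)%N.
Proof.
move=> cq cy yq dim; rewrite leqNgt; apply/negP => mn.
pose sg (b : bool) : R := if b then 1 else -1.
pose U (e : {ffun 'I_n -> bool}) : set X := [set x | forall i, sg (e i) * y x ord0 i < 1].
have oU e : open (U e).
  rewrite openE => x Ux; apply: filter_forall => i.
  have c : continuous (fun x => 1 - sg (e i) * y x ord0 i).
    by move=> z; apply: cvgB; [exact: cvg_cst|apply: cvgMr; exact: coordinate_continuous].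
  have := Ux i; rewrite -subr_gt0 => /(nbhs_preimage c (@open_gt _ 0)).
  by apply: filterS => z /=; rewrite subr_gt0.
have [||D [[oD covD] refD ordD]] := dim (range U).
- exact: finite_image.
- split; first by move=> _ [e _ <-].
  apply/seteqP; split=> // x _; exists (U [ffun i => y x ord0 i < 0]); first by eexists.
  move=> i; rewrite ffunE /sg; case: (ltP (y x ord0 i) 0) => h; first by rewrite mul1r (lt_trans h).
  by rewrite mulN1r ltrNl; apply: lt_le_trans h; rewrite ltrN10.
have cpt := @cube_compact R n; rewrite compact_cover in cpt.
have [||D' D'D covD'] := cpt _ D (fun d => q @^-1` d).
- by move=> d Dd; apply: open_comp => [x _|]; [exact: cq|exact: oD].
- move=> v _; have [d Dd dv] : (\bigcup_(d in D) d) (q v) by rewrite covD.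
  by exists d.
pose W (d : D') := q @^-1` (val d : set X).
have DD (d : D') : D (val d) by apply: set_mem; exact: D'D (valP d).
have [d|v vc|v vc|d [j [v [w [vc wc Wv Ww [vj wj]]]]]] := @lebesgue_covering D' W.
- by apply: open_comp => [x _|]; [exact: cq|exact: oD].
- by have [d dD' dv] := covD' v vc; exists (FSetSub dD').
- apply: leq_trans mn; apply: (finset_card_le (f := val : D' -> set X) _ _ (ordD (q v))).
  - by move=> d e _ _; exact: val_inj.
  - by move=> d; rewrite inE => /asboolP Wd; split; first exact: DD.
have [_ [e _ <-] dU] := refD _ (DD d).
have := dU _ Wv j; have := dU _ Ww j; rewrite !yq // vj wj /sg.
by case: ifP => _; lra.
Qed.

End cube_dimension.

(** * Continuous maps into subspaces *)

Lemma set_type_continuous_at (Z X : topologicalType) (A : set X) (f : Z -> A) (z : Z) :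
  {for z, continuous (fun z => set_val (f z))} -> {for z, continuous f}.
Proof.
move=> c U [_ [[W oW <-] /= Wz WU]]; apply: filterS WU _.
exact: (c W (open_nbhs_nbhs (conj oW Wz))).
Qed.

Lemma set_type_continuous (Z X : topologicalType) (A : set X) (f : Z -> A) :
  continuous (fun z => set_val (f z)) -> continuous f.
Proof. by move=> c z; apply: set_type_continuous_at; exact: c. Qed.

Lemma set_val_continuous (X : topologicalType) (A : set X) : continuous (set_val : A -> X).
Proof. exact: initial_continuous. Qed.

Section continuity_at.
Variables (R : realType) (V : normedModType R) (Z : topologicalType).
Implicit Types (f g : Z -> V) (c : Z -> R) (z : Z).

Lemma continuous_at_near_eq (Y : topologicalType) (h k : Z -> Y) z :
  (\forall u \near z, h u = k u) -> {for z, continuous k} -> {for z, continuous h}.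
Proof.
move=> hk ck; rewrite /prop_for /continuous_at (nbhs_singleton hk).
apply: cvg_trans ck; apply: near_eq_cvg.
by apply: filterS hk => u ->.
Qed.

Lemma continuous_at_pair (Y Y' : topologicalType) (h : Z -> Y) (k : Z -> Y') z :
  {for z, continuous h} -> {for z, continuous k} -> {for z, continuous (fun u => (h u, k u))}.
Proof. by move=> ch ck; apply: cvg_pair. Qed.

Lemma continuous_at_comp (Y Y' : topologicalType) (h : Z -> Y) (k : Y -> Y') z :
  {for z, continuous h} -> {for h z, continuous k} -> {for z, continuous (fun u => k (h u))}.
Proof. exact: continuous_comp. Qed.

Lemma continuous_at_scaleV c f z : c z != 0 -> {for z, continuous c} ->
  {for z, continuous f} -> {for z, continuous (fun u => (c u)^-1 *: f u)}.
Proof. by move=> c0 cc cf; apply: cvgZ => //; exact: cvgV. Qed.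

Lemma continuous_affine_norm (a b : R) f : continuous f -> continuous (fun u => a - b * `|f u|).
Proof. by move=> cf z; apply: cvgB; [exact: cvg_cst|apply: cvgMr; apply: cvg_norm; exact: cf]. Qed.

Lemma continuous_sum_sqr (I : Type) (r : seq I) (c : I -> Z -> R) :
  (forall i, continuous (c i)) -> continuous (fun u => \sum_(i <- r) c i u ^+ 2).
Proof.
move=> cc; elim: r => [|i r IH] z.
  by apply: (@continuous_at_near_eq _ _ (cst 0)); [apply: nearW => u; rewrite big_nil|exact: cst_continuous].
apply: (@continuous_at_near_eq _ _ (fun u => c i u ^+ 2 + \sum_(i <- r) c i u ^+ 2)).
  by apply: nearW => u; rewrite big_cons.
apply: cvgD; last exact: IH.
exact: (@continuous_at_comp _ _ (c i) (fun x => x ^+ 2) z (cc i z) (@exprn_continuous R 2 _)).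
Qed.

End continuity_at.

(** * An essential map of the sphere that is constant near the pole *)

Section clamp.
Variable R : realType.

Definition clamp (r : R) : R := maxr 0 (minr 1 r).

Lemma clamp_itv r : 0 <= clamp r <= 1.
Proof. by rewrite /clamp le_max lexx /= ge_max ler01 /= ge_min lexx. Qed.

Lemma clamp_id r : 0 <= r <= 1 -> clamp r = r.
Proof. by move=> /andP[r0 r1]; rewrite /clamp (min_idPr r1) (max_idPr r0). Qed.

Lemma clamp_le0 r : r <= 0 -> clamp r = 0.
Proof.
by move=> r0; rewrite /clamp (min_idPr (le_trans r0 ler01)); apply/max_idPl.
Qed.

Lemma clamp_ge1 r : 1 <= r -> clamp r = 1.
Proof. by move=> r1; rewrite /clamp (min_idPl r1); apply/max_idPr. Qed.

Lemma clamp_continuous : continuous clamp.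
Proof.
move=> r; apply: (@continuous_max R R (cst 0) (fun r => minr 1 r)); first exact: cst_continuous.
by apply: (@continuous_min R R (cst 1) id); [exact: cst_continuous|].
Qed.

Lemma clamp_mem r : clamp r \in `[0, 1]%classic.
Proof. by rewrite inE /= in_itv /= clamp_itv. Qed.

Definition to_unit (r : R) : unit_interval R := SigSub (clamp_mem r).

Lemma to_unit_continuous : continuous to_unit.
Proof. by apply: set_type_continuous => r; exact: clamp_continuous. Qed.

Lemma to_unit0 : to_unit 0 = unit_interval0.
Proof. by apply: val_inj; rewrite /= clamp_le0. Qed.

Lemma to_unit1 r : 1 <= r -> to_unit r = unit_interval1.
Proof. by move=> r1; apply: val_inj; rewrite /= clamp_ge1. Qed.

End clamp.

Section normed_sphere.
Variables (R : realType) (V : normedModType R).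
Implicit Types u v w : V.

Definition normalize v : V := `|v|^-1 *: v.

Lemma norm_normalize v : v != 0 -> `|normalize v| = 1.
Proof. by move=> v0; rewrite normrZ normfV normr_id mulVf ?normr_eq0. Qed.

Lemma normalize_id v : `|v| = 1 -> normalize v = v.
Proof. by move=> v1; rewrite /normalize v1 invr1 scale1r. Qed.

Lemma normalizeZ (c : R) v : 0 < c -> normalize (c *: v) = normalize v.
Proof.
move=> c0; rewrite /normalize normrZ gtr0_norm // scalerA invfM.
by rewrite mulrAC mulVf ?mul1r // gt_eqF.
Qed.

Lemma normalize_continuous v : v != 0 -> {for v, continuous normalize}.
Proof.
move=> v0; apply: cvgZ; last exact: cvg_id.
by apply: cvgV; rewrite ?normr_eq0 //; exact: norm_continuous.
Qed.

Lemma norm1_neq0 v : `|v| = 1 -> v != 0.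
Proof. by move=> v1; rewrite -normr_eq0 v1 oner_eq0. Qed.

Lemma close_neq0 u v : `|u| = 1 -> `|u - v| < 1 -> v != 0.
Proof. by move=> u1; apply: contraTneq => ->; rewrite subr0 u1 ltxx. Qed.

(** Normalizing at most doubles the distance to a point of the sphere. *)
Lemma normalize_dist u v (e : R) : `|u| = 1 -> `|u - v| <= e -> e < 1 -> `|u - normalize v| <= 2 * e.
Proof.
move=> u1 uv e1; have v0 : v != 0 by apply: close_neq0 u1 _; exact: le_lt_trans e1.
rewrite (_ : u - normalize v = (u - v) + (v - normalize v)); last by rewrite addrA subrK.
rewrite mulr_natl mulr2n; apply: le_trans (ler_normD _ _) _; apply: lerD => //.
have -> : v - normalize v = (1 - `|v|^-1) *: v by rewrite scalerBl scale1r.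
rewrite normrZ -[X in _ * X](normr_id v) -normrM mulrBl mul1r mulVf ?normr_eq0 //.
by apply: le_trans uv; rewrite -u1 distrC; exact: ler_dist_dist.
Qed.

Definition mix u v (t : R) : V := (1 - t) *: u + t *: v.

Lemma mix0 u v : mix u v 0 = u.
Proof. by rewrite /mix subr0 scale1r scale0r addr0. Qed.

Lemma mix1 u v : mix u v 1 = v.
Proof. by rewrite /mix subrr scale0r scale1r add0r. Qed.

Lemma mix_dist u v t : 0 <= t <= 1 -> `|u - mix u v t| <= `|u - v|.
Proof.
move=> /andP[t0 t1]; have -> : u - mix u v t = t *: (u - v).
  by rewrite /mix scalerBl scale1r scalerBr opprD opprB addrA addrCA subrr addr0.
by rewrite normrZ ger0_norm // ler_piMl.
Qed.

Lemma mix_continuous (Z : topologicalType) (f g : Z -> V) (t : Z -> R) :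
  continuous f -> continuous g -> continuous t -> continuous (fun z => mix (f z) (g z) (t z)).
Proof.
move=> cf cg ct z; apply: cvgD; apply: cvgZ; [|exact: cf|exact: ct|exact: cg].
by apply: cvgB; [exact: cvg_cst|exact: ct].
Qed.

Variable pole : V.
Hypothesis norm_pole : `|pole| = 1.

(** [squash] deforms the identity of the sphere so as to be constant on the ball of
radius 1/4 about the pole; on that ball [whisker] grows from 0 to 1 and serves as the
parameter of a path. *)
Definition squash_weight v : R := clamp (2 - 4 * `|v - pole|).

Definition squash v : V := normalize (mix v pole (squash_weight v)).

Definition whisker v : R := clamp (4 * `|v - pole|).

Lemma squash_pole v : whisker v < 1 -> squash v = pole.
Proof.
move=> w1; have d : 4 * `|v - pole| < 1.
  by rewrite ltNge; apply/negP => /clamp_ge1 e; move: w1; rewrite /whisker e ltxx.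
rewrite /squash /squash_weight clamp_ge1 ?mix1 ?normalize_id ?norm_pole //; lra.
Qed.

Lemma whisker_pole : whisker pole = 0.
Proof. by rewrite /whisker subrr normr0 mulr0 clamp_le0. Qed.

Lemma squash_mix_neq0 v : `|v| = 1 -> mix v pole (squash_weight v) != 0.
Proof.
move=> v1; have [d|d] := leP (1 / 2) `|v - pole|.
  rewrite /squash_weight clamp_le0 ?mix0 ?norm1_neq0 //; lra.
apply: close_neq0 v1 _; apply: le_lt_trans (mix_dist _ _ (clamp_itv _)) _; lra.
Qed.

Lemma norm_squash v : `|v| = 1 -> `|squash v| = 1.
Proof. by move=> v1; rewrite norm_normalize // squash_mix_neq0. Qed.

Lemma dist_pole_continuous : continuous (fun v => 4 * `|v - pole|).
Proof.
move=> v; apply: cvgMr; apply: (@continuous_comp _ _ _ (fun v => v - pole)); last exact: norm_continuous.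
by apply: cvgB; [exact: cvg_id|exact: cvg_cst].
Qed.

Lemma squash_weight_continuous : continuous squash_weight.
Proof.
move=> v; apply: (@continuous_comp _ _ _ (fun v => 2 - 4 * `|v - pole|)); last exact: clamp_continuous.
apply: cvgB; first exact: cvg_cst.
exact: dist_pole_continuous.
Qed.

Lemma whisker_continuous : continuous whisker.
Proof.
move=> v; apply: (@continuous_comp _ _ _ (fun v => 4 * `|v - pole|)); last exact: clamp_continuous.
exact: dist_pole_continuous.
Qed.

Lemma squash_continuous v : `|v| = 1 -> {for v, continuous squash}.
Proof.
move=> v1; apply: (@continuous_comp _ _ _ (fun v => mix v pole (squash_weight v))).
  have c := @mix_continuous V id (cst pole) squash_weight.
  apply: c; [by move=> w; exact: cvg_id|by move=> w; exact: cvg_cst|exact: squash_weight_continuous].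
by apply: normalize_continuous; exact: squash_mix_neq0.
Qed.

End normed_sphere.

Section sup_sphere.
Variables (R : realType) (n : nat).
Notation V := 'rV[R]_n.+1.
Implicit Types u v w : V.

Definition pole : V := delta_mx ord0 ord0.

Lemma pole_coord j : pole ord0 j = (j == ord0)%:R.
Proof. by rewrite /pole mxE eqxx. Qed.

Lemma norm_pole : `|pole| = 1.
Proof.
apply/eqP; rewrite eq_le; apply/andP; split.
  by apply: rV_norm_le => // j; rewrite pole_coord normr_nat lern1 leq_b1.
by apply: le_trans (rV_norm_ge _ ord0); rewrite pole_coord normr1.
Qed.

Notation squashp := (@squash R V pole).

Lemma squash_coord_ge0 v j : `|v| = 1 -> v ord0 j = 1 -> 0 <= squashp v ord0 j.
Proof.
move=> v1 vj; rewrite /squash /normalize /mix !mxE vj mulr1.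
have /andP[w0 w1] := clamp_itv (2 - 4 * `|v - pole|).
by rewrite mulr_ge0 ?invr_ge0 // addr_ge0 ?subr_ge0 // mulr_ge0.
Qed.

(** For j = 0 the coordinate of the pole is positive, but v is then so far from the pole
that [squash] does not move it. *)
Lemma squash_coord_le0 v j : `|v| = 1 -> v ord0 j = -1 -> squashp v ord0 j <= 0.
Proof.
move=> v1 vj; rewrite /squash /normalize /mix !mxE vj.
have /andP[w0 w1] := clamp_itv (2 - 4 * `|v - pole|).
rewrite mulr_ge0_le0 ?invr_ge0 //.
have [j0|j0] := eqVneq j ord0; last first.
  by rewrite mulr0 addr0 mulrN1 oppr_le0 subr_ge0.
rewrite /squash_weight clamp_le0 ?mul0r ?addr0; first by rewrite subr0 mul1r lerN10.
have := rV_norm_ge (v - pole) ord0; rewrite !mxE !eqxx -j0 vj /= -opprD normrN ger0_norm // => h.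
rewrite subr_le0; apply: (@le_trans _ _ (4 * (1 + 1))); first by lra.
by rewrite ler_pM2l.
Qed.

Definition euclid v : R := Num.sqrt (\sum_j v ord0 j ^+ 2).

Lemma euclid_gt0 v : v != 0 -> 0 < euclid v.
Proof.
move=> v0; rewrite sqrtr_gt0 lt_neqAle sumr_ge0 ?andbT => [|j _]; last exact: sqr_ge0.
apply: contraNneq v0 => /esym /eqP; rewrite psumr_eq0 => [/allP h|j _]; last exact: sqr_ge0.
apply/eqP/rowP => j; rewrite mxE; have := h j (mem_index_enum _).
by rewrite /= sqrf_eq0 => /eqP.
Qed.

Lemma euclid_continuous : continuous euclid.
Proof.
move=> v; apply: (@continuous_comp _ _ _ (fun v => \sum_j v ord0 j ^+ 2)); last exact: sqrt_continuous.
apply: (@continuous_sum_sqr R V _ (index_enum _) (fun j (v : V) => v ord0 j)) => j.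
exact: coord_continuous.
Qed.

Lemma euclid_sphere v : v != 0 -> (euclid v)^-1 *: v \in @sphere R n.
Proof.
move=> v0; rewrite inE /sphere /=.
under eq_bigr do rewrite mxE exprMn.
rewrite -mulr_sumr -[X in _ * X]sqr_sqrtr ?sumr_ge0 // => [|j _]; last exact: sqr_ge0.
by rewrite -exprMn mulVf ?expr1n // gt_eqF // euclid_gt0.
Qed.

(** Extended by the base point at 0, where [insubd] takes its default value. *)
Definition to_sphere v : @sphere R n := insubd (@sphere_base R n) ((euclid v)^-1 *: v).

Lemma to_sphere_val v : v != 0 -> set_val (to_sphere v) = (euclid v)^-1 *: v.
Proof. by move=> v0; rewrite set_valE /= /to_sphere val_insubd euclid_sphere. Qed.

Lemma to_sphere_continuous v : v != 0 -> {for v, continuous to_sphere}.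
Proof.
move=> v0; apply: set_type_continuous_at.
apply: (@continuous_at_near_eq V V _ (fun v => (euclid v)^-1 *: v)).
  have : \forall u \near v, u != 0.
    have : `|v| > 0 by rewrite normr_gt0.
    move=> /(nbhs_preimage (@norm_continuous R V) (@open_gt _ 0)); apply: filterS => u /=.
    by rewrite normr_gt0.
  by apply: filterS => u u0; rewrite to_sphere_val.
apply: (@continuous_at_scaleV R V V euclid id); [|exact: euclid_continuous|].
  by rewrite gt_eqF // euclid_gt0.
by [].
Qed.

Lemma sphere_vec_neq0 v : sphere v -> v != 0.
Proof.
move=> sv; apply/eqP => v0; move: sv; rewrite v0 /sphere /=.
under eq_bigr do rewrite mxE expr0n.
by rewrite big1 // => /eqP; rewrite eq_sym oner_eq0.
Qed.

Lemma sphere_neq0 (s : @sphere R n) : set_val s != 0.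
Proof. exact: sphere_vec_neq0 (set_valP s). Qed.

(** A null-homotopy would extend [squash] from the boundary of the cube to a map of the
cube without zero, although [squash] maps no point of a face across the parallel
hyperplane through the centre, which Poincare-Miranda excludes. *)
Lemma squash_essential (K : @sphere R n * unit_interval R -> V) (c : V) :
  continuous K -> (forall p, K p != 0) ->
  (forall s, K (s, unit_interval0) = squashp (normalize (set_val s))) ->
  (forall s, K (s, unit_interval1) = c) -> False.
Proof.
move=> cK K1 K_0 K_1.
pose F v := K (to_sphere v, to_unit (2 - 2 * `|v|)).
have cU : continuous (fun v : V => to_unit (2 - 2 * `|v|)).
  move=> v; apply: (@continuous_at_comp V _ _ (fun v : V => 2 - 2 * `|v|)); last exact: to_unit_continuous.
  by apply: (@continuous_affine_norm R V V 2 2 id) => w; exact: cvg_id.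
have cF : continuous F.
  move=> v; have [->|v0] := eqVneq v 0; last first.
    apply: (@continuous_at_comp V _ _ (fun v => (to_sphere v, to_unit (2 - 2 * `|v|)))); last exact: cK.
    by apply: (@continuous_at_pair V _ _ to_sphere); [exact: to_sphere_continuous|exact: cU].
  apply: (@continuous_at_near_eq V V _ (cst c)); last exact: (@cst_continuous V V c 0).
  have : \forall u \near (0 : V), 0 < 1 - 2 * `|u|.
    have cn := @continuous_affine_norm R V V 1 2 id (fun w => cvg_id).
    by apply: (nbhs_preimage cn (@open_gt _ 0)); rewrite /= normr0 mulr0 subr0.
  by apply: filterS => u u0; rewrite /F to_unit1 ?K_1 //; lra.
have F1 v : `|v| = 1 -> F v = squashp v.
  move=> v1; rewrite /F v1 (_ : 2 - 2 * 1 = 0); last by lra.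
  rewrite to_unit0 K_0; congr squash.
  rewrite to_sphere_val ?norm1_neq0 // normalizeZ ?normalize_id //.
  by rewrite invr_gt0 euclid_gt0 ?norm1_neq0.
have face v i : cube v -> `|v ord0 i| = 1 -> `|v| = 1.
  move=> vc vi; apply/eqP; rewrite eq_le -{2}vi rV_norm_ge andbT.
  by apply: rV_norm_le => // j; rewrite ler_norml vc.
have [v i vc vi|v i vc vi|v vc Fv] := poincare_miranda cF.
- by rewrite F1 ?squash_coord_le0 // (face v i) // vi normrN normr1.
- by rewrite F1 ?squash_coord_ge0 // (face v i) // vi normr1.
by have := K1 (to_sphere v, to_unit (2 - 2 * `|v|)); rewrite -/(F v) Fv eqxx.
Qed.

End sup_sphere.

(** * Countable families of vectors as a metric space *)

(** An alias of the function type that carries a metric of the product topology, in which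
coordinates with a large code count little. *)
Definition family (R : realType) (I : countType) (V : normedModType R) : Type := I -> V.

Section family_metric.
Variables (R : realType) (I : countType) (V : normedModType R).
Notation E := (family I V).
Implicit Types (x y z : E) (i : I).

Definition coord_dist i x y : R := minr 1 `|x i - y i| / (pickle i).+1%:R.

Definition family_dist_set x y : set R := [set r | r = 0 \/ exists i, r = coord_dist i x y].

Definition family_dist x y : R := sup (family_dist_set x y).

Lemma coord_dist_le i x y : coord_dist i x y <= (pickle i).+1%:R^-1.
Proof. by rewrite ler_pdivrMr // mulVf ?pnatr_eq0 // ge_min lexx. Qed.

Lemma family_dist_has_sup x y : has_sup (family_dist_set x y).
Proof.
split; first by exists 0; left.
exists 1 => r [->|[i ->]]; first exact: ler01.
by apply: le_trans (coord_dist_le _ _ _) _; rewrite invf_le1 ?ltr0n // ler1n.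
Qed.

Lemma coord_dist_le_dist i x y : coord_dist i x y <= family_dist x y.
Proof. by apply: sup_upper_bound; [exact: family_dist_has_sup|right; exists i]. Qed.

Lemma family_dist_ge0 x y : 0 <= family_dist x y.
Proof. by apply: sup_upper_bound; [exact: family_dist_has_sup|left]. Qed.

Lemma family_dist_le x y (e : R) : 0 <= e -> (forall i, coord_dist i x y <= e) ->
  family_dist x y <= e.
Proof.
move=> e0 h; apply: ge_sup; first by have [] := family_dist_has_sup x y.
by move=> r [->|[i ->]].
Qed.

Lemma family_distxx x : family_dist x x = 0.
Proof.
apply/eqP; rewrite eq_le family_dist_ge0 andbT; apply: family_dist_le => // i.
by rewrite /coord_dist subrr normr0 (min_idPr ler01) mul0r.
Qed.

Lemma coord_dist_gt0 i x y : (0 < coord_dist i x y) = (x i != y i).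
Proof.
rewrite /coord_dist pmulr_lgt0 ?invr_gt0 ?ltr0n // lt_min ltr01 normr_gt0 subr_eq0.
by [].
Qed.

Lemma family_dist_eq0 x y : family_dist x y = 0 -> x = y.
Proof.
move=> d0; apply/funext => i; apply/eqP; apply/negPn; rewrite -coord_dist_gt0.
by rewrite -leNgt -d0 coord_dist_le_dist.
Qed.

Lemma family_distC x y : family_dist x y = family_dist y x.
Proof.
rewrite /family_dist; congr sup; apply/seteqP; split=> r /=;
  (case=> [->|[i ->]]; [by left|right; exists i]); by rewrite /coord_dist distrC.
Qed.

Lemma family_dist_triangle y x z : family_dist x z <= family_dist x y + family_dist y z.
Proof.
apply: family_dist_le => [|i]; first by rewrite addr_ge0 ?family_dist_ge0.
apply: le_trans (lerD (coord_dist_le_dist i x y) (coord_dist_le_dist i y z)).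
rewrite /coord_dist -mulrDl ler_pM2r ?invr_gt0 ?ltr0n //.
have := ler_normD (x i - y i) (y i - z i); rewrite addrA subrK.
have := normr_ge0 (x i - y i); have := normr_ge0 (y i - z i).
by case: (leP 1 `|x i - y i|); case: (leP 1 `|y i - z i|); case: (leP 1 `|x i - z i|); lra.
Qed.

HB.instance Definition _ := gen_eqMixin (family I V).
HB.instance Definition _ := gen_choiceMixin (family I V).
HB.instance Definition _ := isMetric.Build R (family I V)
  family_distxx family_dist_eq0 family_distC family_dist_triangle.

Lemma coordinate_cont i : continuous (fun x : E => x i).
Proof.
move=> x U /nbhs_ballP[e /= e0 eU].
pose d : R := minr (1 / 2) e / (pickle i).+1%:R.
have m0 : 0 < minr (1 / 2) e by rewrite lt_min e0 andbT; lra.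
have d0 : 0 < d by rewrite divr_gt0.
have : nbhs x (ball x d) by exact: nbhsx_ballx.
apply: filterS => y; rewrite ballEmdist /= => xy.
apply: eU; rewrite -ball_normE /=.
have := le_lt_trans (coord_dist_le_dist i x y) xy.
rewrite /coord_dist /d ltr_pM2r ?invr_gt0 ?ltr0n // lt_min => /andP[].
by case: (leP 1 `|x i - y i|) => // h h1 h2; lra.
Qed.

(** All later arguments use this form of neighbourhoods, by finitely many coordinates,
rather than the metric. *)
Lemma nbhs_familyP x (U : set E) : nbhs x U ->
  exists N (e : R), 0 < e /\ forall y, (forall i, (pickle i < N)%N -> `|x i - y i| < e) -> U y.
Proof.
move=> /nbhs_ballP[d /= d0 dU].
have [N Nd] : exists N, N.+1%:R^-1 < d :> R.
  by have [N] := ltr_add_invr (y := 0) (x := d) d0; rewrite add0r; exists N.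
exists N, (d / 2); split=> [|y xy]; first by rewrite divr_gt0.
have m0 : 0 < maxr (d / 2) N.+1%:R^-1 by rewrite lt_max divr_gt0.
apply: dU; rewrite ballEmdist /=.
apply: (@le_lt_trans _ _ (maxr (d / 2) N.+1%:R^-1)); last by rewrite gt_max Nd andbT; lra.
apply: family_dist_le => [|i]; first exact: ltW.
rewrite le_max; have [iN|Ni] := ltnP (pickle i) N; apply/orP; [left|right].
  apply: le_trans (ltW (xy i iN)); rewrite ler_pdivrMr // (@le_trans _ _ `|x i - y i|) //.
    by rewrite ge_min lexx orbT.
  by rewrite ler_peMr // ler1n.
by apply: le_trans (coord_dist_le _ _ _) _; rewrite lef_pV2 ?posrE ?ltr0n // ler_nat.
Qed.

Lemma near_coords (Z : topologicalType) (f : Z -> E) (z : Z) N (e : R) : 0 < e ->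
  (forall i, {for z, continuous (fun u => f u i)}) ->
  \forall u \near z, forall i, (pickle i < N)%N -> `|f z i - f u i| < e.
Proof.
move=> e0 cf.
pose P (k : 'I_N) (u : Z) := forall i, pickle i = k -> `|f z i - f u i| < e.
have : \forall u \near z, forall k, P k u.
  apply: (@filter_forall Z 'I_N P (nbhs z)) => k.
  have [[i ik]|nk] := pselect (exists i, pickle i = k).
    have := cf i; move=> /cvgrPdist_lt /(_ e e0); apply: filterS => u h j jk.
    by have -> : j = i by apply: (pcan_inj pickleK); rewrite jk ik.
  by apply: nearW => u i ik; case: nk; exists i.
by apply: filterS => u h i iN; exact: (h (Ordinal iN)).
Qed.

Lemma family_continuous_at (Z : topologicalType) (f : Z -> E) (z : Z) :
  (forall i, {for z, continuous (fun u => f u i)}) -> {for z, continuous f}.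
Proof.
move=> cf U /nbhs_familyP[N [e [e0 h]]].
by apply: filterS (near_coords N e0 cf) => u hu; exact: h.
Qed.

Lemma family_continuous (Z : topologicalType) (f : Z -> E) :
  (forall i, continuous (fun u => f u i)) -> continuous f.
Proof. by move=> cf z; apply: family_continuous_at => i; exact: cf. Qed.

Lemma family_compact (A : I -> set V) : (forall i, compact (A i)) ->
  compact [set x : E | forall i, A i (x i)].
Proof.
move=> cA; have := @tychonoff I (fun=> V) A cA.
pose f (x : prod_topology (fun _ : I => V)) : E := x.
have cf : continuous f.
  by apply: family_continuous => i x; exact: (@proj_continuous I (fun=> V) i x).
move=> /(continuous_compact (continuous_subspaceT cf)).
by rewrite (_ : f @` _ = [set x : E | forall i, A i (x i)]) // image_id.
Qed.

End family_metric.

HB.instance Definition _ (R : realType) (X : metricType R) (A : set X) :=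
  @PseudoMetric_isMetric.Build R (set_type A)
    (fun x y => mdist (set_val x) (set_val y))
    (fun x y => mdist_ge0 (set_val x) (set_val y))
    (fun x y e => val_inj (mdist_positivity _ _ e))
    (fun x d => f_equal (preimage set_val) (ballEmdist (set_val x) d)).

Lemma set_type_metrizable (R : realType) (X : metricType R) (A : set X) :
  metrizable R (set_type A).
Proof.
exists (set_type A : metricType R), id, id; split=> // x; exact: cvg_id.
Qed.

(** * Paths in topological spaces *)

Section joined.
Variables (R : realType) (T : topologicalType).
Implicit Types (A : set T) (x y z : T) (p : R -> T).

(** Paths are parametrized by the whole line, which makes reparametrization painless. *)
Definition joined A x y := exists p, [/\ continuous p, p 0 = x, p 1 = y & forall t, A (p t)].

Lemma joined_refl A x : A x -> joined A x x.
Proof. by move=> Ax; exists (cst x); split=> // t; exact: cvg_cst. Qed.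

Lemma joined_sub A A' x y : A `<=` A' -> joined A x y -> joined A' x y.
Proof. by move=> AA' [p [cp p0 p1 pA]]; exists p; split=> // t; exact/AA'/pA. Qed.

Lemma joined_in A x y : joined A x y -> A x /\ A y.
Proof. by move=> [p [cp <- <- pA]]. Qed.

Lemma affine_continuous (a b : R) : continuous (fun t : R => a + b * t).
Proof. by move=> t; apply: cvgD; [exact: cvg_cst|apply: cvgMr; exact: cvg_id]. Qed.

Lemma joined_reparam A p (a b : R) : continuous p -> (forall t, A (p t)) -> joined A (p a) (p b).
Proof.
move=> cp pA; exists (fun t => p (a + (b - a) * t)); split.
- move=> t; apply: (@continuous_at_comp R _ _ (fun t => a + (b - a) * t)); last exact: cp.
  exact: affine_continuous.
- by rewrite mulr0 addr0.
- by rewrite mulr1 addrCA subrr addr0.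
- by move=> t; exact: pA.
Qed.

Lemma joined_sym A x y : joined A x y -> joined A y x.
Proof. by move=> [p [cp <- <- pA]]; exact: joined_reparam. Qed.

Lemma joined_trans A y x z : joined A x y -> joined A y z -> joined A x z.
Proof.
move=> [p [cp p0 p1 pA]] [q [cq q0 q1 qA]].
pose pp t := p (clamp (2 * t)); pose qq t := q (clamp (2 * t - 1)).
have cpp : continuous pp.
  move=> t; apply: (@continuous_at_comp R _ _ (fun t => clamp (2 * t))); last exact: cp.
  apply: (@continuous_at_comp R _ _ (fun t => 2 * t)); last exact: clamp_continuous.
  by apply: cvgMr; exact: cvg_id.
have cqq : continuous qq.
  move=> t; apply: (@continuous_at_comp R _ _ (fun t => clamp (2 * t - 1))); last exact: cq.
  apply: (@continuous_at_comp R _ _ (fun t => 2 * t - 1)); last exact: clamp_continuous.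
  by apply: cvgB; [apply: cvgMr; exact: cvg_id|exact: cvg_cst].
have ppy t : 1 / 2 <= t -> pp t = y by move=> t2; rewrite /pp clamp_ge1 //; lra.
have qqy t : t <= 1 / 2 -> qq t = y by move=> t2; rewrite /qq clamp_le0 //; lra.
pose g t := if t <= 1 / 2 then pp t else qq t.
exists g; split.
- move=> t; have [tl|tr|te] := ltgtP t (1 / 2).
  + apply: (@continuous_at_near_eq _ _ _ pp); last exact: cpp.
    have : \forall u \near t, u < 1 / 2 by apply: open_nbhs_nbhs; split; [exact: open_lt|].
    by apply: filterS => u /ltW u2; rewrite /g u2.
  + apply: (@continuous_at_near_eq _ _ _ qq); last exact: cqq.
    have : \forall u \near t, 1 / 2 < u by apply: open_nbhs_nbhs; split; [exact: open_gt|].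
    by apply: filterS => u u2; rewrite /g leNgt u2.
  + move=> U; rewrite /g te lexx ppy // => Uy.
    have Up : nbhs (1 / 2 : R) (pp @^-1` U) by apply: cpp; rewrite ppy.
    have Uq : nbhs (1 / 2 : R) (qq @^-1` U) by apply: cqq; rewrite qqy.
    by apply: filterS2 Up Uq => u up uq /=; case: ifP.
- by rewrite /g ifT; [rewrite /pp mulr0 clamp_le0|lra].
- by rewrite /g ifF; [rewrite /qq clamp_ge1 //; lra|apply/negbTE; rewrite -ltNge; lra].
- by move=> t; rewrite /g; case: ifP => _; [exact: pA|exact: qA].
Qed.

Lemma joined_path A x y : joined A x y ->
  exists p : {path unit_interval R from x to y in T}, range p `<=` A.
Proof.
move=> [p [cp p0 p1 pA]].
have cf : continuous (fun t : unit_interval R => p (set_val t)).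
  move=> t; apply: (@continuous_at_comp _ _ _ (set_val : unit_interval R -> R)); last exact: cp.
  exact: set_val_continuous.
have f0 : (fun t : unit_interval R => p (set_val t)) zero = x by [].
have f1 : (fun t : unit_interval R => p (set_val t)) one = y by [].
by exists (mk_path cf f0 f1) => _ [t _ <-]; exact: pA.
Qed.

(** The set of points that can be joined to x inside the interior of U is open, by the
hypothesis at each of its points. *)
Lemma locally_path_connectedP :
  (forall x U, nbhs x U -> \forall z \near x, joined U x z) -> locally_path_connected R T.
Proof.
move=> lpc x U xU; pose V := [set y | joined U° x y].
exists V; split.
- split; last exact: joined_refl (nbhs_singleton (nbhs_interior xU)).
  rewrite openE => y xy; have [_ Uy] := joined_in xy.
  have : nbhs y U° by apply: open_nbhs_nbhs; split=> //; exact: open_interior.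
  by move=> /lpc; apply: filterS => z; exact: joined_trans xy.
- move=> y z xy xz; apply: joined_path.
  have lift w : joined U° x w -> joined V x w.
    move=> [p [cp p0 p1 pU]]; exists p; split=> // t.
    by rewrite /V /= -p0; exact: (joined_reparam 0 t cp pU).
  exact: joined_trans (joined_sym (lift _ xy)) (lift _ xz).
- by move=> y yV; have [_ /interior_subset] := joined_in yV.
Qed.

End joined.

Lemma joined_set_type (R : realType) (T : topologicalType) (A : set T) (U : set A) (x y : A) :
  joined R [set z | exists2 u : A, U u & set_val u = z] (set_val x) (set_val y) -> joined R U x y.
Proof.
move=> [p [cp p0 p1 pA]].
have [q qP] := choice (fun t => let: ex_intro2 u Uu e := pA t in ex_intro (fun u => U u /\ set_val u = p t) u (conj Uu e)).
exists q; split=> [||| t]; last by have [] := qP t.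
- by apply: set_type_continuous; under eq_fun do rewrite (qP _).2.
- by apply: val_inj; rewrite -set_valE (qP 0).2.
- by apply: val_inj; rewrite -set_valE (qP 1).2.
Qed.

(** * Maps of the sphere with countably many values *)

Section countable_range.
Variable R : realType.

(** A segment has positive Lebesgue measure. *)
Lemma uncountable_segment (a b : R) : a < b -> ~ countable `[a, b]%classic.
Proof.
move=> ab /countable_lebesgue_measure0; rewrite lebesgue_measure_itv /= lte_fin ab.
by rewrite -EFinB => /eqP; rewrite eqe subr_eq0 gt_eqF.
Qed.

(** Otherwise h takes all values between h 0 and h 1. *)
Lemma countable_range_constR (h : R -> R) : continuous h -> countable (range h) ->
  h 0 = h 1.
Proof.
move=> ch cr; apply: contrapT => h01.
have mM : minr (h 0) (h 1) < maxr (h 0) (h 1) by rewrite lt_max !gt_min !ltxx /= orbF orbC -neq_lt; exact/eqP.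
apply: uncountable_segment mM _; apply: sub_countable cr; apply: subset_card_le => v.
rewrite /= in_itv /= => vM; have [c _ <-] := @IVT R h 0 1 v ler01 (continuous_subspaceT ch) vM.
by exists c.
Qed.

Lemma countable_range_const m (h : R -> 'rV[R]_m) (C : set 'rV[R]_m) : continuous h ->
  countable C -> (forall t, C (h t)) -> h 0 = h 1.
Proof.
move=> ch cC hC; apply/rowP => j.
apply: (@countable_range_constR (fun t => h t ord0 j)); first exact: coordinate_continuous.
apply: sub_countable cC; apply: card_le_trans (card_image_le (fun v : 'rV[R]_m => v ord0 j) C).
by apply: subset_card_le => _ [t _ <-]; exists (h t).
Qed.

End countable_range.

Section sphere_paths.
Variables (R : realType) (n : nat).
Notation V := 'rV[R]_n.+1.
Implicit Types u v w : V.

Definition unit_sphere : set V := [set v | `|v| = 1].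

Lemma unit_sphere_compact : compact unit_sphere.
Proof.
apply: bounded_closed_compact.
  by exists 1; split=> // x x1 v /= ->; exact: ltW.
rewrite (_ : unit_sphere = (fun v : V => `|v|) @^-1` [set 1]) //.
by apply: closed_comp => [v _|]; [exact: norm_continuous|exact: closed_eq].
Qed.

(** Project the segment from u to v radially to the sphere. *)
Lemma joined_segment u v : `|u| = 1 -> `|v| = 1 -> (forall t, 0 <= t <= 1 -> mix u v t != 0) ->
  exists p : R -> V, [/\ continuous p, p 0 = u, p 1 = v, forall t, `|p t| = 1 &
    forall e, `|v - u| <= e -> e < 1 -> forall t, `|v - p t| <= 2 * e].
Proof.
move=> u1 v1 h; exists (fun t => normalize (mix u v (clamp t))); split.
- move=> t; apply: (@continuous_at_comp R _ _ (fun t => mix u v (clamp t))).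
    apply: (@mix_continuous R V R (cst u) (cst v)).
    - by move=> z; exact: cvg_cst.
    - by move=> z; exact: cvg_cst.
    - exact: clamp_continuous.
  by apply: normalize_continuous; exact: h (clamp_itv t).
- by rewrite clamp_le0 // mix0 normalize_id.
- by rewrite clamp_ge1 // mix1 normalize_id.
- by move=> t; rewrite norm_normalize // h // clamp_itv.
move=> e vu e1 t; apply: normalize_dist => //; apply: le_trans vu.
have -> : mix u v (clamp t) = mix v u (1 - clamp t).
  by rewrite /mix opprB addrCA subrr addr0 addrC.
by apply: mix_dist; have /andP[] := clamp_itv t => *; apply/andP; split; lra.
Qed.

Lemma mix_neq0 u v t : `|u| = 1 -> `|v| = 1 -> u != - v -> 0 <= t <= 1 -> mix u v t != 0.
Proof.
move=> u1 v1 uv /andP[t0 t1]; apply: contra_neq uv => /eqP; rewrite /mix addr_eq0 => /eqP e.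
have := congr1 Num.norm e; rewrite normrN !normrZ u1 v1 !mulr1 ger0_norm ?subr_ge0 // ger0_norm // => t2.
have tn : t != 0 by apply: contra_eq_neq t2 => ->; rewrite subr0 oner_neq0.
by move: e; rewrite t2 -scalerN => /(scalerI tn).
Qed.

Lemma joined_close u v (e : R) : `|u| = 1 -> `|v| = 1 -> `|v - u| <= e -> e < 1 ->
  joined R [set w | `|w| = 1 /\ `|v - w| <= 2 * e] u v.
Proof.
move=> u1 v1 vu e1; have [|p [cp p0 p1 pS pe]] := joined_segment u1 v1.
  move=> t t01; apply: mix_neq0 => //; apply/eqP => uv; move: vu; rewrite uv opprK.
  rewrite -mulr2n normrMn v1 => h; have : (2 : R) <= e by [].
  by move=> h'; lra.
by exists p; split=> // t; split=> //; exact: pe.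
Qed.

Hypothesis n_gt0 : (0 < n)%N.

(** The point opposite to the pole is joined to it through a coordinate vector. *)
Lemma joined_pole u : `|u| = 1 -> joined R unit_sphere u (@pole R n).
Proof.
move=> u1; have sg a b : `|a| = 1 -> `|b| = 1 -> a != - b -> joined R unit_sphere a b.
  move=> a1 b1 ab; have [|p [cp p0 p1 pS pe]] := joined_segment a1 b1.
    by move=> t t01; exact: mix_neq0.
  by exists p.
have [->|up] := eqVneq u (- pole R n); last by apply: sg => //; exact: norm_pole.
pose i : 'I_n.+1 := inord 1; pose w : V := delta_mx ord0 i.
have i0 : i != ord0 by rewrite -val_eqE /= inordK.
have w1 : `|w| = 1.
  apply/eqP; rewrite eq_le; apply/andP; split.
    by apply: rV_norm_le => // j; rewrite mxE normr_nat lern1 leq_b1.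
  by apply: le_trans (rV_norm_ge _ i); rewrite mxE !eqxx normr1.
apply: (@joined_trans _ _ _ w); apply: sg; rewrite ?normrN ?norm_pole //.
  rewrite eqr_opp; apply/eqP => /rowP /(_ i); rewrite !mxE eqxx (negbTE i0) eqxx.
  by move=> /eqP; rewrite eq_sym oner_eq0.
apply/eqP => /rowP /(_ i); rewrite !mxE eqxx (negbTE i0) eqxx /= oppr0.
by move=> /eqP; rewrite oner_eq0.
Qed.

Lemma to_sphere_normalize (s : @sphere R n) : to_sphere (normalize (set_val s)) = s.
Proof.
have s0 := sphere_neq0 s; apply: val_inj; rewrite -set_valE to_sphere_val; last first.
  by rewrite norm1_neq0 // norm_normalize.
have e1 : euclid (set_val s) = 1.
  by have := set_valP s; rewrite /euclid /sphere /= => ->; rewrite sqrtr1.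
rewrite (_ : euclid _ = `|set_val s|^-1 * euclid (set_val s)); last first.
  rewrite /euclid /normalize; under eq_bigr do rewrite mxE exprMn.
  by rewrite -mulr_sumr sqrtrM ?sqr_ge0 // sqrtr_sqr ger0_norm // invr_ge0.
by rewrite e1 mulr1 invrK scalerA mulfV ?scale1r ?normr_eq0.
Qed.

Lemma to_sphere_pole : to_sphere (@pole R n) = sphere_base R n.
Proof.
rewrite -[RHS]to_sphere_normalize set_valE /= normalize_id //; exact: norm_pole.
Qed.

(** Restrict g to paths that end at the base point. *)
Lemma sphere_countable_const m (g : @sphere R n -> 'rV[R]_m) (C : set 'rV[R]_m) :
  continuous g -> countable C -> (forall s, C (g s)) -> forall s, g s = g (sphere_base R n).
Proof.
move=> cg cC gC s; have s1 : `|normalize (set_val s)| = 1 by rewrite norm_normalize ?sphere_neq0.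
have [p [cp p0 p1 pS]] := joined_pole s1.
have := @countable_range_const R m (fun t => g (to_sphere (p t))) C.
rewrite p0 p1 to_sphere_normalize to_sphere_pole; apply=> // t.
apply: (@continuous_at_comp R _ _ (fun t => to_sphere (p t))); last exact: cg.
apply: (@continuous_at_comp R _ _ p); first exact: cp.
by apply: to_sphere_continuous; apply: norm1_neq0; exact: pS.
Qed.

End sphere_paths.

(** * The tree of spheres *)

(** The children of s are the sequences k :: s, so the ancestors of s are its suffixes. *)
Notation node := (seq nat).

Section tree_space.
Variables (R : realType) (n : nat).
Notation V := 'rV[R]_n.+1.
Notation E := (family node V).
Notation pole := (@pole R n).
Implicit Types (s t : node) (u v w : V) (x y z : E).

Variable att : nat -> V.
Hypothesis norm_att : forall k, `|att k| = 1.
Hypothesis att_pole : forall k, att k != pole.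

(** The sphere of the root is a point, so all its children are attached at the pole. *)
Definition anchor s k : V := if s is [::] then pole else att k.

(** The coordinates common to the points of the sphere of s, except at s itself: at an
ancestor t the point where the branch to s leaves the sphere of t, and elsewhere the pole. *)
Fixpoint stem s : E :=
  if s is k :: s' then fun t => if t == s' then anchor s' k else stem s' t
  else fun=> pole.

Definition pt s v : E := fun t => if t == s then v else stem s t.

Lemma norm_anchor s k : `|anchor s k| = 1.
Proof. by case: s => [|? ?]; [exact: norm_pole|exact: norm_att]. Qed.

Lemma size_cat_cons s k t : (size t < size (s ++ k :: t))%N.
Proof. by rewrite size_cat /= addnS ltnS leq_addl. Qed.

Lemma cat_cons_neq s k t : (t == s ++ k :: t) = false.
Proof. by apply/eqP => e; have := size_cat_cons s k t; rewrite -e ltnn. Qed.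

Lemma stem_cat s k t : stem (s ++ k :: t) t = anchor t k.
Proof.
by elim: s => [|j s IH] /=; rewrite ?eqxx // cat_cons_neq.
Qed.

Lemma stem_neq s t : stem s t != pole -> exists r k, s = r ++ k :: t.
Proof.
elim: s => [|k s IH] /=; first by rewrite eqxx.
case: (eqVneq t s) => [-> _|_ /IH[r [j ->]]]; first by exists [::], k.
by exists (k :: r), j.
Qed.

Lemma stem_above s r k : stem s (r ++ k :: s) = pole.
Proof.
apply/eqP/negPn/negP => /stem_neq[q [j e]].
have := size_cat_cons r k s; have := size_cat_cons q j (r ++ k :: s).
by rewrite -e => h1 h2; have := ltn_trans h1 h2; rewrite ltnn.
Qed.

Lemma stem_values s t : stem s t = pole \/ exists k, stem s t = att k.
Proof.
elim: s => [|k s IH] /=; first by left.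
case: (eqVneq t s) => [_|_] //; case: s {IH} => [|j s]; [by left|by right; exists k].
Qed.

Lemma norm_stem s t : `|stem s t| = 1.
Proof. by case: (stem_values s t) => [->|[k ->]]; [exact: norm_pole|]. Qed.

Lemma pt_self s v : pt s v s = v.
Proof. by rewrite /pt eqxx. Qed.

Lemma pt_out s v t : t != s -> pt s v t = stem s t.
Proof. by rewrite /pt => /negbTE ->. Qed.

Lemma pt_neq s v t : pt s v t != pole -> exists r, s = r ++ t.
Proof.
rewrite /pt; case: (eqVneq t s) => [-> _|_ /stem_neq[r [k ->]]]; first by exists [::].
by exists (r ++ [:: k]); rewrite -catA.
Qed.

(** The gluing of the sphere of k :: s to that of s. *)
Lemma pt_cons k s : pt (k :: s) pole = pt s (anchor s k).
Proof.
apply/funext => t; rewrite /pt /=; case: (eqVneq t (k :: s)) => [->|//].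
by rewrite [k :: s == s]eq_sym (cat_cons_neq [::] k) (stem_above s [::] k).
Qed.

Lemma norm_pt s v t : `|v| = 1 -> `|pt s v t| = 1.
Proof. by move=> v1; rewrite /pt; case: eqP => // _; exact: norm_stem. Qed.

Lemma pt_continuous s : continuous (pt s).
Proof.
apply: family_continuous => t v; rewrite /pt; case: (eqVneq t s) => _; first exact: cvg_id.
exact: (@cst_continuous V V).
Qed.

Lemma pt_child_anchor s r k v : pt (r ++ k :: s) v s = anchor s k.
Proof. by rewrite pt_out ?stem_cat // cat_cons_neq. Qed.

Lemma pt_above s v r k : pt s v (r ++ k :: s) = pole.
Proof. by rewrite pt_out ?stem_above // eq_sym cat_cons_neq. Qed.

Definition carrier s : set V := [set v | `|v| = 1 /\ (s = [::] -> v = pole)].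

Lemma carrier_anchor s k : carrier s (anchor s k).
Proof. by split; [exact: norm_anchor|move=> ->]. Qed.

Lemma carrier_pole s : carrier s pole.
Proof. by split; first exact: norm_pole. Qed.

Definition cell s : set E := pt s @` carrier s.

Variable act : node -> Prop.
Hypothesis act_nil : act [::].
Hypothesis act_tail : forall k s, act (k :: s) -> act s.
Hypothesis act_wf : well_founded (fun t s => act t /\ exists k, t = k :: s).

Definition tree : set E := \bigcup_(s in act) cell s.

Lemma pt_tree s v : act s -> carrier s v -> tree (pt s v).
Proof. by move=> sa cv; exists s => //; exists v. Qed.

(** Local conditions on one node, on a node and a child, and on two siblings. Each is
closed, which makes the tree compact. *)
Definition tree_eqs : set E := [set x | [/\ forall s, `|x s| = 1,
  forall s, act s \/ x s = pole, x [::] = pole,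
  forall k s, x (k :: s) = pole \/ x s = anchor s k &
  forall j k s, j = k \/ x (j :: s) = pole \/ x (k :: s) = pole]].

Lemma act_cat r s : act (r ++ s) -> act s.
Proof. by elim: r => //= k r IH /act_tail. Qed.

Lemma tree_sub_eqs : tree `<=` tree_eqs.
Proof.
move=> _ [s sa [v [v1 vn] <-]]; split.
- by move=> t; exact: norm_pt.
- move=> t; have [->|/pt_neq[r e]] := eqVneq (pt s v t) pole; [by right|left].
  by apply: (@act_cat r); rewrite -e.
- case: s sa vn => [|k s] sa vn; first by rewrite pt_self vn.
  have [//|/pt_neq[r e]] := eqVneq (pt (k :: s) v [::]) pole.
  rewrite pt_out //; case: (lastP (k :: s)) => [//|q j].
  by rewrite -cats1 stem_cat.
- move=> k t; have [->|/pt_neq[r ->]] := eqVneq (pt s v (k :: t)) pole; [by left|right].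
  exact: pt_child_anchor.
- move=> j k t; have [->|/pt_neq[r e]] := eqVneq (pt s v (j :: t)) pole; first by right; left.
  have [->|/pt_neq[r' e']] := eqVneq (pt s v (k :: t)) pole; [by right; right|left].
  have := e; rewrite e' => /eqP; rewrite -!cat_rcons eqseq_cat ?eqxx ?andbT; last first.
    have := congr1 size e; rewrite e' !size_cat !size_rcons /= => /eqP.
    by rewrite eqn_add2r => /eqP ->.
  by rewrite eqseq_rcons => /andP[_ /eqP].
Qed.

Lemma eqs_above x r k s : tree_eqs x -> x (k :: s) = pole -> x (r ++ k :: s) = pole.
Proof.
move=> [_ _ _ h _] xk; elim: r => //= j r IH.
have [//|] := h j (r ++ k :: s); rewrite IH => e.
have : anchor (r ++ k :: s) j != pole by case: (r) => //= *; exact: att_pole.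
by rewrite -e eqxx.
Qed.

(** Follow the nodes at which the coordinate is not the pole, upwards from the root; there
is at most one such child at each step, and the path ends since branches are finite. *)
Lemma eqs_sub_tree : tree_eqs `<=` tree.
Proof.
move=> x xe; have [x1 xa x0 xc xs] := xe.
suff H s : act s -> carrier s (x s) ->
    (forall t, (forall r k, t <> r ++ k :: s) -> x t = pt s (x s) t) -> tree x.
  apply: (H [::]) => // t ht.
  case: (lastP t) ht => [_|r k]; first by rewrite pt_self.
  by rewrite -cats1 => /(_ r k).
elim: s / (act_wf s) => s _ IH sa cs ht.
have [[k xk]|nk] := pselect (exists k, x (k :: s) != pole).
  have ksa : act (k :: s) by have [//|e] := xa (k :: s); rewrite e eqxx in xk.
  apply: (IH (k :: s)) => // [|t tn]; first by split=> //; exists k.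
  have xsk : x s = anchor s k by have [e|//] := xc k s; rewrite e eqxx in xk.
  have [->|tk] := eqVneq t (k :: s); first by rewrite pt_self.
  have [[r [j e]]|nd] := pselect (exists r j, t = r ++ j :: s); last first.
    rewrite (ht t) => [|r j e]; last by apply: nd; exists r, j.
    by rewrite xsk -pt_cons pt_out // pt_out.
  have jk : j <> k.
    move=> jk; move: e; rewrite jk; case: (lastP r) => [|q i] e; first by rewrite e eqxx in tk.
    by apply: (tn q i); rewrite e cat_rcons.
  rewrite pt_out // e; have -> : stem (k :: s) (r ++ j :: s) = pole.
    apply/eqP/negPn/negP => /stem_neq[q [i e']].
    have := congr1 size e'; rewrite size_cat /= size_cat /= -addn1 => /eqP; lia.
  apply: eqs_above => //; have [//|[//|e']] := xs j k s.
  by rewrite e' eqxx in xk.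
exists s => //; exists (x s) => //; apply/funext => t.
have [[r [k ->]]|nd] := pselect (exists r k, t = r ++ k :: s).
  rewrite pt_above (eqs_above _ xe) //; apply/eqP/negPn/negP => xk.
  by apply: nk; exists k.
by rewrite (ht t) // => r k e; apply: nd; exists r, k.
Qed.

Lemma treeE : tree = tree_eqs.
Proof. by apply/seteqP; split; [exact: tree_sub_eqs|exact: eqs_sub_tree]. Qed.

Lemma subC_continuous (Z : topologicalType) (f : Z -> V) v :
  continuous f -> continuous (fun q => f q - v).
Proof. by move=> cf q; apply: cvgB; [exact: cf|exact: cvg_cst]. Qed.

Lemma closed_coord_eq s v : closed [set x : E | x s = v].
Proof.
rewrite (_ : [set _ | _] = (fun x : E => `|x s - v|) @^-1` [set r : R | r = 0]).
  apply: closed_comp => [x _|]; last exact: closed_eq.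
  apply: (@continuous_at_comp E _ _ (fun x : E => x s - v)); last exact: norm_continuous.
  exact: (@subC_continuous E (fun x => x s) v (@coordinate_cont _ _ _ s)).
apply/seteqP; split=> x /=; first by move=> ->; rewrite subrr normr0.
by move=> /eqP; rewrite normr_eq0 subr_eq0 => /eqP.
Qed.

Lemma closed_or_coord (P : Prop) s v : closed [set x : E | P \/ x s = v].
Proof.
have [p|np] := pselect P.
  by rewrite (_ : [set _ | _] = setT); [exact: closedT|apply/seteqP; split=> // y _; left].
rewrite (_ : [set _ | _] = [set x : E | x s = v]); first exact: closed_coord_eq.
by apply/seteqP; split=> y /=; [case|right].
Qed.

Lemma tree_closed : closed tree.
Proof.
have -> : tree = \bigcap_(s in setT) [set x | act s \/ x s = pole] `&`
   \bigcap_(p in setT) ([set x : E | x (p.1 :: p.2) = pole] `|` [set x | x p.2 = anchor p.2 p.1]) `&`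
   \bigcap_(p in setT) ([set x : E | x (p.1.1 :: p.2) = pole] `|` [set x | p.1.1 = p.1.2 \/ x (p.1.2 :: p.2) = pole]) `&`
   [set x | x [::] = pole] `&` \bigcap_(s in setT) (fun x : E => `|x s|) @^-1` [set r | r = 1].
  rewrite treeE; apply/seteqP; split=> x.
    move=> [x1 xa x0 xc xs]; split; last by move=> s _; exact: x1.
    split=> //; split; last first.
      by move=> [[j k] s] _ /=; case: (xs j k s) => [e|[e|e]]; [right; left|left|right; right].
    by split; [move=> s _; exact: xa|move=> [k s] _; exact: xc].
  move=> [[[[xa xc] xs] x0] x1]; split=> //.
  - by move=> s; exact: x1.
  - by move=> s; exact: xa.
  - by move=> k s; exact: (xc (k, s)).
  - by move=> j k s; case: (xs (j, k, s) I) => [e|[e|e]]; [right; left|left|right; right].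
apply: closedI; [apply: closedI; [apply: closedI; [apply: closedI|]|]|].
- by apply: closed_bigI => s _; exact: closed_or_coord.
- by apply: closed_bigI => p _; apply: closedU; exact: closed_coord_eq.
- by apply: closed_bigI => p _; apply: closedU; [exact: closed_coord_eq|exact: closed_or_coord].
- exact: closed_coord_eq.
- apply: closed_bigI => s _; apply: closed_comp => [x _|]; last exact: closed_eq.
  by apply: (@continuous_at_comp E _ _ (fun x : E => x s)); [exact: coordinate_cont|exact: norm_continuous].
Qed.

Lemma tree_compact : compact tree.
Proof.
have cB := @family_compact R node V (fun=> @unit_sphere R n) (fun=> @unit_sphere_compact R n).
apply: (subclosed_compact tree_closed cB).
by move=> x; rewrite treeE => -[].
Qed.

(** Pass to the parent as long as the point is the pole of its sphere. *)
Lemma normal_form x : tree x ->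
  exists s v, [/\ act s, carrier s v, x = pt s v & s = [::] \/ v != pole].
Proof.
move=> [s sa [v cv <-]]; elim: s v sa cv => [|k s IH] v sa cv.
  by exists [::], v; split=> //; left.
have [->|vp] := eqVneq v pole; last by exists (k :: s), v; split=> //; right.
by rewrite pt_cons; apply: IH; [exact: act_tail sa|exact: carrier_anchor].
Qed.

End tree_space.

(** * The tree of spheres is a Peano continuum *)

Lemma set_type_surj (T : Type) (A : set T) (z : T) : A z -> exists u : A, set_val u = z.
Proof. by move=> Az; exists (SigSub (mem_set Az)); rewrite set_valE. Qed.

(** A cluster point in A of the image filter is one of the filter. *)
Lemma compact_set_type (T : topologicalType) (A : set T) : compact A -> compact [set: set_type A].
Proof.
move=> cA F FF _; have [|p [Ap pcl]] := cA (set_val x @[x --> F]) _.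
  suff : F (set_val @^-1` A) by [].
  rewrite (_ : _ @^-1` _ = setT); first exact: filterT.
  by apply/seteqP; split=> // u _; exact: set_valP.
have [u uE] := set_type_surj Ap; exists u; split=> // B C FB [_ [[W oW <-] Wu WC]].
have Wp : nbhs p W by apply: open_nbhs_nbhs; split=> //; rewrite -uE.
have FB' : F (set_val @^-1` (set_val @` B)) by apply: filterS FB => b Bb; exists b.
by have [_ [[b Bb <-] Wb]] := pcl _ _ FB' Wp; exists b; split=> //; exact: WC.
Qed.

Lemma near_all_seq (Z : topologicalType) (I : eqType) (s : seq I) (P : I -> Z -> Prop) (z : Z) :
  (forall i, i \in s -> \forall u \near z, P i u) -> \forall u \near z, forall i, i \in s -> P i u.
Proof.
elim: s => [_|i s IH h]; first by apply: nearW.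
have h1 := h i (mem_head i s).
have h2 : \forall u \near z, forall j, j \in s -> P j u.
  by apply: IH => j js; apply: h; rewrite inE js orbT.
by apply: filterS2 h1 h2 => u hi hs j; rewrite inE => /orP[/eqP ->|/hs].
Qed.

Lemma joined_map (R : realType) (S T : topologicalType) (f : S -> T) (A : set S) (B : set T) x y :
  continuous f -> (forall z, A z -> B (f z)) -> joined R A x y -> joined R B (f x) (f y).
Proof.
move=> cf AB [p [cp <- <- pA]]; exists (fun t => f (p t)); split=> // t; last exact/AB/pA.
by apply: (@continuous_at_comp R _ _ p); [exact: cp|exact: cf].
Qed.

Section tree_peano.
Variables (R : realType) (n : nat).
Notation V := 'rV[R]_n.+1.
Notation E := (family node V).
Notation pole := (@pole R n).
Implicit Types (s t : node) (u v w : V) (x y z : E).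

Variable att : nat -> V.
Hypothesis norm_att : forall k, `|att k| = 1.
Hypothesis att_pole : forall k, att k != pole.
Variable act : node -> Prop.
Hypothesis act_nil : act [::].
Hypothesis act_tail : forall k s, act (k :: s) -> act s.
Hypothesis act_wf : well_founded (fun t s => act t /\ exists k, t = k :: s).
Hypothesis n_gt0 : (0 < n)%N.

Notation tree := (tree att act).
Notation pt := (pt att).
Notation anchor := (anchor att).

Section collapse.
Variables (x0 : E) (F : node -> Prop) (e : R).
Hypothesis e_ge0 : 0 <= e.
Hypothesis e_lt1 : e < 1.

Definition close_on (d : R) : set E := [set y | forall t, F t -> `|x0 t - y t| <= d].

Lemma close_on_double y : close_on e y -> close_on (2 * e) y.
Proof. by move=> h t /h h'; apply: le_trans h' _; rewrite mulr_natl mulr2n lerDr. Qed.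

(** Move the point along its sphere to the pole, which lies on the sphere of the parent,
and repeat until the sphere of s is reached. The coordinates in F stay close to those of
x0, because these are the pole on all the spheres that are passed. *)
Lemma collapse s r u : act (r ++ s) -> carrier (r ++ s) u -> close_on e (pt (r ++ s) u) ->
  (forall q k, F (q ++ k :: s) -> x0 (q ++ k :: s) = pole) ->
  exists v, [/\ carrier s v, close_on e (pt s v) &
    joined R (tree `&` close_on (2 * e)) (pt (r ++ s) u) (pt s v)].
Proof.
move=> + + + far; elim: r u => [|k r IH] u /= ka cu uc.
  exists u; split=> //; apply: joined_refl; split; first exact: pt_tree.
  exact: close_on_double.
set q := r ++ s in IH ka cu uc *.
have qa : act q by exact: act_tail ka.
have Fq : F (k :: q) -> x0 (k :: q) = pole.
  by rewrite /q -cat_cons lastI cat_rcons; exact: far.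
have pc : close_on e (pt q (anchor q k)).
  move=> t Ft; rewrite -pt_cons; have [tq|tq] := eqVneq t (k :: q).
    by rewrite tq pt_self Fq -?tq // subrr normr0.
  by have := uc t Ft; rewrite !pt_out.
have [v [cv vc jv]] := IH _ qa (carrier_anchor norm_att q k) pc.
exists v; split=> //; apply: joined_trans jv; rewrite -pt_cons.
pose A : set V := [set w | `|w| = 1 /\ (F (k :: q) -> `|pole - w| <= 2 * e)].
apply: (@joined_map _ V E _ A); first exact: pt_continuous.
  move=> w [w1 wF]; split; first by apply: pt_tree => //; split.
  move=> t Ft; have [tq|tq] := eqVneq t (k :: q).
    by rewrite tq pt_self Fq -?tq //; apply: wF; rewrite -tq.
  by have := close_on_double uc Ft; rewrite !pt_out.
have u1 := cu.1; have p1 := @norm_pole R n.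
have [kF|kF] := pselect (F (k :: q)).
  have : `|pole - u| <= e by have := uc _ kF; rewrite pt_self Fq.
  by move=> /(joined_close u1 p1) /(_ e_lt1); apply: joined_sub => w [].
by apply: joined_sub (joined_pole n_gt0 u1) => w w1; split.
Qed.

End collapse.

Lemma joined_root x : tree x -> joined R tree x (pt [::] pole).
Proof.
move=> [s sa [u cu <-]].
have [||||v [[v1 vp] _ j]] := @collapse (cst 0) (fun=> False) 0 (lexx _) ltr01 [::] s u; rewrite ?cats0 //.
by move: j; rewrite vp // cats0; apply: joined_sub => y [].
Qed.

Lemma tree_path_connected : path_connected R [set: set_type tree].
Proof.
move=> x y _ _; apply: joined_path; apply: joined_set_type.
apply: (@joined_sub _ _ tree) => [z zt|]; first by have [u ue] := set_type_surj zt; exists u.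
exact: joined_trans (joined_root (set_valP x)) (joined_sym (joined_root (set_valP y))).
Qed.

Lemma tree_normal (x : set_type tree) :
  exists s v, [/\ act s, carrier s v, set_val x = pt s v & s = [::] \/ v != pole].
Proof. by have := normal_form norm_att act_tail (set_valP x); rewrite set_valE. Qed.

(** Write x as a point of a sphere s other than its pole. Nearby points lie on spheres
above s, collapse to a point of the sphere of s close to x, and are joined to x there. *)
Lemma tree_locally_path_connected : locally_path_connected R (set_type tree).
Proof.
apply: locally_path_connectedP => x U xU.
have [W xW WU] : exists2 W : set E, nbhs (set_val x) W & forall z : set_type tree, W (set_val z) -> U z.
  move: xU => [_ [[W oW <-] Wx WU]]; exists W; last by move=> z Wz; exact: WU.
  exact: open_nbhs_nbhs.
have [s [v [sa cv xE sv]]] := tree_normal x.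
have [N [e [e0 eW]]] := nbhs_familyP xW.
have [d [d0 d1 de dv]] : exists d : R, [/\ 0 < d, d < 1, 2 * d < e &
    v != pole -> d < `|v - pole|].
  have [vp|vp] := eqVneq v pole.
    exists (minr (1 / 2) (e / 3)); split=> //.
    - by rewrite lt_min; apply/andP; split; lra.
    - by rewrite gt_min; apply/orP; left; lra.
    - by case: (leP (1 / 2) (e / 3)); lra.
  have vp0 : 0 < `|v - pole| by rewrite normr_gt0 subr_eq0.
  exists (minr (minr (1 / 2) (e / 3)) (`|v - pole| / 2)); split=> [|||_].
  - by rewrite !lt_min; apply/andP; split; [apply/andP; split|]; lra.
  - by rewrite !gt_min; apply/orP; left; apply/orP; left; lra.
  - apply: (@le_lt_trans _ _ (2 * (e / 3))); last by lra.
    by rewrite ler_pM2l // !ge_min lexx orbT.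
  - by rewrite gt_min; apply/orP; right; lra.
pose N' := maxn N (choice.pickle s).+1.
pose F t := (choice.pickle t < N')%N.
have Fs : F s by rewrite /F /N' leq_max leqnn orbT.
have : \forall z \near x, forall t, F t -> `|set_val x t - set_val z t| < d.
  apply: near_coords => // t.
  exact: (@continuous_at_comp (set_type tree) E V set_val (fun y : E => y t) x
    (@set_val_continuous _ _ x) (@coordinate_cont _ _ _ t _)).
apply: filterS => z zd.
have [t [u [ta cu zE _]]] := tree_normal z.
have [r tE] : exists r, t = r ++ s.
  case: sv => [->|vp]; first by exists t; rewrite cats0.
  apply: (@pt_neq _ _ att t u s); rewrite -zE; apply/eqP => zp.
  have := zd s Fs; rewrite xE pt_self zp => /(lt_trans (dv vp)).
  by rewrite ltxx.
have zc : close_on (set_val x) F d (pt (r ++ s) u).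
  by move=> q /zd /ltW; rewrite zE tE.
subst t.
have [|v' [cv' v'c jz]] := collapse (ltW d0) d1 ta cu zc.
  by move=> q k _; rewrite xE pt_above.
apply: joined_sym; apply: joined_set_type.
apply: (@joined_sub _ _ (tree `&` close_on (set_val x) F (2 * d))).
  move=> y [yt yc]; have [y' y'E] := set_type_surj yt; exists y' => //; apply: WU; apply: eW => t tN.
  rewrite y'E.
  apply: le_lt_trans de; apply: yc; rewrite /F /N'; apply: leq_trans tN _.
  by rewrite leq_maxl.
rewrite zE; apply: joined_trans jz _.
have v'd : `|v - v'| <= d by have := v'c s Fs; rewrite xE !pt_self.
rewrite {2}xE; case: (eqVneq s [::]) => [s0|s0].
  rewrite (cv.2 s0) (cv'.2 s0); apply: joined_refl; split; first by apply: pt_tree => //; exact: carrier_pole.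
  by move=> t _; rewrite xE (cv.2 s0) subrr normr0 mulr_ge0 // ltW.
pose A : set V := [set w | `|w| = 1 /\ `|v - w| <= 2 * d].
apply: (@joined_map _ V E _ A); first exact: pt_continuous.
  move=> w [w1 wF]; split; first by apply: pt_tree => //; split=> // s0'; rewrite s0' eqxx in s0.
  move=> q _; rewrite xE; have [->|qs] := eqVneq q s; first by rewrite !pt_self.
  by rewrite !pt_out // subrr normr0 mulr_ge0 // ltW.
exact: joined_close cv'.1 cv.1 v'd d1.
Qed.

Lemma tree_peano : peano_continuum R (set_type tree).
Proof.
split; [split|exact: tree_path_connected|exact: tree_locally_path_connected].
- exact: compact_set_type (tree_compact norm_att att_pole act_nil act_tail act_wf).
- exact: set_type_metrizable.
Qed.

End tree_peano.

(** * The dimension of the tree of spheres *)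

Section family_refinement.
Variables (R : realType) (I : countType) (V : normedModType R) (K : set (family I V)).
Implicit Types (x y : set_type K) (U : set (set_type K)).

Lemma nbhs_set_familyP x U : nbhs x U -> exists N (e : R), 0 < e /\
  forall y, (forall i, (choice.pickle i < N)%N -> `|set_val x i - set_val y i| < e) -> U y.
Proof.
move=> [_ [[W oW <-] Wx WU]].
have [N [e [e0 h]]] := nbhs_familyP (open_nbhs_nbhs (conj oW Wx)).
by exists N, e; split=> // y hy; apply: WU; exact: h.
Qed.

Lemma set_coord_continuous i : continuous (fun x : set_type K => set_val x i).
Proof.
move=> x; exact: (@continuous_at_comp (set_type K) (family I V) V set_val (fun y : family I V => y i) x
  (@set_val_continuous _ _ x) (@coordinate_cont _ _ _ i _)).
Qed.

(** A Lebesgue number, with closeness measured on finitely many coordinates. *)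
Lemma uniform_refinement (C : set (set (set_type K))) : compact K -> open_cover C ->
  exists N (e : R), 0 < e /\ forall x, exists2 A, C A &
    forall y, (forall i, (choice.pickle i < N)%N -> `|set_val x i - set_val y i| < e) -> A y.
Proof.
move=> cK [oC covC]; apply: contrapT => nex.
have bad k : exists x, forall A, C A -> exists2 y,
    (forall i, (choice.pickle i < k)%N -> `|set_val x i - set_val y i| < k.+1%:R^-1) & ~ A y.
  apply: contrapT => nk; apply: nex; exists k, k.+1%:R^-1; split=> [|x]; first by rewrite invr_gt0.
  apply: contrapT => nA; apply: nk; exists x => A CA; apply: contrapT => ny.
  apply: nA; exists A => // y xy; apply: contrapT => nAy; apply: ny; by exists y.
have [p pP] := choice bad.
have [|x [_ xcl]] := compact_set_type cK (F := p @ \oo) _; first exact: filterT.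
have [A CA Ax] : (\bigcup_(A in C) A) x by rewrite covC.
have [N [e [e0 h]]] := nbhs_set_familyP (open_nbhs_nbhs (conj (oC _ CA) Ax)).
have e20 : 0 < e / 2 by rewrite divr_gt0.
have nx := near_coords N e20 (fun i => @set_coord_continuous i x).
have [M Me] : exists M, M.+1%:R^-1 < e / 2 :> R.
  by have [M] := ltr_add_invr (y := 0) (x := e / 2) e20; rewrite add0r; exists M.
have B : (p @ \oo) (p @` [set k | (maxn M N <= k)%N]).
  by exists (maxn M N) => // k /= kM; exists k.
have [_ [[k /= kM <-] xk]] := xcl _ _ B nx.
have [y yk nA] := pP k A CA; apply: nA; apply: h => i iN.
rewrite (splitr e) (_ : set_val x i - set_val y i = (set_val x i - set_val (p k) i) + (set_val (p k) i - set_val y i)); last first.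
  by rewrite addrA subrK.
apply: le_lt_trans (ler_normD _ _) _; apply: ltrD; first exact: xk.
apply: lt_le_trans (yk i _) _; first by apply: leq_trans iN _; apply: leq_trans kM; exact: leq_maxr.
apply: le_trans (ltW Me); rewrite lef_pV2 ?posrE ?ltr0n // ler_nat ltnS.
by apply: leq_trans kM; exact: leq_maxl.
Qed.

End family_refinement.

Lemma pselect_ex (T : Type) (t0 : T) (P : T -> Prop) : exists t, (exists t', P t') -> P t.
Proof.
by have [[t Pt]|nP] := pselect (exists t, P t); [exists t|exists t0 => /nP].
Qed.

Section grids.
Variable R : realType.

(** The intervals between consecutive points of the arithmetic progression o + e * Z. *)
Definition gap (o e : R) (z : int) : set R := [set r | o + e * z%:~R < r < o + e * (z + 1)%:~R].

Lemma gap_open o e z : open (gap o e z).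
Proof.
rewrite (_ : gap o e z = [set r | o + e * z%:~R < r] `&` [set r | r < o + e * (z + 1)%:~R]).
  by apply: openI; [exact: open_gt|exact: open_lt].
by apply/seteqP; split=> r /=; [move=> /andP[]|move=> [h1 h2]; apply/andP].
Qed.

Lemma gap_eq o e z z' r : 0 < e -> gap o e z r -> gap o e z' r -> z = z'.
Proof.
move=> e0; rewrite /gap /= => /andP[a b] /andP[c d].
have h (i j : int) : o + e * i%:~R < r -> r < o + e * (j + 1)%:~R -> i <= j.
  move=> h1 h2; have := lt_trans h1 h2; rewrite ltrD2l ltr_pM2l // ltr_int.
  by rewrite ltzD1.
by apply/eqP; rewrite eq_le !h.
Qed.

Lemma gap_ex (o e r : R) : 0 < e -> (forall z : int, r <> o + e * z%:~R) -> exists z, gap o e z r.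
Proof.
move=> e0 nr; exists (Num.floor ((r - o) / e)); rewrite /gap /=.
have := real_floor_itv (num_real ((r - o) / e)); set z := Num.floor _ => /andP[h1 h2].
apply/andP; split; last first.
  by move: h2; rewrite ltr_pdivrMr // mulrC ltrBlDl.
move: h1; rewrite ler_pdivlMr // mulrC lerBrDl le_eqVlt => /orP[/eqP e1|//].
by case: (nr z).
Qed.

Lemma gap_dist (o e r r' : R) z : gap o e z r -> gap o e z r' -> `|r - r'| < e.
Proof.
rewrite /gap /= intrD mulrDr mulr1 => /andP[a b] /andP[c d].
by rewrite ltr_norml; apply/andP; split; lra.
Qed.

(** Countably many offsets are excluded, among uncountably many. *)
Lemma offsets (Q : seq R) (e : R) : 0 < e -> exists o : nat -> R,
  [/\ injective o, forall l, 0 < o l < e & forall l r (z : int), r \in Q -> r <> o l + e * z%:~R].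
Proof.
move=> e0; pose bad : set R := \bigcup_(r in [set` Q]) range (fun z : int => r - e * z%:~R).
have cbad : countable bad.
  apply: bigcup_countable; first exact/finite_set_countable/finite_seq.
  by move=> r _; apply: sub_countable (card_image_le _ _) (countableP _).
pose good : set R := `]0, e[ `\` bad.
have : infinite_set good.
  move=> /finite_set_countable cgood.
  have e32 : e / 3 < e / 2 by lra.
  apply: (uncountable_segment e32); apply: (@sub_countable _ _ _ (good `|` bad)).
    apply: subset_card_le => r /=; rewrite in_itv /= => /andP[r1 r2].
    have [rb|rb] := pselect (bad r); [by right|left; split=> //=].
    by rewrite in_itv /=; apply/andP; split; lra.
  rewrite -bigcup2E; apply: bigcup_countable => // i _.
  by rewrite /bigcup2; case: ifP => _ //; case: ifP.
move=> /infiniteP/pcard_leP/unsquash f; exists f; split.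
- by move=> i j /(@inj _ _ _ f) -> //; rewrite inE.
- by move=> l; have [+ _] : good (f l) by exact: funS; rewrite /= in_itv.
move=> l r z rQ re; have [_] : good (f l) by exact: funS.
by apply; exists r => //; exists z => //; rewrite re addrK.
Qed.

End grids.

Section tree_dimension.
Variables (R : realType) (n : nat).
Notation V := 'rV[R]_n.+1.
Notation E := (family node V).
Notation pole := (@pole R n).
Implicit Types (s t : node).

Variable att : nat -> V.
Hypothesis norm_att : forall k, `|att k| = 1.
Hypothesis att_pole : forall k, att k != pole.
Variable act : node -> Prop.
Hypothesis act_nil : act [::].
Hypothesis act_tail : forall k s, act (k :: s) -> act s.
Hypothesis act_wf : well_founded (fun t s => act t /\ exists k, t = k :: s).

Notation tree := (tree att act).
Notation pt := (pt att).

Lemma norm_tree (x : E) t : tree x -> `|x t| = 1.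
Proof. by move=> [s _ [v [v1 _] <-]]; exact: norm_pt. Qed.

Definition suffixes s : seq node := [seq drop i s | i <- iota 0 (size s).+1].

Lemma suffixesP s t : reflect (exists r, s = r ++ t) (t \in suffixes s).
Proof.
apply: (iffP mapP) => [[i _ ->]|[r ->]]; first by exists (take i s); rewrite cat_take_drop.
exists (size r); last by rewrite drop_size_cat.
by rewrite mem_iota add0n size_cat ltnS leq_addr.
Qed.

Lemma finite_support N : exists F : seq node,
  (forall t, (choice.pickle t < N)%N -> t \in F) /\ (forall r t, r ++ t \in F -> t \in F).
Proof.
pose L := pmap (@choice.unpickle node) (iota 0 N).
exists (flatten [seq suffixes t | t <- L]); split=> [t tN|r t].
  apply/flattenP; exists (suffixes t); last by apply/suffixesP; exists [::].
  apply: map_f; rewrite mem_pmap; apply/mapP; exists (choice.pickle t); rewrite ?choice.pickleK //.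
  by rewrite mem_iota.
move=> /flattenP[_ /mapP[q qL ->] /suffixesP[q' qE]].
apply/flattenP; exists (suffixes q); first exact: map_f.
by apply/suffixesP; exists (q' ++ r); rewrite qE catA.
Qed.

Section grid_cover.
Variables (F : seq node).
Hypothesis F_suffix : forall r t, r ++ t \in F -> t \in F.

(** Values of coordinates at poles and gluing points, and the extreme values 1 and -1.
The cuts of the grids avoid them. *)
Definition joint_values : seq R :=
  [:: -1, 0, 1 & [seq att (head 0%N t) ord0 j | t <- F, j <- enum 'I_n.+1]].

Lemma pole_joint j : pole ord0 j \in joint_values.
Proof. by rewrite pole_coord; case: (j == ord0); rewrite !inE eqxx ?orbT. Qed.

(** Both t and t' are ancestors of the sphere of the point, hence one is an ancestor of
the other; if they were distinct, the coordinate at the lower one would be a gluing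
point. *)
Lemma free_node (x : E) t t' j j' : tree x -> t \in F -> t' \in F ->
  x t ord0 j \notin joint_values -> x t' ord0 j' \notin joint_values -> t = t'.
Proof.
move=> [s sa [v cv <-]].
suff H a b i i' : a \in F -> b \in F -> (size b <= size a)%N -> pt s v a ord0 i \notin joint_values ->
    pt s v b ord0 i' \notin joint_values -> a = b.
  move=> tF tF' nt nt'; have [le|le] := leqP (size t') (size t); first exact: H nt nt'.
  by apply/esym; apply: H nt' nt => //; exact: ltnW.
move=> aF bF ba na nb.
have np c k : pt s v c ord0 k \notin joint_values -> exists r, s = r ++ c.
  by move=> h; apply: (@pt_neq _ _ att s v c); apply: contraNneq h => ->; exact: pole_joint.
have [r sE] := np _ _ na; have [r' sE'] := np _ _ nb.
have aE : a = drop (size r) s by rewrite sE drop_size_cat.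
have [q aq] : exists q, a = q ++ b.
  exists (drop (size r) r'); have rr : (size r <= size r')%N.
    have sz : (size r' + size b = size r + size a)%N by rewrite -!size_cat -sE -sE'.
    by rewrite -(leq_add2r (size b)) sz leq_add2l.
  rewrite aE sE' drop_cat; case: ltnP => // h.
  have e : size r = size r' by apply/eqP; rewrite eqn_leq rr h.
  by rewrite e subnn drop0 drop_oversize.
case: (lastP q) aq => [->//|q' k] aq; case/negP: nb.
rewrite sE aq cat_rcons catA pt_child_anchor /anchor.
case eb : b => [|c b']; first exact: pole_joint.
have kF : k :: b \in F by apply: (@F_suffix q'); rewrite -cat_rcons -aq.
rewrite !inE; apply/orP; right; apply/orP; right; apply/orP; right.
by apply/allpairsP; exists (k :: b, i'); rewrite mem_enum.
Qed.

Variables (o : nat -> R) (e : R).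
Hypothesis e_gt0 : 0 < e.
Hypothesis o_inj : injective o.
Hypothesis o_itv : forall l, 0 < o l < e.
Hypothesis o_joint : forall l r (z : int), r \in joint_values -> r <> o l + e * z%:~R.

Definition brick (l : nat) (z : node -> 'I_n.+1 -> int) : set (set_type tree) :=
  [set x : set_type tree | forall t, t \in F -> forall j, gap (o l) e (z t j) (set_val x t ord0 j)].

Lemma brick_open l z : open (brick l z).
Proof.
rewrite openE => x xb.
pose P t (y : set_type tree) := forall j, gap (o l) e (z t j) (set_val y t ord0 j).
suff : \forall y \near x, forall t, t \in F -> P t y by [].
apply: near_all_seq => t tF.
apply: (@filter_forall (set_type tree) 'I_n.+1
  (fun j (y : set_type tree) => gap (o l) e (z t j) (set_val y t ord0 j)) (nbhs x)) => j.
have c : continuous (fun y : set_type tree => set_val y t ord0 j).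
  exact: coordinate_continuous (@set_coord_continuous R _ V tree t) j.
exact: (nbhs_preimage c (@gap_open R _ _ _) (xb t tF j)).
Qed.

Lemma offset_eq (l l' : nat) (z z' : int) : o l + e * z%:~R = o l' + e * z'%:~R -> l = l'.
Proof.
move=> h; have [a b] := andP (o_itv l); have [c d] := andP (o_itv l').
have hz (p q : nat) (i i' : int) : o p < e -> 0 < o q -> o p + e * i%:~R = o q + e * i'%:~R -> i' <= i.
  move=> h1 h2 h3; rewrite -ltzD1 -(ltr_int R) -(ltr_pM2l e_gt0) intrD mulrDr mulr1.
  by rewrite -(ltrD2l (o q)) -h3; lra.
have zz : z = z' by apply/eqP; rewrite eq_le (hz l' l) ?(hz l l') // -h.
by apply: o_inj; move: h; rewrite zz => /addIr.
Qed.

(** If each of the n + 1 grids cut through x, the cuts would be at coordinates of one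
sphere by [free_node], at distinct ones since distinct grids have no common cut, hence at
all n + 1 of them. But one coordinate is 1 or -1, and no grid cuts there. *)
Lemma brick_cover x : exists2 l, (l <= n)%N & exists z, brick l z x.
Proof.
apply: contrapT => nl.
have cut (l : 'I_n.+1) : exists p : node * 'I_n.+1, p.1 \in F /\
    exists z : int, set_val x p.1 ord0 p.2 = o l + e * z%:~R.
  apply: contrapT => nc; apply: nl; exists l; first by rewrite -ltnS.
  have g (p : node * 'I_n.+1) : exists z, p.1 \in F -> gap (o l) e z (set_val x p.1 ord0 p.2).
    have [pF|pF] := pselect (is_true (p.1 \in F)); last by exists 0.
    have [z zP|z zP] := @gap_ex R (o l) e (set_val x p.1 ord0 p.2) e_gt0; last by exists z.
    by apply: nc; exists p; split=> //; exists z.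
  by have [z zP] := choice g; exists (fun t j => z (t, j)) => t tF j; exact: (zP (t, j)).
have [p pP] := choice cut.
have pn l : set_val x (p l).1 ord0 (p l).2 \notin joint_values.
  by apply/negP => h; have [_ [z ze]] := pP l; exact: (o_joint h ze).
have pE l : (p l).1 = (p ord0).1.
  by apply: (free_node (set_valP x)) (pn l) (pn ord0); have [] := pP l; have [] := pP ord0.
have pinj : injective (fun l => (p l).2).
  move=> l l' /= ll'; have [_ [z ze]] := pP l; have [_ [z' ze']] := pP l'.
  by apply: val_inj; apply: (@offset_eq _ _ z z'); rewrite -ze -ze' !pE ll'.
have [j jn] := rV_norm_attained (set_val x (p ord0).1).
have x1 : `|set_val x (p ord0).1| = 1.
  exact: norm_tree (set_valP x).
have /codomP[l lj] := injF_onto pinj j.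
case/negP: (pn l); rewrite pE -lj; move: jn; rewrite x1 => /eqP.
rewrite eqr_norml ler01 andbT => /orP[/eqP ->|/eqP ->]; by rewrite !inE eqxx ?orbT.
Qed.

Lemma brick_eq l z z' x : brick l z x -> brick l z' x -> brick l z = brick l z'.
Proof.
move=> zx zx'; apply/seteqP; split=> y yz t tF j; have := yz t tF j.
  by rewrite (gap_eq e_gt0 (zx t tF j) (zx' t tF j)).
by rewrite (gap_eq e_gt0 (zx t tF j) (zx' t tF j)).
Qed.

End grid_cover.

(** The bricks of a grid are disjoint, so a point lies in at most one of each grid. *)
Lemma tree_dim_le : covering_dim_le (set_type tree) n.
Proof.
move=> C _ oC.
have cK := tree_compact norm_att att_pole act_nil act_tail act_wf.
have [N [e [e0 hN]]] := uniform_refinement cK oC.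
have [F [NF Fs]] := finite_support N.
have [off [oi ob oj]] := offsets (joint_values F) e0.
pose D := [set U : set (set_type tree) | exists2 l, (l <= n)%N & exists z, U = brick F off e l z].
exists D; split.
- split; first by move=> _ [l _ [z ->]]; exact: brick_open.
  apply/seteqP; split=> // x _; have [l ln [z xz]] := brick_cover Fs e0 oi ob oj x.
  by exists (brick F off e l z) => //; exists l => //; exists z.
- move=> _ [l ln [z ->]].
  have [[x xb]|nb] := pselect (exists x, brick F off e l z x); last first.
    have [A CA _] : exists2 A, C A & True.
      have p : tree (pt [::] pole) by apply: pt_tree => //; exact: carrier_pole.
      by have [u _] := set_type_surj p; have [A CA _] := hN u; exists A.
    by exists A => // x xb; case: nb; exists x.
  have [A CA hA] := hN x; exists A => // y yb; apply: hA => t tN.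
  apply: rV_norm_lt => // j; rewrite !mxE.
  exact: gap_dist (xb t (NF t tN) j) (yb t (NF t tN) j).
- move=> x.
  have [b bP] := choice (fun l => pselect_ex (fun _ _ => 0) (fun z => brick F off e l z x)).
  apply: (@card_le_trans _ _ _ ((fun l => brick F off e l (b l)) @` `I_n.+1)); last exact: card_image_le.
  apply: subset_card_le => U [[l ln [z ->]] xz]; exists l => //.
  by apply: (brick_eq e0 _ xz); apply: bP; exists z.
Qed.

(** A face of the sphere of [:: k] is a cube, and its coordinates extend to the tree. *)
Lemma tree_dim_ge k m : act [:: k] -> covering_dim_le (set_type tree) m -> (n <= m)%N.
Proof.
move=> ka.
pose q (v : 'rV[R]_n) : V := \row_j (if unlift ord0 j is Some i then -1 + 2 * clamp (1 / 2 + 2^-1 * v ord0 i) else 1).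
have q1 v : `|q v| = 1.
  apply/eqP; rewrite eq_le; apply/andP; split.
    apply: rV_norm_le => // j; rewrite mxE; case: unlift => [i|]; last by rewrite normr1.
    by have := clamp_itv (1 / 2 + 2^-1 * v ord0 i); rewrite ler_norml => /andP[? ?]; apply/andP; split; lra.
  by apply: le_trans (rV_norm_ge _ ord0); rewrite mxE unlift_none normr1.
have cq : continuous q.
  apply: row_continuous => j; case E : (unlift ord0 j) => [i|].
    have -> : (fun z => q z ord0 j) = (fun v : 'rV[R]_n => -1 + 2 * clamp (1 / 2 + 2^-1 * v ord0 i)).
      by apply/funext => v; rewrite mxE E.
    move=> v; apply: (@continuous_at_comp _ R R (fun v : 'rV[R]_n => clamp (1 / 2 + 2^-1 * v ord0 i)) (fun r => -1 + 2 * r)); last exact: affine_continuous.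
    apply: (@continuous_at_comp _ R R (fun v : 'rV[R]_n => 1 / 2 + 2^-1 * v ord0 i)); last exact: clamp_continuous.
    apply: (@continuous_at_comp _ R R (fun v : 'rV[R]_n => v ord0 i) (fun r => 1 / 2 + 2^-1 * r)); last exact: affine_continuous.
    exact: coord_continuous.
  have -> : (fun z => q z ord0 j) = cst 1 by apply/funext => v; rewrite mxE E.
  exact: cst_continuous.
have qt v : tree (pt [:: k] (q v)) by apply: pt_tree => //; split.
have [Q QE] := choice (fun v => set_type_surj (qt v)).
apply: (@covering_dim_ge R n (set_type tree) Q (fun x => \row_i set_val x [:: k] ord0 (lift ord0 i))).
- apply: set_type_continuous; under eq_fun do rewrite QE.
  by move=> v; apply: (@continuous_at_comp _ V E q); [exact: cq|exact: pt_continuous].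
- apply: row_continuous => i.
  have -> : (fun z : set_type tree => (\row_i0 set_val z [:: k] ord0 (lift ord0 i0) : 'rV[R]_n) ord0 i) =
      (fun z => set_val z [:: k] ord0 (lift ord0 i)) by apply/funext => z; rewrite mxE.
  exact: coordinate_continuous (@set_coord_continuous R _ V tree [:: k]) _.
move=> v vc; apply/rowP => i; rewrite !mxE QE pt_self mxE liftK.
have /andP[v1 v2] := vc i; rewrite clamp_id; first by lra.
by apply/andP; split; lra.
Qed.

Lemma tree_dim k : act [:: k] -> covering_dim (set_type tree) n.
Proof. by move=> ka; split; [exact: tree_dim_le|move=> m; exact: tree_dim_ge ka]. Qed.

End tree_dimension.

(** * The wild sets of a labelled tree *)

Section wild_in_metric.
Variables (R : realType) (n : nat) (M : metricType R).
Notation S := (@sphere R n).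
Notation b0 := (@sphere_base R n).
Implicit Types (A K : set M) (x : M).

(** Null-homotopy inside A, for maps to the ambient space. *)
Definition null_in A (g : S -> M) := exists (c : M) (H : S * unit_interval R -> M),
  [/\ continuous H, forall p, A (H p), forall s, H (s, unit_interval0) = g s &
      forall s, H (s, unit_interval1) = c].

(** The iterated wild sets are wild sets of subspaces of subspaces. This form refers to
the ambient metric space only, where a sequence of balls turns maps in all
neighbourhoods into a convergent sequence. *)
Lemma wild_subsetP K A (x : set_type K) : A `<=` K ->
  wild_subset R n (set_val @^-1` A : set (set_type K)) x <->
  A (set_val x) /\ forall U, nbhs (set_val x) U -> exists g : S -> M,
    [/\ continuous g, g b0 = set_val x, forall s, A (g s) /\ U (g s) & ~ null_in A g].
Proof.
move=> AK; pose A' : set (set_type K) := set_val @^-1` A.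
pose emb (u : set_type A') : M := set_val (set_val u).
have cemb : continuous emb.
  move=> u; apply: (@continuous_at_comp _ _ _ (set_val : set_type A' -> set_type K));
    exact: set_val_continuous.
have embA u : A (emb u) by exact: (set_valP u).
have emb_inj : injective emb by move=> u u' e; apply: val_inj; apply: val_inj.
have embP z : A z -> exists u, emb u = z.
  move=> Az; have [k ke] := set_type_surj (AK _ Az).
  have kA : A' k by rewrite /A' /= ke.
  by have [u ue] := set_type_surj kA; exists u; rewrite /emb ue.
have lift_cont (Z : topologicalType) (f : Z -> set_type A') : continuous (fun z => emb (f z)) -> continuous f.
  by move=> cf; do 2 apply: set_type_continuous.
split.
  move=> [u [f [cf fb fess fx]] ux]; split; first by rewrite -ux; exact: embA.
  move=> U xU; have uU : nbhs u (emb @^-1` U) by apply: cemb; rewrite /emb ux.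
  have [k0 hk] := fx _ uU; exists (fun s => emb (f k0 s)); split.
  - by move=> s; apply: (@continuous_at_comp _ _ _ (f k0)); [exact: cf|exact: cemb].
  - by rewrite fb /emb ux.
  - by move=> s; split; [exact: embA|apply: (hk k0 (leqnn _)); exists s].
  move=> [c [H [cH HA H0 H1]]]; apply: (fess k0).
  have [h hE] := choice (fun p => embP _ (HA p)).
  exists (h (b0, unit_interval1)), h; split.
  - by apply: lift_cont; under eq_fun do rewrite hE.
  - by move=> s; apply: emb_inj; rewrite hE H0.
  - by move=> s; apply: emb_inj; rewrite !hE !H1.
move=> [Ax near_x]; have [u ux] := embP _ Ax.
have bk k : nbhs (set_val x) (ball (set_val x) (k.+1%:R^-1 : R)).
  by apply: nbhsx_ballx; rewrite invr_gt0.
have [g gP] := choice (fun k => near_x _ (bk k)).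
have gA k s : A (g k s) by have [_ _ /(_ s)[]] := gP k.
have [f fE] := choice (fun ks : nat * S => embP _ (gA ks.1 ks.2)).
exists u; last by apply: val_inj.
exists (fun k s => f (k, s)); split.
- by move=> k; apply: lift_cont; under eq_fun do rewrite fE /=; have [] := gP k.
- by move=> k; apply: emb_inj; rewrite fE ux /=; have [] := gP k.
- move=> k [c [H [cH H0 H1]]]; have [_ _ _] := gP k; apply.
  exists (emb c), (fun p => emb (H p)); split.
  + by move=> p; apply: (@continuous_at_comp _ _ _ H); [exact: cH|exact: cemb].
  + by move=> p; exact: embA.
  + by move=> s; rewrite H0 fE.
  + by move=> s; rewrite H1.
move=> U [_ [[W1 [W oW <-] <-] Wu WU]].
have : nbhs (set_val x) W by apply: open_nbhs_nbhs; split=> //; rewrite -ux.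
move=> /nbhs_ballP[e /= e0 eW].
have [k0 ke] : exists k, k.+1%:R^-1 < e :> R.
  by have [k] := ltr_add_invr (y := 0) (x := e) e0; rewrite add0r; exists k.
exists k0 => k kk _ [s _ <-]; apply: WU; apply: eW; rewrite -/(emb _) fE /=.
have [_ _ /(_ s)[_ +] _] := gP k; apply: le_ball.
by apply: le_trans (ltW ke); rewrite lef_pV2 ?posrE ?ltr0n // ler_nat.
Qed.

End wild_in_metric.

Section labelled_tree.
Variables (R : realType) (n : nat).
Notation V := 'rV[R]_n.+1.
Notation E := (family node V).
Notation pole := (@pole R n).
Notation b0 := (@sphere_base R n).
Implicit Types (s t : node) (u v w : V) (x y : E) (k : nat) (a c : Ord).

Variable att : nat -> V.
Hypothesis norm_att : forall k, `|att k| = 1.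
Hypothesis att_pole : forall k, att k != pole.
Variable lab : node -> option Ord.
Let act s := exists a, lab s = Some a.
Hypothesis act_nil : act [::].
Hypothesis act_tail : forall k s, act (k :: s) -> act s.
Hypothesis act_wf : well_founded (fun t s => act t /\ exists k, t = k :: s).
Hypothesis n_gt0 : (0 < n)%N.

(** A label may fail to decrease only at an only child: there are then no further
children of that node that would make gluing points wild. *)
Hypothesis lab_edge : forall s k a c, lab s = Some a -> lab (k :: s) = Some c ->
  (c < a)%O \/ (s = [::] \/ (a < c)%O) /\ forall k', act (k' :: s) -> k' = k.

(** The source of wildness. The bound m makes the attached spheres small. *)
Hypothesis lab_dense : forall s a c v (e : R) m, lab s = Some a -> (c < a)%O -> `|v| = 1 -> 0 < e ->
  exists k, [/\ (m <= k)%N, `|att k - v| <= e & exists2 d, lab (k :: s) = Some d & (c <= d)%O].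

Notation tree := (tree att act).
Notation pt := (pt att).
Notation stem := (stem att).
Notation anchor := (anchor att).

Lemma coord_of_continuous (Z : topologicalType) (f : Z -> E) t :
  continuous f -> continuous (fun q => f q t).
Proof.
by move=> cf q; apply: (@continuous_at_comp Z E V f (fun y : E => y t) q (cf q)); exact: coordinate_cont.
Qed.

Definition level c : set E := \bigcup_(s in [set s | exists2 a, lab s = Some a & (c <= a)%O]) cell att s.

Lemma level_tree c : level c `<=` tree.
Proof. by move=> x [s [a sa _] xs]; exists s => //; exists a. Qed.

Lemma level_cell c s a x : lab s = Some a -> (c <= a)%O -> cell att s x -> level c x.
Proof. by move=> sa ca xs; exists s => //; exists a. Qed.

Lemma level_pt c s a v : lab s = Some a -> (c <= a)%O -> carrier s v -> level c (pt s v).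
Proof. by move=> sa ca cv; apply: level_cell sa ca _; exists v. Qed.

Lemma tree_eq x : tree x -> tree_eqs att act x.
Proof. by rewrite (treeE norm_att att_pole act_nil act_tail act_wf). Qed.

(** Only finitely many nodes have a code below N. *)
Lemma large_children s N : exists m, forall k, (m <= k)%N -> (N <= choice.pickle (k :: s))%N.
Proof.
pose L := [seq head 0%N t | t <- pmap (@choice.unpickle node) (iota 0 N)].
exists (\max_(i <- L) i).+1 => k kL; rewrite leqNgt; apply/negP => h.
have : k \in L.
  apply/mapP; exists (k :: s) => //; rewrite mem_pmap; apply/mapP.
  by exists (choice.pickle (k :: s)); rewrite ?choice.pickleK // mem_iota.
by move=> /(leq_bigmax_seq (F := id)) /(_ isT); rewrite leqNgt kL.
Qed.

Lemma normalize_base : normalize (set_val b0) = pole.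
Proof. by rewrite set_valE /= normalize_id //; exact: norm_pole. Qed.

Lemma normalize_sphere_continuous : continuous (fun s : @sphere R n => normalize (set_val s)).
Proof.
move=> s; apply: (@continuous_at_comp _ V V (set_val : @sphere R n -> V)); first exact: set_val_continuous.
by apply: normalize_continuous; exact: sphere_neq0.
Qed.

(** Near the pole of the source the map follows the path p from [pt s v] to the foot of
the child k, and elsewhere it wraps around that child. A null-homotopy in the level would
give one of [squash] in the coordinate at the child. *)
Lemma whisker_map c s a k d v (p : R -> V) (e : R) N :
  lab s = Some a -> (c <= a)%O -> lab (k :: s) = Some d -> (c <= d)%O ->
  continuous p -> p 0 = v -> p 1 = anchor s k -> (forall r : R, carrier s (p r)) ->
  (forall r : R, `|v - p r| < e) -> 0 < e -> (N <= choice.pickle (k :: s))%N ->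
  exists g : @sphere R n -> E, [/\ continuous g, g b0 = pt s v,
    forall q, level c (g q) /\ forall t, (choice.pickle t < N)%N -> `|pt s v t - g q t| < e &
    ~ null_in (level c) g].
Proof.
move=> sa ca kd cd cp p0 p1 pS pe e0 Nk.
pose h (q : @sphere R n) := normalize (set_val q).
have h1 q : `|h q| = 1 by rewrite norm_normalize ?sphere_neq0.
pose g q : E := fun t => if t == k :: s then squash pole (h q)
  else if t == s then p (whisker pole (h q)) else stem s t.
have g_near q : whisker pole (h q) < 1 -> g q = pt s (p (whisker pole (h q))).
  move=> w1; apply/funext => t; rewrite /g (squash_pole (@norm_pole R n) w1) /pt.
  case: (eqVneq t (k :: s)) => [->|//].
  by rewrite eq_sym (cat_cons_neq [::]) (stem_above _ s [::] k).
have g_far q : whisker pole (h q) = 1 -> g q = pt (k :: s) (squash pole (h q)).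
  by move=> w1; apply/funext => t; rewrite /g w1 p1 /pt.
exists g; split.
- apply: family_continuous => t q; rewrite /g.
  case: (eqVneq t (k :: s)) => _.
    apply: (@continuous_at_comp _ V V h); first exact: normalize_sphere_continuous.
    by apply: squash_continuous; exact: h1.
  case: (eqVneq t s) => _; last exact: (@cst_continuous _ V).
  apply: (@continuous_at_comp _ R V (fun q => whisker pole (h q))); last exact: cp.
  apply: (@continuous_at_comp _ V R h); first exact: normalize_sphere_continuous.
  exact: whisker_continuous.
- have hb : h b0 = pole by exact: normalize_base.
  by rewrite g_near hb whisker_pole ?p0.
- move=> q; split.
    have [w1|w1] := ltP (whisker pole (h q)) 1; first by rewrite g_near //; exact: level_pt sa ca _.
    have w1' : whisker pole (h q) = 1.
      by apply/eqP; rewrite eq_le w1 andbT; have /andP[] := clamp_itv (4 * `|h q - pole|).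
    rewrite g_far //; apply: level_pt kd cd _; split=> //.
    by apply: norm_squash; exact: h1.
  move=> t tN; rewrite /g; case: (eqVneq t (k :: s)) => [tk|tk].
    by move: tN; rewrite tk ltnNge Nk.
  by rewrite /pt; case: (eqVneq t s) => // _; rewrite subrr normr0.
move=> [z [H [cH HA H0 H1]]].
apply: (@squash_essential R n (fun q => H q (k :: s)) (z (k :: s))).
- exact: coord_of_continuous.
- move=> q; apply: norm1_neq0; apply: (@norm_tree R n att norm_att act).
  exact: level_tree (HA q).
- by move=> q; rewrite H0 /g eqxx.
- by move=> q; rewrite H1.
Qed.

(** The child is attached at distance at most d from v, so the path to it can be kept
close to v, and its code is at least N, so wrapping around it is invisible to the
coordinates that define the neighbourhood. *)
Lemma level_wild c x U : level (OrdS c) x -> nbhs x U -> exists g : @sphere R n -> E,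
  [/\ continuous g, g b0 = x, forall q : @sphere R n, level c (g q) /\ U (g q) & ~ null_in (level c) g].
Proof.
move=> [s [a sa ca] [v cv <-]] /nbhs_familyP[N [e [e0 eU]]].
have {}ca : (c < a)%O by apply: lt_le_trans ca; exact: ltOrdS.
have [m mN] := large_children s N.
pose d : R := minr (1 / 2) (e / 4).
have d0 : 0 < d by rewrite lt_min; apply/andP; split; lra.
have d1 : d < 1 by rewrite gt_min; apply/orP; left; lra.
have de : 3 * d < e.
  by apply: (@le_lt_trans _ _ (3 * (e / 4))); [rewrite ler_pM2l // ge_min lexx orbT|lra].
have [k [mk kv [f kf cf]]] := lab_dense m sa ca cv.1 d0.
have [p [cp p0 p1 pS pe]] : exists p : R -> V, [/\ continuous p, p 0 = v, p 1 = anchor s k,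
    forall r : R, carrier s (p r) & forall r : R, `|v - p r| < e].
  clear eU; case: s sa cv kf mN => [|j s] sa cv kf mN.
    exists (cst v); split=> //; [by move=> t; exact: cvg_cst|exact: cv.2|].
    by move=> t; rewrite subrr normr0.
  have [p [cp p0 p1 pS]] := joined_close cv.1 (norm_att k) kv d1.
  exists p; split=> // t; first by split=> //; have [] := pS t.
  have [_ pt2] := pS t; apply: le_lt_trans de.
  rewrite (_ : v - p t = (v - att k) + (att k - p t)); last by rewrite addrA subrK.
  apply: le_trans (ler_normD _ _) _; rewrite (_ : 3 * d = d + 2 * d); last by ring.
  by apply: lerD => //; rewrite distrC.
have [g [cg gb gU gn]] := whisker_map sa (ltW ca) kf cf cp p0 p1 pS pe e0 (mN k mk).
by exists g; split=> // q; have [gl gq] := gU q; split=> //; apply: eU => t /gq.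
Qed.

(** At a node whose own sphere is not part of the level the points of the level have the
pole or a gluing point as coordinate, which leaves countably many values. *)
Lemma low_coord_const c (g : @sphere R n -> E) t : continuous g -> (forall q, level c (g q)) ->
  (forall a, lab t = Some a -> (a < c)%O) -> forall q, g q t = g b0 t.
Proof.
move=> cg gc low.
apply: (@sphere_countable_const R n n_gt0 _ (fun q => g q t) ([set pole] `|` range att)).
- exact: coord_of_continuous.
- rewrite -bigcup2E; apply: bigcup_countable => // i _; rewrite /bigcup2; case: ifP => _.
    exact/finite_set_countable/finite_set1.
  by case: ifP => // _; apply: sub_countable (card_image_le _ _) (countableP _).
- move=> q; have [s [a sa ca] [v _ <-]] := gc q.
  have ts : t != s by apply: contraTneq ca => ts; rewrite -ltNge; apply: low; rewrite ts.
  rewrite pt_out //; case: (stem_values att s t) => [->|[k ->]]; [by left|right].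
  by exists k.
Qed.

(** Straight lines to v, projected back to the sphere. *)
Lemma cell_contract c s a v (g : @sphere R n -> E) : lab s = Some a -> (c <= a)%O -> carrier s v ->
  continuous g -> (forall q, g q = pt s (g q s)) -> (forall q, carrier s (g q s)) ->
  (forall q, `|v - g q s| < 1) -> null_in (level c) g.
Proof.
move=> sa ca cv cg gs gc g1.
pose K (p : @sphere R n * unit_interval R) := normalize (mix (g p.1 s) v (set_val p.2)).
have mx0 (p : @sphere R n * unit_interval R) : mix (g p.1 s) v (set_val p.2) != 0.
  apply: close_neq0 cv.1 _; apply: le_lt_trans (g1 p.1).
  rewrite (_ : mix _ _ _ = mix v (g p.1 s) (1 - set_val p.2)); last first.
    by rewrite /mix opprB addrCA subrr addr0 addrC.
  apply: mix_dist; have := set_valP p.2; rewrite /= in_itv /= => h.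
  by rewrite set_valE subr_ge0 lerBlDr lerDl andbC.
have cgs : continuous (fun q => g q s) by exact: coord_of_continuous.
have cK : continuous K.
  move=> p; apply: (@continuous_at_comp _ V V (fun p : @sphere R n * unit_interval R => mix (g p.1 s) v (set_val p.2))).
    apply: (@mix_continuous R V _ (fun p : @sphere R n * unit_interval R => g p.1 s) (cst v)).
    + by move=> q; exact: (@continuous_at_comp _ _ V (fun p : @sphere R n * unit_interval R => p.1) (fun q => g q s) q cvg_fst (cgs _)).
    + by move=> q; exact: cvg_cst.
    + by move=> q; exact: (@continuous_at_comp _ _ R (fun p : @sphere R n * unit_interval R => p.2) (set_val : unit_interval R -> R) q cvg_snd (@set_val_continuous _ _ _)).
  by apply: normalize_continuous; exact: mx0.
exists (pt s v), (fun p => pt s (K p)); split.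
- by move=> p; apply: (@continuous_at_comp _ V E K); [exact: cK|exact: pt_continuous].
- move=> p; apply: level_pt sa ca _; split; first by rewrite norm_normalize ?mx0.
  move=> s0; rewrite /K (cv.2 s0) ((gc p.1).2 s0) /mix -scalerDl subrK scale1r normalize_id //.
  exact: norm_pole.
- by move=> q; rewrite [RHS]gs /K /= mix0 normalize_id //; have [] := gc q.
- by move=> q; rewrite /K /= mix1 normalize_id //; have [] := cv.
Qed.

Lemma suffix_compare (T : Type) (r1 r2 p1 p2 : seq T) : r1 ++ p1 = r2 ++ p2 ->
  (size p1 <= size p2)%N -> exists q, p2 = q ++ p1.
Proof.
elim: r2 r1 => [|z2 r2 IH] [|z1 r1] //= e sz.
- by exists [::]; rewrite e.
- by exists (z1 :: r1); rewrite -e.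
- have := congr1 size e; rewrite /= size_cat => h.
  by move: sz; rewrite h ltnNge leq_addl.
- by case: e => _ e; exact: IH e sz.
Qed.

(** A coordinate off the pole at s puts the point on s or above it, and thereby fixes all
coordinates at nodes that are not above s. *)
Lemma coord_below y s t : tree y -> y s != pole -> t != s ->
  (forall r k, t <> r ++ k :: s) -> y t = stem s t.
Proof.
move=> [q _ [u _ <-]] ys ts nd; have [r qE] := pt_neq ys.
case: (lastP r) qE => [|r' k] qE; first by rewrite qE pt_out.
have tq : t != q by apply/eqP => e; apply: (nd r' k); rewrite e qE cat_rcons.
rewrite pt_out //.
have [[p [j e]]|np] := pselect (exists p j, q = p ++ j :: t).
  rewrite e stem_cat; have [sz|sz] := leqP (size s) (size t).
    have [p' tE] := suffix_compare (etrans (esym qE) (etrans e (esym (cat_rcons j p t)))) sz.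
    case: (lastP p') tE => [|p'' i] tE; first by rewrite tE eqxx in ts.
    by case: (nd p'' i); rewrite tE cat_rcons.
  have [p' sE] := suffix_compare (etrans (esym e) qE) sz.
  by rewrite sE stem_cat.
have -> : stem q t = pole.
  by apply/eqP/negPn/negP => /stem_neq[p [j e]]; apply: np; exists p, j.
apply/esym/eqP/negPn/negP => /stem_neq[p [j e]]; apply: np.
by exists (rcons r' k ++ p), j; rewrite qE e catA.
Qed.

Lemma ord_leS a c : (OrdS a <= c)%O = (a < c)%O.
Proof. by rewrite leNgt ord_ltS -ltNge. Qed.

(** A coordinate at a child outside the level is constant, and at a child in the level it
is the pole, since maps near v do not reach the foot of that child. *)
Lemma above_pole c s v (g : @sphere R n -> E) : continuous g -> g b0 = pt s v ->
  (forall q, level c (g q)) ->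
  (forall k a, lab (k :: s) = Some a -> (c <= a)%O -> forall q, g q s != anchor s k) ->
  forall q r k, g q (r ++ k :: s) = pole.
Proof.
move=> cg gb gl far q r k; have te := tree_eq (level_tree (gl q)).
apply: (eqs_above att_pole r te).
have [[a ka ca]|nk] := pselect (exists2 a, lab (k :: s) = Some a & (c <= a)%O).
  have [_ _ _ h _] := te; have [//|e] := h k s.
  by have := far k a ka ca q; rewrite e eqxx.
rewrite (low_coord_const cg gl) => [|a ka]; last first.
  by rewrite ltNge; apply/negP => ca; apply: nk; exists a.
by rewrite gb (pt_above att s v [::] k).
Qed.

(** The coordinates above s are the pole by [above_pole], for maps that stay within d of
v at s. The other coordinates are constant for one of three reasons: the map stays away
from the pole of s, or s is the root, or s is an only child whose parent is the root or
lies outside the level. So the map stays on the sphere of s, close to v. *)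
Lemma contract_at c s v : lab s = Some c -> carrier s v ->
  (forall k a, lab (k :: s) = Some a -> (c <= a)%O -> v != anchor s k) ->
  [\/ v != pole, s = [::] | exists k s1, [/\ s = k :: s1,
     s1 = [::] \/ (exists2 a, lab s1 = Some a & (a < c)%O) &
     forall k', act (k' :: s1) -> k' = k]] ->
  exists2 U, nbhs (pt s v) U & forall g : @sphere R n -> E, continuous g -> g b0 = pt s v ->
    (forall q, level c (g q)) -> (forall q, U (g q)) -> null_in (level c) g.
Proof.
move=> sc cv up alt.
have [d [d0 d1 dp dup]] : exists d : R, [/\ 0 < d, d <= 1, v != pole -> d <= `|v - pole| &
    forall k a, lab (k :: s) = Some a -> (c <= a)%O -> d <= `|v - anchor s k|].
  have [e [e0 e1 ep]] : exists e : R, [/\ 0 < e, e <= 1 & v != pole -> e <= `|v - pole|].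
    have [vp|vp] := eqVneq v pole; first by exists 1.
    exists (minr 1 `|v - pole|); rewrite lt_min ltr01 normr_gt0 subr_eq0 vp !ge_min !lexx orbT.
    by split.
  have [[k [a [ka ca]]]|nk] := pselect (exists k a, lab (k :: s) = Some a /\ (c <= a)%O); last first.
    by exists e; split=> // k a ka ca; case: nk; exists k, a.
  have uniq_k k' a' : lab (k' :: s) = Some a' -> k' = k.
    move=> ka'; have [|[_ h]] := lab_edge sc ka; first by rewrite ltNge ca.
    by apply: h; exists a'.
  exists (minr e `|v - anchor s k|); split.
  - by rewrite lt_min e0 normr_gt0 subr_eq0 (up k a).
  - by rewrite ge_min e1.
  - by move=> /ep h; rewrite ge_min h.
  - by move=> k' a' ka' _; rewrite (uniq_k k' a' ka') ge_min lexx orbT.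
exists [set y | `|v - y s| < d].
  have c1 : continuous (fun y : E => `|y s - v|).
    move=> y; apply: (@continuous_at_comp E V R (fun y : E => y s - v)); last exact: norm_continuous.
    exact: (@subC_continuous R n E (fun y : E => y s) v (@coordinate_cont _ _ _ s)).
  have : nbhs (pt s v) ((fun y : E => `|y s - v|) @^-1` [set r | r < d]).
    by apply: (nbhs_preimage c1 (@open_lt _ d)); rewrite /= pt_self subrr normr0.
  by apply: filterS => y /=; rewrite distrC.
move=> g cg gb gl gU.
have gt q := level_tree (gl q).
have high q r k : g q (r ++ k :: s) = pole.
  apply: (above_pole cg gb gl) => k' a ka ca q'; apply/eqP => e.
  by have := lt_le_trans (gU q') (dup k' a ka ca); rewrite e ltxx.
have low q t : t != s -> (forall r k, t <> r ++ k :: s) -> g q t = stem s t.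
  move=> ts nd; case: alt => [vp|s0|[k [s1 [sE s1c s1u]]]].
  - apply: coord_below => //; apply/eqP => e.
    by have := lt_le_trans (gU q) (dp vp); rewrite e ltxx.
  - case: (lastP t) ts nd => [|r k] ts nd; first by rewrite s0 eqxx in ts.
    by case: (nd r k); rewrite s0 cats1.
  have gs1 : g q s1 = anchor s1 k.
    case: s1c => [->|[a s1a ac]]; first by have [_ _ -> _ _] := tree_eq (gt q).
    rewrite (low_coord_const cg gl) => [|a']; last by rewrite s1a => -[<-].
    by rewrite gb sE (pt_child_anchor att s1 [::] k).
  have [->|ts1] := eqVneq t s1; first by rewrite gs1 sE (stem_cat att [::]).
  have [[r [k' tE]]|nd1] := pselect (exists r k', t = r ++ k' :: s1).
    have kk : k' <> k.
      move=> kk; case: (lastP r) tE => [|r' j] tE; first by rewrite sE tE kk eqxx in ts.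
      by apply: (nd r' j); rewrite tE sE kk cat_rcons.
    rewrite tE (eqs_above att_pole _ (tree_eq (gt q))); last first.
      have [_ h _ _ _] := tree_eq (gt q); have [ak|//] := h (k' :: s1).
      by case: kk; exact: s1u.
    apply/esym/eqP/negPn/negP => /stem_neq[p [j e]].
    have := congr1 size e; rewrite sE /= !size_cat /= size_cat /=; lia.
  have s10 : s1 != [::].
    apply/eqP => s10; case: (lastP t) ts1 nd1 => [|r j] ts1 nd1; first by rewrite s10 eqxx in ts1.
    by apply: nd1; exists r, j; rewrite s10 cats1.
  rewrite (@coord_below (g q) s1 t) //; first by rewrite sE /= (negbTE ts1).
    by rewrite gs1; case: (s1) s10 => // *; exact: att_pole.
  by move=> r j e; apply: nd1; exists r, j.
apply: (cell_contract sc (lexx _) cv cg) => q.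
- apply/funext => t; rewrite /pt; case: (eqVneq t s) => [->//|ts].
  have [[r [k ->]]|nd] := pselect (exists r k, t = r ++ k :: s); first by rewrite high stem_above.
  by apply: low => // r k e; apply: nd; exists r, k.
- split; first exact: (@norm_tree R n att norm_att act).
  by move=> s0; rewrite s0; have [_ _ -> _ _] := tree_eq (gt q).
- exact: lt_le_trans (gU q) d1.
Qed.

(** Choose the sphere of label c to which [contract_at] applies: the given one, unless x is
the root and an only child of label c is attached there. *)
Lemma level_tame c x : level c x -> ~ level (OrdS c) x ->
  exists2 U, nbhs x U & forall g : @sphere R n -> E, continuous g -> g b0 = x ->
    (forall q, level c (g q)) -> (forall q, U (g q)) -> null_in (level c) g.
Proof.
move=> [s [a sa ca] [v cv xE]] nx.
have top t b : lab t = Some b -> cell att t x -> (b <= c)%O.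
  move=> tb tx; rewrite leNgt; apply/negP => cb; apply: nx.
  by apply: level_cell tb _ tx; rewrite ord_leS.
have ac : a = c by apply/le_anti; rewrite ca andbT; apply: top sa _; exists v.
subst a x; have [vp|vp] := eqVneq v pole; last first.
  apply: (contract_at sa cv); last by constructor 1.
  move=> k b kb cb; apply/eqP => vk.
  have bc : (b <= c)%O.
    by apply: top kb _; exists pole; [exact: carrier_pole|rewrite pt_cons vk].
  have {cb}bc : b = c by apply/le_anti; rewrite bc cb.
  have [|[[s0|]]] := lab_edge sa kb; rewrite ?bc ?ltxx //.
  by rewrite (cv.2 s0) eqxx in vp.
subst v; case: s sa cv top nx => [|k s1] sa cv top nx.
  have [[k [b [kb cb]]]|nk] := pselect (exists k b, lab [:: k] = Some b /\ (c <= b)%O).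
    have e : pt [::] pole = pt [:: k] pole by rewrite pt_cons.
    have bc : b = c.
      apply/le_anti; rewrite cb andbT; apply: top kb _.
      by exists pole; [exact: carrier_pole|rewrite e].
    rewrite bc in kb; have := @contract_at c [:: k] pole kb (@carrier_pole R n _).
    rewrite -e; apply.
      by move=> j d _ _; rewrite eq_sym; exact: att_pole.
    constructor 3; exists k, [::]; split=> //; first by left.
    by have [|[_ h]] := lab_edge sa kb; first by rewrite ltxx.
  apply: (contract_at sa cv); last by constructor 2.
  by move=> k b kb cb; case: nk; exists k, b.
apply: (contract_at sa cv).
  by move=> j b _ _; rewrite eq_sym; exact: att_pole.
have [b s1b] : act s1 by apply: (act_tail (k := k)); exists c.
have bc : (b <= c)%O.
  by apply: top s1b _; exists (anchor s1 k); [exact: carrier_anchor|rewrite -pt_cons].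
constructor 3; exists k, s1; split=> //.
  have [|[[s10|bc'] _]] := lab_edge s1b sa; first by rewrite ltNge bc.
    by left.
  by right; exists b.
by have [|[_ h]] := lab_edge s1b sa; first by rewrite ltNge bc.
Qed.

(** A point other than the pole of its sphere lies on that sphere and, as gluing point, on
those of children. *)
Lemma cell_normal s v t : s = [::] \/ v != pole -> cell att t (pt s v) ->
  t = s \/ exists k, t = k :: s.
Proof.
move=> sv [u cu e]; have step t' u' : (t' = [::] \/ u' != pole) -> pt t' u' = pt s v -> t' = s.
  move=> tu {}e.
  have h (p q : node) w w' : q = [::] \/ w' != pole -> pt p w = pt q w' -> exists r, p = r ++ q.
    case=> [->|w'p] e'; first by exists p; rewrite cats0.
    by apply: (@pt_neq _ _ att p w); rewrite e' pt_self.
  have [r tE] := h _ _ _ _ sv e; have [r' sE] := h _ _ _ _ tu (esym e).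
  have := congr1 size sE; rewrite {1}tE !size_cat => /esym/eqP.
  by rewrite tE; case: r {tE} => //= z r; rewrite -[X in _ == X -> _]add0n addnA eqn_add2r addnS.
case: t cu e => [|k t'] cu e; first by left; apply: step e; left.
have [up|up] := eqVneq u pole; last by left; apply: step e; right.
right; exists k; congr (_ :: _); apply: (@step t' (anchor t' k)); last by rewrite -pt_cons -up.
by case: (t') => [|? ?]; [left|right; exact: att_pole].
Qed.

(** The spheres through x are that of its normal form s and those of children of s. If one
of these children has a label at least that of s, it is an only child. *)
Lemma top_label x : tree x -> exists a, forall c, level c x <-> (c <= a)%O.
Proof.
move=> tx; have [s [v [[a sa] cv -> sv]]] := normal_form norm_att act_tail tx.
have [[k [b [kb kx ab]]]|nk] := pselect (exists k b,
    [/\ lab (k :: s) = Some b, cell att (k :: s) (pt s v) & (a <= b)%O]).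
  exists b => c; split; last by move=> cb; exact: level_cell kb cb kx.
  move=> [t [d td cd] /(cell_normal sv)[tE|[k' tE]]]; move: td; rewrite tE => td.
    by move: td; rewrite sa => -[ad]; apply: le_trans cd _; rewrite -ad.
  have [|[_ h]] := lab_edge sa kb; first by rewrite ltNge ab.
  have kk : k' = k by apply: h; exists d.
  by move: td; rewrite kk kb => -[bd]; rewrite bd.
exists a => c; split; last by move=> ca; exact: level_pt sa ca cv.
move=> [t [d td cd] tx']; apply: le_trans cd _; rewrite leNgt; apply/negP => ad.
have [tE|[k tE]] := cell_normal sv tx'; move: td; rewrite tE => td.
  by move: td ad; rewrite sa => -[->]; rewrite ltxx.
by apply: nk; exists k, d; split=> //; [rewrite -tE|exact: ltW].
Qed.

(** Transfinite induction. The successor step is [level_wild] and [level_tame]; at limits the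
greatest label at a point is at least c as soon as it is at least all smaller ordinals. *)
Lemma wild_iter_level c : wild_iter R n (set_type tree) c = set_val @^-1` level c.
Proof.
elim: c / (ord_lt_wf c) => c _ IH.
have [c0|c0] := pselect (c = Ord0).
  rewrite c0 wild_iter0; apply/seteqP; split=> // x _ /=.
  by have [s [a sa] xs] := set_valP x; apply: level_cell sa (ord_le0x _) xs.
have [[b cE]|nS] := pselect (exists b, c = OrdS b).
  rewrite cE wild_iterS IH ?cE ?ltOrdS //.
  apply/seteqP; split=> x.
    move=> /(wild_subsetP n x (@level_tree b))[xb xw]; apply: contrapT => nx.
    have [U xU hU] := level_tame xb nx; have [g [cg gb gU]] := xw U xU; apply.
    by apply: hU => // q; have [] := gU q.
  move=> xb; apply/(wild_subsetP n x (@level_tree b)); split.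
    have [a aP] := top_label (set_valP x).
    by apply/aP; apply: ltW; rewrite -ord_leS; apply/aP.
  by move=> U xU; exact: level_wild xb xU.
have lc : ord_limit c by split.
rewrite wild_iter_limit //; apply/seteqP; split=> x.
  move=> xc; have [a aP] := top_label (set_valP x).
  apply/aP; rewrite leNgt; apply/negP => ac.
  have ac' : (OrdS a < c)%O.
    by rewrite lt_neqAle ord_leS ac andbT; apply/eqP => e; apply: nS; exists a.
  have := xc _ ac'; rewrite IH // => /aP.
  by rewrite leNgt ltOrdS.
move=> xc m mc; rewrite IH //=; have [a aP] := top_label (set_valP x).
by apply/aP; apply: le_trans (ltW mc) _; apply/aP.
Qed.

Lemma level_nonempty c s a : lab s = Some a -> (c <= a)%O -> level c !=set0.
Proof. by move=> sa ca; exists (pt s pole); apply: level_pt sa ca _; exact: carrier_pole. Qed.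

Theorem tree_wild_rank l : (forall s a, lab s = Some a -> (a < l)%O) ->
  (forall c, (c < l)%O -> exists s, exists2 a, lab s = Some a & (c <= a)%O) ->
  is_wild_rank R n (set_type tree) l /\ wild_iter R n (set_type tree) l = set0.
Proof.
move=> below cof.
have empty c : (l <= c)%O -> wild_iter R n (set_type tree) c = set0.
  move=> lc; rewrite wild_iter_level; apply/seteqP; split=> // x [s [a sa ca] _].
  by have := lt_le_trans (below _ _ sa) (le_trans lc ca); rewrite ltxx.
split; last exact: empty.
split; first by move=> c lc; rewrite !empty.
move=> c stable; rewrite leNgt; apply/negP => cl.
have [s [a sa ca]] := cof c cl; have [y yc] := level_nonempty sa ca.
have [x xy] := set_type_surj (level_tree yc).
have h0 := stable l (ltW cl); rewrite (empty l (lexx _)) in h0.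
move: h0; rewrite wild_iter_level => /seteqP[h _].
by apply: (h x); rewrite /= xy.
Qed.

Lemma wild_iter_root l : lab [::] = Some l ->
  (forall s a, lab s = Some a -> (l <= a)%O -> s = [::]) ->
  exists x : set_type tree, wild_iter R n (set_type tree) l = [set x].
Proof.
move=> l0 top; have tr : tree (pt [::] pole) by exists [::]; [exists l|exists pole => //; exact: carrier_pole].
have [x xE] := set_type_surj tr; exists x; rewrite wild_iter_level; apply/seteqP; split=> y.
  move=> [s [a sa la] [v cv e]]; apply: val_inj; rewrite -!set_valE xE -e.
  by rewrite (top _ _ sa la) in cv *; rewrite (cv.2 erefl).
by move=> ->; rewrite /= xE; apply: level_pt l0 (lexx _) _; exact: carrier_pole.
Qed.

End labelled_tree.

(** * Labels and attaching points *)

Lemma nat_inj_unbounded (f : nat -> nat) m : injective f -> exists i, (m <= f i)%N.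
Proof.
move=> fi; apply: contrapT => h.
have : (size (map f (iota 0 m.+1)) <= size (iota 0 m))%N.
  apply: uniq_leq_size; first by rewrite map_inj_uniq ?iota_uniq.
  move=> _ /mapP[i _ ->]; rewrite mem_iota add0n ltnNge.
  by apply/negP => mi; apply: h; exists i.
by rewrite size_map !size_iota ltnn.
Qed.

(** The spare coordinate of the pairs repeats each value infinitely often. *)
Lemma repeated_enumeration (T : countType) (x0 : T) :
  exists f : nat -> T, forall x m, exists2 k, (m <= k)%N & f k = x.
Proof.
exists (fun k => (odflt (x0, 0%N) (choice.unpickle k)).1) => x m.
have [i mi] := @nat_inj_unbounded (fun i => choice.pickle (x, i)) m
  (fun i j e => (congr1 snd (pcan_inj choice.pickleK e))).
by exists (choice.pickle (x, i)) => //; rewrite choice.pickleK.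
Qed.

Lemma countable_enumeration (T : Type) (A : set T) : countable A ->
  exists e : nat -> option T, forall x, A x -> exists j, e j = Some x.
Proof.
move=> /countable_injP[f fi].
have h (j : nat) : exists o : option T, forall x, A x -> f x = j -> o = Some x.
  have [[x [Ax fx]]|nx] := pselect (exists x, A x /\ f x = j).
    by exists (Some x) => y Ay fy; congr Some; apply: fi; rewrite ?inE // fx.
  by exists None => x Ax fx; case: nx; exists x.
have [e eP] := choice h; exists e => x Ax; exists (f x); exact: eP.
Qed.

(** Directions of rational vectors. The default value, opposite to the pole, replaces those
whose last coordinate vanishes, among which is the pole. *)
Lemma dense_directions (R : realType) (n : nat) : (0 < n)%N ->
  exists d : 'rV[rat]_n.+1 -> 'rV[R]_n.+1, (forall q, `|d q| = 1 /\ d q != pole R n) /\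
    forall (v : 'rV[R]_n.+1) (e : R), `|v| = 1 -> 0 < e -> exists q, `|d q - v| <= e.
Proof.
move=> n0; pose w (q : 'rV[rat]_n.+1) : 'rV[R]_n.+1 := normalize (map_mx ratr q).
have mx : ord_max != ord0 :> 'I_n.+1 by rewrite -val_eqE /= -lt0n.
exists (fun q : 'rV[rat]_n.+1 => if q ord0 ord_max == 0 then - pole R n else w q); split=> [q|v e v1 e0].
  case: ifPn => q0.
    rewrite normrN norm_pole; split=> //; apply/eqP => e.
    have /eqP := congr1 (fun u : 'rV[R]_n.+1 => u ord0 ord0) e.
    by rewrite !mxE eqxx /= eqNr oner_eq0.
  have r0 : ratr (q ord0 ord_max) != 0 :> R by rewrite fmorph_eq0.
  have q1 : map_mx ratr q != 0 :> 'rV[R]_n.+1.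
    by apply: contraNneq r0 => e; have := congr1 (fun u : 'rV[R]_n.+1 => u ord0 ord_max) e; rewrite !mxE => ->.
  rewrite norm_normalize //; split=> //; apply: contraNneq r0 => e.
  have /eqP := congr1 (fun u : 'rV[R]_n.+1 => u ord0 ord_max) e.
  by rewrite !mxE (negbTE mx) andbF mulf_eq0 invr_eq0 normr_eq0 (negbTE q1).
pose d := minr (1 / 2) (e / 2).
have d0 : 0 < d by rewrite lt_min; apply/andP; split; lra.
have d1 : d < 1 by rewrite gt_min; apply/orP; left; lra.
have de : 2 * d <= e by rewrite mulrC -ler_pdivlMr // ge_min lexx orbT.
(* Rational coordinates are chosen nonzero, to stay clear of the default value. *)
have qj (j : 'I_n.+1) : exists q : rat, q != 0 /\ `|v ord0 j - ratr q| <= d.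
  have [vj|vj] := leP 0 (v ord0 j).
    have [|q] := @rat_in_itvoo R (v ord0 j) (v ord0 j + d); first lra.
    rewrite in_itv /= => /andP[q1 q2]; exists q; split; last by rewrite ler_norml; lra.
    by apply: contraTneq q1 => ->; rewrite raddf0 -leNgt.
  have [|q] := @rat_in_itvoo R (v ord0 j - d) (v ord0 j); first lra.
  rewrite in_itv /= => /andP[q1 q2]; exists q; split; last by rewrite ler_norml; lra.
  by apply: contraTneq q2 => ->; rewrite raddf0 -leNgt ltW.
have [q qP] := choice qj; exists (\row_j q j); rewrite mxE.
have [/negbTE -> _] := qP ord_max.
rewrite distrC; apply: le_trans de; apply: normalize_dist => //.
by apply/rV_norm_le => [|j]; [exact: ltW|rewrite !mxE; have [] := qP j].
Qed.

Section labelled_by_rule.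
Variables (l : Ord) (l0 : Ord) (rule : node -> Ord -> nat -> option Ord).

Fixpoint rule_label (s : node) : option Ord :=
  if s is k :: s' then obind (fun a => rule s' a k) (rule_label s') else Some l0.

Lemma rule_label_cons k s c : rule_label (k :: s) = Some c ->
  exists2 a, rule_label s = Some a & rule s a k = Some c.
Proof. by move=> /=; case: (rule_label s) => [a|//] /= h; exists a. Qed.

(** From depth two on the labels strictly decrease, so there branches are finite by
induction on labels. *)
Lemma rule_label_wf :
  (forall s a k c, (1 < size s)%N -> rule s a k = Some c -> (c < a)%O) ->
  well_founded (fun t s => (exists a, rule_label t = Some a) /\ exists k, t = k :: s).
Proof.
move=> desc.
have deep s : (1 < size s)%N -> Acc (fun t s => (exists a, rule_label t = Some a) /\ exists k, t = k :: s) s.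
  move=> s2; constructor=> t [[a sa] [k tE]]; subst t.
  have {}s2 : (1 < size (k :: s))%N by exact: ltnW.
  move: (k :: s) sa s2 => {k}{}s.
  elim: a / (ord_lt_wf a) s => a _ IH s sa s2; constructor=> t [[c kc] [k tE]]; subst t.
  have [a' sa' ac] := rule_label_cons kc.
  have ca : (c < a)%O by move: sa; rewrite sa' => -[<-]; exact: desc ac.
  by apply: IH ca _ kc _; exact: ltnW.
have mid s : (0 < size s)%N -> Acc (fun t s => (exists a, rule_label t = Some a) /\ exists k, t = k :: s) s.
  by move=> s1; constructor=> _ [_ [k ->]]; exact: deep.
by move=> s; constructor=> _ [_ [k ->]]; exact: mid.
Qed.

Hypothesis l0_lt : (l0 < l)%O.
Hypothesis rule_lt : forall s a k c, (a < l)%O -> rule s a k = Some c -> (c < l)%O.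

Lemma rule_label_lt s a : rule_label s = Some a -> (a < l)%O.
Proof.
elim: s a => [|k s IH] a; first by case=> <-.
by move=> /rule_label_cons[c /IH cl]; exact: rule_lt.
Qed.

End labelled_by_rule.

Section standard_rule.
Variables (l : Ord) (e : nat -> option Ord).
Hypothesis e_onto : forall c, (c < l)%O -> exists j, e j = Some c.

(** The label offered to child number j of a node of label a by the enumeration e. *)
Definition below_rule (a : Ord) (j : nat) : option Ord :=
  if e j is Some c then if (c < a)%O then Some c else None else None.

Lemma below_rule_lt a j c : below_rule a j = Some c -> (c < a)%O.
Proof. by rewrite /below_rule; case: (e j) => [b|//]; case: ifP => // ba [<-]. Qed.

Lemma below_rule_onto a c : (a < l)%O -> (c < a)%O -> exists j, below_rule a j = Some c.
Proof.
move=> al ca; have [j ej] := e_onto (lt_trans ca al).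
by exists j; rewrite /below_rule ej ca.
Qed.

End standard_rule.

(** * Spaces of prescribed wild rank *)

Section wild_space.
Variables (R : realType) (n : nat) (l l0 : Ord) (rule : node -> Ord -> nat -> option Ord).
Variable att : nat -> 'rV[R]_n.+1.
Hypothesis n_gt0 : (0 < n)%N.
Hypothesis norm_att : forall k, `|att k| = 1.
Hypothesis att_pole : forall k, att k != pole R n.
Hypothesis l0_lt : (l0 < l)%O.
Hypothesis rule_lt : forall s a k c, (a < l)%O -> rule s a k = Some c -> (c < l)%O.
(** Labels may increase only at depth at most two, and at only children. *)
Hypothesis rule_desc : forall s a k c, rule s a k = Some c ->
  (c < a)%O \/ [/\ (size s < 2)%N, s = [::] \/ (a < c)%O & forall k', rule s a k' <> None -> k' = k].
Hypothesis rule_dense : forall s a c v (e : R) m, (a < l)%O -> (c < a)%O -> `|v| = 1 -> 0 < e ->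
  exists k, [/\ (m <= k)%N, `|att k - v| <= e & rule s a k = Some c].
Hypothesis rule_root : exists k c, rule [::] l0 k = Some c.
Let lab := rule_label l0 rule.
Hypothesis cofinal : forall c, (c < l)%O -> exists s, exists2 a, lab s = Some a & (c <= a)%O.

Theorem wild_space_exists : exists (X : topologicalType) (x : X),
    [/\ peano_continuum R X, covering_dim X n, is_wild_rank R n X l, wild_iter R n X l = set0 &
    (forall s a, lab s = Some a -> (l0 <= a)%O -> s = [::]) -> wild_iter R n X l0 = [set x]].
Proof.
pose act s := exists a, lab s = Some a.
have act_nil : act [::] by exists l0.
have act_tail k s : act (k :: s) -> act s.
  by move=> [c /rule_label_cons[a sa _]]; exists a.
have act_wf : well_founded (fun t s => act t /\ exists k, t = k :: s).
  apply: (@rule_label_wf l0 rule) => s a k c s2 /rule_desc[//|[]].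
  by rewrite ltnNge s2.
have lab_edge s k a c : lab s = Some a -> lab (k :: s) = Some c ->
    (c < a)%O \/ (s = [::] \/ (a < c)%O) /\ forall k', act (k' :: s) -> k' = k.
  move=> sa /rule_label_cons[b]; rewrite -/lab sa => -[<-] {b} /rule_desc[|[_ h u]]; first by left.
  right; split=> // k' [c' /rule_label_cons[b]]; rewrite -/lab sa => -[<-] {b} e.
  by apply: u; rewrite e.
have lab_dense s a c v (e : R) m : lab s = Some a -> (c < a)%O -> `|v| = 1 -> 0 < e ->
    exists k, [/\ (m <= k)%N, `|att k - v| <= e & exists2 d, lab (k :: s) = Some d & (c <= d)%O].
  move=> sa ca v1 e0; have al := rule_label_lt l0_lt rule_lt sa.
  have [k [mk kv rk]] := @rule_dense s a c v e m al ca v1 e0.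
  by exists k; split=> //; exists c => //; rewrite /lab /= -/lab sa.
have [k0 act_k] : exists k, act [:: k].
  by have [k [c kc]] := rule_root; exists k, c.
have [rk rk0] := @tree_wild_rank R n att norm_att att_pole lab act_nil act_tail act_wf n_gt0
  lab_edge lab_dense l (@rule_label_lt _ _ _ l0_lt rule_lt) cofinal.
have pc := tree_peano norm_att att_pole act_nil act_tail act_wf n_gt0.
have dm := tree_dim norm_att att_pole act_nil act_tail act_wf act_k.
have [root|nroot] := pselect (forall s a, lab s = Some a -> (l0 <= a)%O -> s = [::]).
  have [x xE] := wild_iter_root norm_att att_pole act_nil act_tail act_wf n_gt0
    lab_edge lab_dense (erefl : lab [::] = Some l0) root.
  by exists (set_type (tree att act)), x.
have tr : tree att act (pt att [::] (pole R n)).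
  by exists [::] => //; exists (pole R n) => //; exact: carrier_pole.
have [x _] := set_type_surj tr.
by exists (set_type (tree att act)), x.
Qed.

End wild_space.

Lemma ord_limit_succ l c : ord_limit l -> (c < l)%O -> (OrdS c < l)%O.
Proof.
move=> [_ nS] cl; rewrite lt_neqAle ord_leS cl andbT.
by apply/eqP => e; apply: nS; exists c.
Qed.

Theorem theorem1p1 (R : realType) (n : nat) (lambda : Ord) :
  (1 <= n)%N ->
  countable [set mu : Ord | (mu < lambda)%O] ->
  (OrdS Ord0 <= lambda)%O ->
  exists (X : topologicalType) (x : X),
    [/\ peano_continuum R X,
        covering_dim X n,
        is_wild_rank R n X lambda,
        wild_iter R n X lambda = set0 &
        forall mu : Ord, lambda = OrdS mu ->
          (OrdS (OrdS Ord0) <= lambda)%O ->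
          wild_iter R n X mu = [set x]].
Proof.
move=> n1 ctb l1.
have [e e_onto] := countable_enumeration ctb.
have [d [dP d_dense]] := dense_directions R n1.
have [f fP] := repeated_enumeration (0 : 'rV[rat]_n.+1, 0%N, 0%N).
(* The index k of a child encodes a triple: the point where it is attached, the position
of its label in the enumeration of the ordinals below lambda, and, for limit lambda, the
position of the ordinal that determines the label of its only child. *)
pose att k := d (f k).1.1; pose std a k := below_rule e a (f k).1.2.
have norm_att k : `|att k| = 1 by have [] := dP (f k).1.1.
have att_pole k : att k != pole R n by have [] := dP (f k).1.1.
have std_dense a c v (r : R) m : (a < lambda)%O -> (c < a)%O -> `|v| = 1 -> 0 < r ->
    exists k, [/\ (m <= k)%N, `|att k - v| <= r & std a k = Some c].
  move=> al ca v1 r0; have [q qv] := d_dense v r v1 r0.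
  have [j jc] := below_rule_onto e_onto al ca; have [k mk fk] := fP (q, j, 0%N) m.
  by exists k; rewrite /att /std fk.
have std_lt a k c : std a k = Some c -> (c < a)%O by exact: below_rule_lt.
have [[mu lE]|nS] := pselect (exists mu, lambda = OrdS mu).
  (* The exception is for mu = 0: one child of label 0 gives the space dimension n. *)
  pose rule (s : node) (a : Ord) (k : nat) := if (s == [::]) && (a == Ord0)
    then (if k == 0%N then Some Ord0 else None) else std a k.
  have rule_lt s a k c : (a < lambda)%O -> rule s a k = Some c -> (c < lambda)%O.
    rewrite /rule; case: ifP => _ al; last by move=> /std_lt h; exact: lt_trans h al.
    by case: ifP => // _ [<-]; rewrite -ord_leS.
  have rule_desc s a k c : rule s a k = Some c -> (c < a)%O \/ [/\ (size s < 2)%N,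
      s = [::] \/ (a < c)%O & forall k', rule s a k' <> None -> k' = k].
    rewrite /rule; case: ifP => [/andP[/eqP -> _]|_ /std_lt]; last by left.
    case: eqP => // -> _; right; split=> //; first by left.
    by move=> k'; case: eqP.
  have mu_lt : (mu < lambda)%O by rewrite lE ltOrdS.
  have [|||X [x [h1 h2 h3 h4 h5]]] :=
    @wild_space_exists R n lambda mu rule att n1 norm_att att_pole mu_lt rule_lt rule_desc.
  - move=> s a c v r m al ca v1 r0; have [k [mk kv kc]] := std_dense a c v r m al ca v1 r0.
    exists k; split=> //; rewrite /rule; case: ifP => // /andP[_ /eqP a0].
    by move: ca; rewrite a0 ltNge ord_le0x.
  - have [m0|m0] := eqVneq mu Ord0; first by exists 0%N, Ord0; rewrite /rule m0 eqxx.
    have m0' : (Ord0 < mu)%O by rewrite lt_neqAle eq_sym m0 ord_le0x.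
    have [k [_ _ kc]] := std_dense mu Ord0 _ 1 0%N mu_lt m0' (norm_pole R n) ltr01.
    by exists k, Ord0; rewrite /rule (negbTE m0) andbF.
  - by move=> c; rewrite lE ord_ltS => cm; exists [::], mu.
  exists X, x; split=> // mu'; rewrite lE => /OrdS_inj <- m2; apply: h5 => s a.
  have m0 : mu != Ord0.
    by apply: contraTneq m2 => ->; rewrite ord_leS ltxx.
  have {}m0 (s' : node) : (s' == [::]) && (mu == Ord0) = false by rewrite (negbTE m0) andbF.
  have le s' b : rule_label mu rule s' = Some b -> (b <= mu)%O.
    by move=> /(rule_label_lt mu_lt rule_lt); rewrite lE ord_ltS.
  case: s => // k s /rule_label_cons[b sb bk]; rewrite leNgt => /negP[].
  apply: lt_le_trans (le _ _ sb); move: bk; rewrite /rule; case: ifP => [/andP[/eqP s0 /eqP b0]|_ /std_lt//].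
  by move: sb; rewrite s0 => -[mb]; have := m0 s; rewrite s0 mb b0 !eqxx.
have lim : ord_limit lambda.
  split=> // l0; move: l1; rewrite ord_leS l0 ltxx //.
(* Successors of the ordinals below lambda, hence cofinal in lambda and positive. *)
pose nu k := if e (f k).2 is Some c then if (c < lambda)%O then OrdS c else OrdS Ord0 else OrdS Ord0.
have one_lt : (OrdS Ord0 < lambda)%O by apply: ord_limit_succ => //; rewrite -ord_leS.
have nu_lt k : (nu k < lambda)%O.
  by rewrite /nu; case: (e _) => // c; case: ifP => // cl; exact: ord_limit_succ.
have nu_gt0 k : (Ord0 < nu k)%O.
  by rewrite /nu; case: (e _) => [c|]; [case: ifP|] => *; rewrite ord_ltS // ord_le0x.
(* Root of label 1, children of label 0; each has the only child 0, of label nu j. *)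
pose rule (s : node) (a : Ord) (k : nat) := if s is [:: j] then
  if a == Ord0 then if k == 0%N then Some (nu j) else None else std a k else std a k.
have ruleP s a k : (exists j, [/\ s = [:: j], a = Ord0 & rule s a k = if k == 0%N then Some (nu j) else None])
    \/ rule s a k = std a k.
  rewrite /rule; case: s => [|j [|j' s]]; [by right| |by right].
  by case: eqP => [->|]; [left; exists j|right].
have rule_lt s a k c : (a < lambda)%O -> rule s a k = Some c -> (c < lambda)%O.
  move=> al; have [[j [_ _ ->]]|->] := ruleP s a k; last by move=> /std_lt h; exact: lt_trans h al.
  by case: eqP => // _ [<-].
have rule_desc s a k c : rule s a k = Some c -> (c < a)%O \/ [/\ (size s < 2)%N,
    s = [::] \/ (a < c)%O & forall k', rule s a k' <> None -> k' = k].
  have [[j [-> -> ->]]|->] := ruleP s a k; last by move=> /std_lt; left.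
  case: eqP => // -> [<-]; right; split=> //; first by right.
  by move=> k'; rewrite /rule eqxx; case: eqP.
have z_lt : (Ord0 < OrdS Ord0)%O by exact: ltOrdS.
have [|||X [x [h1 h2 h3 h4 _]]] :=
  @wild_space_exists R n lambda (OrdS Ord0) rule att n1 norm_att att_pole one_lt rule_lt rule_desc.
- move=> s a c v r m al ca v1 r0; have [k [mk kv kc]] := std_dense a c v r m al ca v1 r0.
  exists k; split=> //; have [[j [_ a0 _]]|->//] := ruleP s a k.
  by move: ca; rewrite a0 ltNge ord_le0x.
- have [k [_ _ kc]] := std_dense (OrdS Ord0) Ord0 _ 1 0%N one_lt z_lt (norm_pole R n) ltr01.
  by exists k, Ord0.
- move=> c cl; have [i ic] := e_onto c cl; have [j jz] := below_rule_onto e_onto one_lt z_lt.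
  have [k _ fk] := fP (0, j, i) 0%N; exists [:: 0%N; k], (OrdS c); last by rewrite ltW ?ltOrdS.
  by rewrite /= /std fk /= jz /= eqxx /nu fk /= ic cl.
by exists X, x; split=> // mu lE; case: nS; exists mu.
Qed.
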